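(* Let $N\ge 2$ be an even integer and $T>0$. The Dirac operator on the lens space $\mathcal{L}_N=SU(2)/\mathbb{Z}_N$ equipped with the Berger metric corresponding to the parameter $T$ and the trivial spin structure has the following spectrum: (1) for every $n\in 2\mathbb{N}+1$ and every $m\in\mathbb{Z}$ with $-n\le mN-1<n$, the two eigenvalues $$-\frac T2 \pm\sqrt{(1+n)^2+m^2N^2\left(\frac1{T^2}-1\right)},$$ each with multiplicity $n+1$; (2) for every $m\in\mathbb{N}$, the eigenvalue $-\frac T2-\frac{mN}{T}$ with multiplicity $2mN$. Here the spectrum is understood as a multiset: the multiplicity of a real number $\lambda$ is the sum of the contributions of all parameter values listed that yield $\lambda$.
   Context: $\mathbb{N}=\{0,1,2,\dots\}$ (a contribution with multiplicity $0$ contributes nothing). In $\mathfrak{su}(2)$ let $I=\begin{pmatrix} i&0\\0&-i\end{pmatrix}$, $J=\begin{pmatrix}0&1\\-1&0\end{pmatrix}$, $K=\begin{pmatrix}0&i\\i&0\end{pmatrix}$. For $T>0$ the Berger metric with parameter $T$ on $SU(2)$ is the left-invariant metric for which $X_1=\frac1T I,\ X_2=J,\ X_3=K$ is an orthonormal basis ($T=1$ is the round metric). Let $\mathbb{Z}_N\subset SU(2)$ be the cyclic group of order $N$ generated by $\mathrm{diag}(e^{2\pi i/N},e^{-2\pi i/N})$; the Berger metric descends to $\mathcal{L}_N=SU(2)/\mathbb{Z}_N=\{g\mathbb{Z}_N\}$. The trivial spin structure is the one corresponding to the lift of the isotropy representation $\mathbb{Z}_N\to SO(3)$ given by the inclusion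 $\iota:\mathbb{Z}_N\to SU(2)\cong\mathrm{Spin}(3)$, i.e. the principal bundle $SU(2)\times_\iota \mathrm{Spin}(3)$. Concretely, spinor fields are the functions $\psi:SU(2)\to\mathbb{C}^2$ with $\psi(g\gamma)=\gamma^{-1}\psi(g)$ for all $\gamma\in\mathbb{Z}_N$, and the Dirac operator is $$D\psi = I\,(X_1\psi)+J\,(X_2\psi)+K\,(X_3\psi)-\left(\tfrac T2+\tfrac1T\right)\psi,$$ where $(X\psi)(g)=\frac{d}{dt}\big|_{t=0}\psi(g\exp(tX))$ and $I,J,K$ act as matrices on $\mathbb{C}^2$. *)

(* Defs.v *)
From HB Require Import structures.
From mathcomp Require Import all_boot all_order all_algebra.
From mathcomp Require Import all_classical all_reals all_analysis.
From mathcomp Require Import complex.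

Set Implicit Arguments.
Unset Strict Implicit.
Unset Printing Implicit Defensive.

Import Order.TTheory GRing.Theory Num.Theory.
Import numFieldNormedType.Exports.

Local Open Scope classical_set_scope.
Local Open Scope ring_scope.
Local Open Scope complex_scope.

(* The topology of R[i] given by the modulus; the library provides it for an
   abstract numClosedFieldType but not for R[i]. *)
HB.instance Definition _ (R : realType) := NormedModule.copy R[i] R[i]^o.

Section BergerLens.
Variable R : realType.
Local Notation C := R[i].

Definition mx2 (a b c d : C) : 'M[C]_2 :=
  \matrix_(i < 2, j < 2)
    if i == 0 then (if j == 0 then a else b) else (if j == 0 then c else d).

Record su2 := SU2 {
  su2_mx :> 'M[C]_2;
  _ : (su2_mx \is unitarymx) && (\det su2_mx == 1) }.

HB.instance Definition _ := [isSub for su2_mx].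
HB.instance Definition _ := [Choice of su2 by <:].
HB.instance Definition _ := Topological.copy su2 (initial_topology su2_mx).

Fact su2_mulP (g h : su2) :
  (g *m h \is unitarymx) && (\det (g *m h) == 1).
Proof.
case: g h => [A /andP[uA /eqP dA]] [B /andP[uB /eqP dB]] /=.
by rewrite mul_unitarymx // det_mulmx dA dB mulr1 eqxx.
Qed.
Definition su2_mul (g h : su2) : su2 := SU2 (su2_mulP g h).

Fact su2_oneP : ((1%:M : 'M[C]_2) \is unitarymx) && (\det (1%:M : 'M[C]_2) == 1).
Proof. by rewrite det1 eqxx andbT; apply/unitarymxP; rewrite trmx1 map_mx1 mulmx1. Qed.
Definition su2_one : su2 := SU2 su2_oneP.

Fact su2_unit (g : su2) : (g : 'M[C]_2) \in unitmx.
Proof. by have /andP[u _] := valP g; exact: unitarymx_unit u. Qed.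

Fact su2_invP (g : su2) :
  (invmx g \is unitarymx) && (\det (invmx g) == 1).
Proof.
have /andP[u /eqP d] := valP g.
by rewrite det_inv [\det g]d invr1 eqxx andbT invmx_unitary // trmxC_unitary.
Qed.
Definition su2_inv (g : su2) : su2 := SU2 (su2_invP g).

Fact su2_mulA : associative su2_mul.
Proof. by move=> g h k; apply: val_inj; rewrite /= mulmxA. Qed.
Fact su2_mul1 : left_id su2_one su2_mul.
Proof. by move=> g; apply: val_inj; rewrite /= mul1mx. Qed.
Fact su2_mulr1 : right_id su2_one su2_mul.
Proof. by move=> g; apply: val_inj; rewrite /= mulmx1. Qed.
Fact su2_mulV : left_inverse su2_one su2_inv su2_mul.
Proof. by move=> g; apply: val_inj; rewrite /= mulVmx // su2_unit. Qed.
Fact su2_mulrV : right_inverse su2_one su2_inv su2_mul.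
Proof. by move=> g; apply: val_inj; rewrite /= mulmxV // su2_unit. Qed.

HB.instance Definition _ :=
  isGroup.Build su2 su2_mulA su2_mul1 su2_mulr1 su2_mulV su2_mulrV.

Definition expm (X : 'M[C]_2) : 'M[C]_2 :=
  limn (fun n => \sum_(k < n) (k`!%:R : C)^-1 *: X ^+ k).

(* For X in su(2) the exponential lies in SU(2), so that the default value 1
   of insubd plays no role. *)
Definition one_param (X : 'M[C]_2) (t : R) : su2 :=
  insubd su2_one (expm (t%:C *: X)).

Definition su2_I : 'M[C]_2 := mx2 'i 0 0 (- 'i).
Definition su2_J : 'M[C]_2 := mx2 0 1 (-1) 0.
Definition su2_K : 'M[C]_2 := mx2 0 'i 'i 0.

Definition spinor := su2 -> 'cV[C]_2.

Definition diff_quot (X : 'M[C]_2) (psi : spinor) (g : su2) (t : R) : 'cV[C]_2 :=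
  (t^-1)%:C *: (psi (g * one_param X t)%g - psi g).

Definition derivable_along (X : 'M[C]_2) (psi : spinor) : Prop :=
  forall g, cvg (diff_quot X psi g t @[t --> (0 : R)^']).

Definition derive_along (X : 'M[C]_2) (psi : spinor) : spinor :=
  fun g => lim (diff_quot X psi g t @[t --> (0 : R)^']).

(* I, J, K span the Lie algebra su(2), so the associated left-invariant vector
   fields form a global frame of the tangent bundle of SU(2): a function is C^k
   iff all its iterated derivatives along this frame up to order k exist and are
   continuous. *)
Fixpoint class_C (k : nat) (psi : spinor) : Prop :=
  if k is k'.+1 then
    continuous psi /\
    forall X, X \in [:: su2_I; su2_J; su2_K] ->
      derivable_along X psi /\ class_C k' (derive_along X psi)
  else continuous psi.

Definition smooth (psi : spinor) : Prop := forall k, class_C k psi.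

Definition expi (theta : R) : C := cos theta +i* sin theta.

Fact expiN (theta : R) : expi theta * expi (- theta) = 1.
Proof.
apply/eqP; rewrite /expi cosN sinN eq_complex /= -!expr2 mulrN opprK.
by rewrite -!expr2 cos2Dsin2 mulrN mulrC addNr !eqxx.
Qed.

Fact expi_conj (theta : R) : expi theta * (expi theta)^* = 1.
Proof. by rewrite -[RHS](expiN theta) /expi cosN sinN. Qed.

Definition zgen_mx (N : nat) : 'M[C]_2 :=
  mx2 (expi (2 * pi / N%:R)) 0 0 (expi (- (2 * pi / N%:R))).

Fact zgen_mxP N : (zgen_mx N \is unitarymx) && (\det (zgen_mx N) == 1).
Proof.
apply/andP; split.
  apply/unitarymxP/matrixP => i j; rewrite !mxE !big_ord_recl big_ord0 !mxE /=.
  case: i => [[|[|i]] //= ?]; case: j => [[|[|j]] //= ?];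
    by rewrite ?(mul0r, mulr0, conjC0, addr0, add0r) ?expi_conj.
apply/eqP; rewrite (expand_det_row _ ord0) !big_ord_recl big_ord0 !mxE /=.
by rewrite /cofactor !det_mx11 !mxE /= !mul0r !addr0 expr0 mul1r expiN.
Qed.

Definition zgen (N : nat) : su2 := SU2 (zgen_mxP N).

Definition ZN (N : nat) : set su2 := [set gamma | exists k, gamma = (zgen N ^+ k)%g].

(* Smooth sections of the spinor bundle of SU(2)/Z_N for the trivial spin
   structure, seen as Z_N-equivariant functions on SU(2). *)
Definition lens_spinor (N : nat) : set spinor :=
  [set psi | smooth psi /\
     forall g gamma, ZN N gamma -> psi (g * gamma)%g = su2_mx (gamma^-1)%g *m psi g].

(* Orthonormal frame of the Berger metric with parameter T. *)
Definition X1 (T : R) : 'M[C]_2 := (T^-1)%:C *: su2_I.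
Definition X2 : 'M[C]_2 := su2_J.
Definition X3 : 'M[C]_2 := su2_K.

Definition dirac (T : R) (psi : spinor) : spinor := fun g =>
  su2_I *m derive_along (X1 T) psi g
  + su2_J *m derive_along X2 psi g
  + su2_K *m derive_along X3 psi g
  - (T / 2 + 1 / T)%:C *: psi g.

Definition dirac_eigenspace (N : nat) (T : R) (lambda : C) : set spinor :=
  [set psi | lens_spinor N psi /\ forall g, dirac T psi g = lambda *: psi g].

(* Used for complex vector subspaces V only: then b is a basis of V. *)
Definition has_dim (V : set spinor) (d : nat) : Prop :=
  exists b : 'I_d -> spinor, (forall i, V (b i)) /\
    forall psi, V psi ->
      exists! c : 'rV[C]_d, forall g, psi g = \sum_(i < d) c 0 i *: b i g.

(* The sign is + for s = false and - for s = true. *)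
Definition eigenvalue1 (N : nat) (T : R) (n : nat) (m : int) (s : bool) : R :=
  - (T / 2) + (-1) ^+ s *
    Num.sqrt ((1 + n%:R) ^+ 2 + m%:~R ^+ 2 * N%:R ^+ 2 * (1 / T ^+ 2 - 1)).

Definition eigenvalue2 (N : nat) (T : R) (m : nat) : R :=
  - (T / 2) - m%:R * N%:R / T.

(* Triples (n, m, s) listing the first family of eigenvalues; the multiplicity
   of lambda is the sum of the contributions of all parameters giving lambda. *)
Definition index1 (N : nat) : set (nat * int * bool) :=
  [set p | let: (n, m, _) := p in
     odd n /\ - (n%:Z) <= m * N%:Z - 1 < n%:Z].

Definition listed_multiplicity (N : nat) (T : R) (lambda : R) : \bar R :=
  (\esum_(p in index1 N `&`
             [set p | let: (n, m, s) := p in eigenvalue1 N T n m s = lambda])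
      (p.1.1.+1)%:R%:E
   + \esum_(m in [set m : nat | eigenvalue2 N T m = lambda]) (2 * m * N)%:R%:E)%E.

End BergerLens.

(* Main.v *)
(* Write a spinor as a pair (f1, f2) of functions on SU(2), and let A, E, F be the
   complex combinations of the left-invariant fields I, J, K acting on functions as
   an sl2-triple (up to scale). With x = lambda + T/2 and t = 1/T the eigenvalue
   equation reads E f2 = (x + t) f1 + t A f1 and F f1 = (x + t) f2 - t A f2; it
   commutes with the total weight (A + 1, A - 1), and the Z_N-equivariance says that
   this weight is divisible by N.

   Neither Haar measure nor Peter-Weyl is needed. Eliminating f2 gives a second order
   elliptic equation, and the maximum principle applied to |A f|^2 + B |f|^2 bounds
   A f by f: the iterates A^j f grow geometrically, so f, being periodic along
   t |-> exp(t I), has finitely many Fourier modes, i.e. is a finite sum of weight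
   vectors. The maximum principle also bounds the weights of an eigenfunction of E F,
   which makes the raising operator F nilpotent on it and quantizes its eigenvalue.
   The space of highest weight vectors of weight n has the basis a^(n-j) c^j, where
   (a, c) is the first column of the matrix: contracting the lowering chain E^j f with
   a suitable polynomial in matrix entries gives a function with vanishing
   derivatives. The dimensions of all weight spaces follow by the ladder. *)

Require Import Defs.
From HB Require Import structures.
From mathcomp Require Import all_boot all_order all_algebra.
From mathcomp Require Import all_classical all_reals all_analysis.
From mathcomp Require Import complex ring lra zify.
Set Implicit Arguments.
Unset Strict Implicit.
Unset Printing Implicit Defensive.

Import Order.TTheory GRing.Theory Num.Theory.
Import numFieldNormedType.Exports.
Local Open Scope classical_set_scope.
Local Open Scope ring_scope.
Local Open Scope complex_scope.

(** * Unit quaternions and one-parameter subgroups *)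

Section Quaternions.
Variable R : realType.
Local Notation C := R[i].

(** Smoothness is defined by iterated derivatives along I, J, K, so the bracket relations have to be
    extracted from difference quotients; this needs a factorization of group elements with control
    near 1. The elimination is elliptic because E F is -(J^2 + K^2) up to first order, while the two
    first order equations make E F a quadratic polynomial in A with leading coefficient -t^2:
    together they give t^2 I^2 + J^2 + K^2. The element E F + (A + 1)^2 is the Casimir, with value
    (n + 1)^2 on highest weight n. A solution of total weight k has components of weights k - 1 and
    k + 1, and the product of its two equations reads x^2 - k^2 t^2 = (n + 1)^2 - k^2; this is the
    first family, with n odd because N, hence k, is even. At an extremal weight one component
    vanishes and the linear equation x = -|k| t remains; k = mN and k = -mN contribute mN dimensions
    each, which explains the multiplicity 2mN. The eigenvalue is a complex number throughout, so
    that reality of the spectrum is a result of the same case analysis. *)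

Definition qw (g : su2 R) : R := complex.Re (su2_mx g 0 0).
Definition qx (g : su2 R) : R := complex.Im (su2_mx g 0 0).
Definition qy (g : su2 R) : R := complex.Re (su2_mx g 0 1).
Definition qz (g : su2 R) : R := complex.Im (su2_mx g 0 1).

Definition quat_mx (w x y z : R) : 'M[C]_2 :=
  mx2 (w +i* x) (y +i* z) ((- y) +i* z) (w -i* x).

Lemma mx2E (a b c d : C) :
  ((mx2 a b c d 0 0 = a) * (mx2 a b c d 0 1 = b)) *
  ((mx2 a b c d 1 0 = c) * (mx2 a b c d 1 1 = d)).
Proof. by rewrite /mx2 !mxE. Qed.

Lemma eq_mx2 (A B : 'M[C]_2) : A 0 0 = B 0 0 -> A 0 1 = B 0 1 ->
  A 1 0 = B 1 0 -> A 1 1 = B 1 1 -> A = B.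
Proof.
have ord2 (i : 'I_2) : i = 0 \/ i = 1.
  by case: i => [[|[|i]] //= ?]; [left|right]; apply: val_inj.
move=> e00 e01 e10 e11; apply/matrixP => i j.
by case: (ord2 i) => ->; case: (ord2 j) => ->.
Qed.

Lemma mulmx2 (A B : 'M[C]_2) i j : (A *m B) i j = A i 0 * B 0 j + A i 1 * B 1 j.
Proof.
have l0 : lift ord0 ord0 = 1 :> 'I_2 by apply: val_inj.
by rewrite mxE !big_ord_recl big_ord0 addr0 l0.
Qed.

Lemma det2 (A : 'M[C]_2) : \det A = A 0 0 * A 1 1 - A 0 1 * A 1 0.
Proof.
rewrite (expand_det_row _ 0) !big_ord_recl big_ord0 addr0 /cofactor !det_mx11 !mxE.
have -> : lift ord0 ord0 = 1 :> 'I_2 by apply: val_inj.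
have -> : lift 1 (0 : 'I_1) = 0 :> 'I_2 by apply: val_inj.
by rewrite /= expr0 mul1r expr1 mulN1r mulrN.
Qed.

(** The first row (a, b) being a unit vector, orthogonality of the rows and determinant 1 form a
    linear system for the second row, solved by (- conj b, conj a). So SU(2) is the unit sphere of
    the quaternions. *)
Lemma su2E (g : su2 R) : su2_mx g = quat_mx (qw g) (qx g) (qy g) (qz g) /\
  qw g ^+ 2 + qx g ^+ 2 + qy g ^+ 2 + qz g ^+ 2 = 1.
Proof.
have /andP[/unitarymxP U /eqP D] := valP g.
have U00 := congr1 (fun M : 'M[C]_2 => M 0 0) U.
have U01 := congr1 (fun M : 'M[C]_2 => M 1 0) U.
rewrite det2 in D.
move: U00 U01 D; rewrite !mulmx2 /quat_mx /qw /qx /qy /qz !mxE /=.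
case EA: (su2_mx g 0 0) => [a1 a2]; case EB: (su2_mx g 0 1) => [b1 b2].
set c := su2_mx g 1 0; set d := su2_mx g 1 1.
move=> H0 H1 D.
pose A : C := a1 +i* a2; pose B : C := b1 +i* b2.
rewrite -/A -/B in H0 H1 D.
have n1 : a1 ^+ 2 + a2 ^+ 2 + b1 ^+ 2 + b2 ^+ 2 = 1.
  move: H0 => /eqP; rewrite eq_complex /= => /andP[/eqP H _].
  by rewrite -H; ring.
have cE : c = - B^*%R.
  apply/eqP; rewrite -subr_eq0 opprK; apply/eqP.
  transitivity (c * (1 - (A * A^*%R + B * B^*%R)) + A * (c * A^*%R + d * B^*%R)
     + B^*%R * (1 - (A * d - B * c))); first by ring.
  by rewrite H0 H1 D; ring.
have dE : d = A^*%R.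
  apply/eqP; rewrite -subr_eq0; apply/eqP.
  transitivity (d * (1 - (A * A^*%R + B * B^*%R)) + B * (c * A^*%R + d * B^*%R)
     - A^*%R * (1 - (A * d - B * c))); first by ring.
  by rewrite H0 H1 D; ring.
split=> //; apply: eq_mx2; rewrite !mx2E ?EA ?EB //=.
by rewrite -[LHS]/c cE /=; apply/eqP; rewrite eq_complex /= opprK !eqxx.
Qed.

Lemma qnorm (g : su2 R) : qw g ^+ 2 + qx g ^+ 2 + qy g ^+ 2 + qz g ^+ 2 = 1.
Proof. by have [] := su2E g. Qed.

Definition quat (w x y z : R) : su2 R := insubd (su2_one R) (quat_mx w x y z).

Lemma quatK w x y z : w ^+ 2 + x ^+ 2 + y ^+ 2 + z ^+ 2 = 1 ->
  su2_mx (quat w x y z) = quat_mx w x y z.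
Proof.
move=> n1.
suff P : (quat_mx w x y z \is unitarymx) && (\det (quat_mx w x y z) == 1).
  exact: (insubdK (su2_one R) P).
apply/andP; split.
  apply/unitarymxP; apply: eq_mx2; rewrite mulmx2 !mxE /=;
    apply/eqP; rewrite eq_complex /=; apply/andP; split; apply/eqP;
    rewrite ?mulr1n ?mulr0n -?n1; ring.
by rewrite det2 !mx2E; apply/eqP/eqP; rewrite eq_complex /=; apply/andP;
  split; apply/eqP; rewrite -?n1; ring.
Qed.

Lemma quat_coordK (g : su2 R) : quat (qw g) (qx g) (qy g) (qz g) = g.
Proof. by apply: val_inj; rewrite /= quatK ?qnorm // -(su2E g).1. Qed.

Lemma quat_coord w x y z : w ^+ 2 + x ^+ 2 + y ^+ 2 + z ^+ 2 = 1 ->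
  [/\ qw (quat w x y z) = w, qx (quat w x y z) = x,
     qy (quat w x y z) = y & qz (quat w x y z) = z].
Proof. by move=> n1; rewrite /qw /qx /qy /qz quatK // !mx2E. Qed.

Lemma eq_quat (g h : su2 R) : qw g = qw h -> qx g = qx h -> qy g = qy h ->
  qz g = qz h -> g = h.
Proof. by move=> e1 e2 e3 e4; rewrite -[g]quat_coordK -[h]quat_coordK e1 e2 e3 e4. Qed.

Lemma su2_mulE (g h : su2 R) : su2_mx (g * h)%g = su2_mx g *m su2_mx h.
Proof. by []. Qed.

Lemma qmul (g h : su2 R) :
  [/\ qw (g * h)%g = qw g * qw h - qx g * qx h - qy g * qy h - qz g * qz h,
      qx (g * h)%g = qw g * qx h + qx g * qw h + qy g * qz h - qz g * qy h,
      qy (g * h)%g = qw g * qy h + qy g * qw h + qz g * qx h - qx g * qz h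
    & qz (g * h)%g = qw g * qz h + qz g * qw h + qx g * qy h - qy g * qx h].
Proof.
have M : su2_mx (g * h)%g =
    quat_mx (qw g) (qx g) (qy g) (qz g) *m quat_mx (qw h) (qx h) (qy h) (qz h).
  by rewrite su2_mulE; congr (_ *m _); [exact: (su2E g).1|exact: (su2E h).1].
move: (qw g) (qx g) (qy g) (qz g) (qw h) (qx h) (qy h) (qz h) M => w x y z w' x' y' z' M.
by split; rewrite /qw /qx /qy /qz M mulmx2 !mx2E /=; ring.
Qed.

Lemma qone : [/\ qw 1%g = 1, qx 1%g = 0, qy 1%g = 0 & qz 1%g = 0].
Proof. by rewrite /qw /qx /qy /qz !mxE. Qed.

End Quaternions.

Variant axis := axI | axJ | axK.

Definition axis_mx (R : realType) (a : axis) : 'M[R[i]]_2 :=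
  match a with axI => su2_I R | axJ => su2_J R | axK => su2_K R end.

(* Locked: unification must not compare one-parameter subgroups by unfolding them. *)
HB.lock Definition ex (R : realType) (a : axis) (t : R) : su2 R :=
  match a with
  | axI => quat (cos t) (sin t) 0 0
  | axJ => quat (cos t) 0 (sin t) 0
  | axK => quat (cos t) 0 0 (sin t)
  end.

Section Exponentials.
Variable R : realType.

Lemma ex_coord a (t : R) : [/\ qw (ex a t) = cos t,
  qx (ex a t) = if a is axI then sin t else 0,
  qy (ex a t) = if a is axJ then sin t else 0
  & qz (ex a t) = if a is axK then sin t else 0].
Proof. by rewrite ex.unlock /ex.body; case: a => /=; apply: quat_coord; rewrite ?expr0n ?addr0 cos2Dsin2. Qed.

Lemma exD a (s t : R) : ex a (s + t) = (ex a s * ex a t)%g.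
Proof.
have [w1 x1 y1 z1] := ex_coord a s; have [w2 x2 y2 z2] := ex_coord a t.
have [w3 x3 y3 z3] := ex_coord a (s + t); have [w4 x4 y4 z4] := qmul (ex a s) (ex a t).
have /[dup] := cosD s t; have /[dup] := sinD s t.
move: w1 x1 y1 z1 w2 x2 y2 z2 w3 x3 y3 z3 w4 x4 y4 z4.
move: (ex a (s + t)) (ex a s) (ex a t) (cos (s + t)) (sin (s + t)) (cos s) (sin s) (cos t) (sin t).
move=> g3 g1 g2 c3 s3 c1 s1 c2 s2 -> -> -> -> -> -> -> -> w3 x3 y3 z3 w4 x4 y4 z4 _ s3E _ c3E.
apply: eq_quat; [rewrite w3 w4|rewrite x3 x4|rewrite y3 y4|rewrite z3 z4];
  rewrite ?c3E ?s3E; case: (a);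
  by rewrite ?(mulr0, mul0r, addr0, subr0, add0r, sub0r, oppr0) // addrC mulrC.
Qed.

Lemma ex0 a : ex a 0 = 1%g :> su2 R.
Proof.
have [w1 x1 y1 z1] := @ex_coord a 0; have [w2 x2 y2 z2] := qone R.
by apply: eq_quat; rewrite ?w1 ?x1 ?y1 ?z1 ?w2 ?x2 ?y2 ?z2; case: (a); rewrite ?cos0 ?sin0.
Qed.

Lemma ex_2pi a (t : R) : ex a (t + 2 * pi) = ex a t.
Proof.
rewrite exD; suff -> : ex a (2 * pi) = 1%g :> su2 R by rewrite mulg1.
have [w1 x1 y1 z1] := ex_coord a (2 * pi); have [w2 x2 y2 z2] := qone R.
have -> : (2 * pi : R) = pi *+ 2 by rewrite mulr_natl.
move: w1 x1 y1 z1; rewrite mulr_natl sin2pi cos2pi => w1 x1 y1 z1.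
by apply: eq_quat; rewrite ?w1 ?x1 ?y1 ?z1 ?w2 ?x2 ?y2 ?z2; case: (a).
Qed.
End Exponentials.

(** * Complex limits and the exponential of a square root of -1 *)

Section ComplexTopology.
Variable R : realType.
Local Notation C := R[i].

Lemma normc_le_ReIm (z : C) : `|z| <= (`|complex.Re z| + `|complex.Im z|)%:C.
Proof.
rewrite normc_def lecR -[leRHS]ger0_norm ?addr_ge0 // -sqrtr_sqr ler_wsqrtr //.
by rewrite sqrrD !real_normK ?num_real // lerD2r lerDl mulrn_wge0 // mulr_ge0.
Qed.

Lemma normc_ge_Re' (z : C) : (`|complex.Re z|)%:C <= `|z|.
Proof. exact: normc_ge_Re. Qed.

Lemma normc_ge_Im (z : C) : (`|complex.Im z|)%:C <= `|z|.
Proof.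
rewrite normc_def lecR -sqrtr_sqr ler_wsqrtr // lerDr sqr_ge0 //.
Qed.

Lemma gt0_complex (e : C) : 0 < e -> exists2 r : R, 0 < r & e = r%:C.
Proof.
case: e => a b; rewrite ltcE /= => /andP[/eqP -> a0].
by exists a.
Qed.

Lemma cvg_complexP (T : Type) (F : set_system T) (FF : Filter F) (f : T -> C) (l : C) :
  f @ F --> l <-> ((fun x => complex.Re (f x)) @ F --> complex.Re l) /\
                 ((fun x => complex.Im (f x)) @ F --> complex.Im l).
Proof.
split=> [/cvgrPdist_le fl|[/cvgrPdist_le re /cvgrPdist_le im]].
  split; apply/cvgrPdist_le => e e0; have /= := fl e%:C; rewrite ltcR => /(_ e0);
    apply: filterS => x xe; rewrite -lecR (le_trans _ xe) //.
    by case: l (f x) {fl xe} => [a b] [c d]; exact: (normc_ge_Re' ((a +i* b) - (c +i* d))).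
  by case: l (f x) {fl xe} => [a b] [c d]; exact: (normc_ge_Im ((a +i* b) - (c +i* d))).
apply/cvgrPdist_le => e /gt0_complex[r r0 ->].
have r20 : 0 < r / 2 by rewrite divr_gt0.
near=> x; apply: (le_trans (normc_le_ReIm _)).
have -> : r = r / 2 + r / 2 by rewrite -splitr.
rewrite lecR lerD //.
  have : `|complex.Re l - complex.Re (f x)| <= r / 2 by near: x; exact: re.
  by case: (l) (f x) => [a b] [c d].
have : `|complex.Im l - complex.Im (f x)| <= r / 2 by near: x; exact: im.
by case: (l) (f x) => [a b] [c d].
Unshelve. all: by end_near. Qed.

Lemma continuous_RC : continuous (fun x : R => x%:C : C).
Proof. by move=> x; apply/cvg_complexP; split=> /=; [exact: cvg_id | exact: cvg_cst]. Qed.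

Lemma continuous_Re : continuous (@complex.Re R).
Proof. by move=> x; have [] := (@cvg_complexP _ (nbhs x) _ id x).1 cvg_id. Qed.

(** Even powers of X are multiples of 1 and odd powers multiples of X, so the partial sums are those
    of the cosine and sine series. *)
Lemma expm_rot (X : 'M[C]_2) (t : R) : X ^+ 2 = - 1%:M ->
  expm (t%:C *: X) = (cos t)%:C *: 1%:M + (sin t)%:C *: X.
Proof.
move=> X2.
have Xk k : X ^+ k = (~~ odd k)%:R * (-1) ^+ k./2 *: 1%:M + (odd k)%:R * (-1) ^+ k./2 *: X.
  rewrite -{1}(odd_double_half k) exprD -mul2n exprM X2.
  rewrite -[- 1%:M]scaleN1r exprZn expr1n.
  by case: (odd k); rewrite ?expr1 ?expr0 /= ?mul0r ?mul1r ?scale0r ?add0r ?addr0 ?scalerAr ?mulr1 // -scalerAr mulr1.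
rewrite /expm.
have -> : (fun n => \sum_(k < n) (k`!%:R : C)^-1 *: (t%:C *: X) ^+ k) =
   (fun n => (series (cos_coeff t) n)%:C *: 1%:M + (series (sin_coeff t) n)%:C *: X).
  apply/funext => n; rewrite /series /= !big_mkord !rmorph_sum /= !scaler_suml -big_split /=.
  apply: eq_bigr => k _; rewrite exprZn Xk /cos_coeff /sin_coeff !scalerDr !scalerA.
  have cE b : (k`!%:R)^-1 * t%:C ^+ k * (b%:R * (-1) ^+ k./2) =
      (b%:R * (-1) ^+ k./2 * t ^+ k / k`!%:R)%:C :> C.
    by rewrite !rmorphM fmorphV !rmorphXn /= rmorphN rmorph1 !rmorph_nat; ring.
  rewrite !cE; congr (_ + _ *: _); congr (_%:C).
  rewrite /=; have [ok|] := boolP (odd k); last by rewrite /= !mul0r.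
  (* [sin_coeff] halves [k.-1], which for odd k is the same as halving k. *)
  by have -> : k./2 = k.-1./2 by lia.
apply/cvg_lim => //; apply: cvgD; apply: cvgZr_tmp.
- apply: (continuous_cvg _ (@continuous_RC (cos t))).
  by rewrite unlock; exact: (@is_cvg_series_cos_coeff R t).
- apply: (continuous_cvg _ (@continuous_RC (sin t))).
  by rewrite unlock; exact: (@is_cvg_series_sin_coeff R t).
Qed.

Lemma axis_mx_sqr a : axis_mx R a ^+ 2 = - 1%:M.
Proof.
rewrite expr2; case: a; apply: eq_mx2; rewrite [LHS]mulmx2 !mx2E !mxE /= ?mulr1n ?mulr0n;
  apply/eqP; rewrite eq_complex /=; apply/andP; split; apply/eqP; ring.
Qed.

Lemma quat_mx_rot (a : axis) (t : R) :
  su2_mx (ex a t) = (cos t)%:C *: 1%:M + (sin t)%:C *: axis_mx R a.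
Proof.
have [] := su2E (ex a t); have [-> -> -> -> -> _] := ex_coord a t.
case: a; apply: eq_mx2; rewrite !mx2E !mxE /= ?mulr1n ?mulr0n;
  apply/eqP; rewrite eq_complex /=; apply/andP; split; apply/eqP; ring.
Qed.

(** The bridge from the matrix exponential to [ex]; the exponential lies in SU(2), so [insubd]
    returns it unchanged. The factor s serves the rescaled field [X1]. *)
Lemma one_paramE a (s t : R) : one_param (s%:C *: axis_mx R a) t = ex a (t * s).
Proof.
rewrite /one_param scalerA -rmorphM /= expm_rot ?axis_mx_sqr // -quat_mx_rot.
exact: valKd.
Qed.
End ComplexTopology.

(** * Topology of SU(2) in quaternion coordinates *)

Section SU2Topology.
Variable R : realType.
Local Notation C := R[i].

Lemma cvg_mxP (T : Type) (F : set_system T) (FF : Filter F) m n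
    (f : T -> 'M[C]_(m, n)) (l : 'M[C]_(m, n)) :
  f @ F --> l <-> forall i j, (fun x => f x i j) @ F --> l i j.
Proof.
split=> [fl i j|fl A].
  exact: (continuous_cvg _ (@coord_continuous _ _ _ i j l) fl).
case=> P Pl PA; rewrite /= nbhs_filterE /=.
have : \forall x \near F, forall i j, P i j (f x i j).
  by apply: filter_forall => i; apply: filter_forall => j; exact: fl.
by apply: filterS => x xP; apply: PA.
Qed.

Lemma cvg_su2_mx (T : Type) (F : set_system T) (FF : Filter F) (f : T -> su2 R) (g : su2 R) :
  f @ F --> g <-> (fun x => su2_mx (f x)) @ F --> su2_mx g.
Proof.
have cont : continuous (@su2_mx R) by exact: initial_continuous.
split=> [fg|fg A]; first exact: (continuous_cvg _ (cont g) fg).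
case=> B [[D oD DB] Bg] BA.
have nD : nbhs (su2_mx g) D by apply: open_nbhs_nbhs; split=> //; rewrite -DB in Bg.
apply: (@filterS _ F FF (fun x => D (su2_mx (f x)))); last exact: (fg _ nD).
by move=> x Dx; apply: BA; rewrite -DB.
Qed.

Lemma cvg_su2P (T : Type) (F : set_system T) (FF : Filter F) (f : T -> su2 R) (g : su2 R) :
  f @ F --> g <->
  [/\ (fun x => qw (f x)) @ F --> qw g, (fun x => qx (f x)) @ F --> qx g,
      (fun x => qy (f x)) @ F --> qy g & (fun x => qz (f x)) @ F --> qz g].
Proof.
rewrite cvg_su2_mx cvg_mxP; split=> [fg|[fw fx fy fz]].
  have /cvg_complexP[fw fx] := fg 0 0; have /cvg_complexP[fy fz] := fg 0 1.
  by split.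
have E (h : su2 R) : [/\ su2_mx h 0 0 = qw h +i* qx h, su2_mx h 0 1 = qy h +i* qz h,
    su2_mx h 1 0 = (- qy h) +i* qz h & su2_mx h 1 1 = qw h -i* qx h].
  by rewrite (su2E h).1 !mx2E.
have ord2 (i : 'I_2) : i = 0 \/ i = 1.
  by case: i => [[|[|i]] //= ?]; [left|right]; apply: val_inj.
move=> i j; apply/cvg_complexP.
have [e1 e2 e3 e4] := E g.
by case: (ord2 i) => ->; case: (ord2 j) => ->; rewrite ?e1 ?e2 ?e3 ?e4 /=; split;
   under eq_fun => x do [have [f1 f2 f3 f4] := E (f x); rewrite ?f1 ?f2 ?f3 ?f4 /=];
   rewrite //; exact: cvgN.
Qed.

Lemma cvg_su2M (T : Type) (F : set_system T) (FF : Filter F) (f h : T -> su2 R) (g k : su2 R) :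
  f @ F --> g -> h @ F --> k -> (fun x => f x * h x)%g @ F --> (g * k)%g.
Proof.
move=> /cvg_su2P[f1 f2 f3 f4] /cvg_su2P[h1 h2 h3 h4]; apply/cvg_su2P.
have [E1 E2 E3 E4] := qmul g k; split.
- have -> : (fun x => qw (f x * h x)%g) = fun x => qw (f x) * qw (h x) - qx (f x) * qx (h x)
      - qy (f x) * qy (h x) - qz (f x) * qz (h x).
    by apply/funext => x; case: (qmul (f x) (h x)).
  by rewrite E1; apply: cvgB; [apply: cvgB; [apply: cvgB|]|]; apply: cvgM.
- have -> : (fun x => qx (f x * h x)%g) = fun x => qw (f x) * qx (h x) + qx (f x) * qw (h x)
      + qy (f x) * qz (h x) - qz (f x) * qy (h x).
    by apply/funext => x; case: (qmul (f x) (h x)).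
  by rewrite E2; apply: cvgB; [apply: cvgD; [apply: cvgD|]|]; apply: cvgM.
- have -> : (fun x => qy (f x * h x)%g) = fun x => qw (f x) * qy (h x) + qy (f x) * qw (h x)
      + qz (f x) * qx (h x) - qx (f x) * qz (h x).
    by apply/funext => x; case: (qmul (f x) (h x)).
  by rewrite E3; apply: cvgB; [apply: cvgD; [apply: cvgD|]|]; apply: cvgM.
- have -> : (fun x => qz (f x * h x)%g) = fun x => qw (f x) * qz (h x) + qz (f x) * qw (h x)
      + qx (f x) * qy (h x) - qy (f x) * qx (h x).
    by apply/funext => x; case: (qmul (f x) (h x)).
  by rewrite E4; apply: cvgB; [apply: cvgD; [apply: cvgD|]|]; apply: cvgM.
Qed.

Lemma continuous_ex a : continuous (@ex R a).
Proof.
move=> t; apply/cvg_su2P.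
have cw : continuous (fun t => qw (@ex R a t)).
  have -> : (fun t => qw (@ex R a t)) = cos by apply/funext => x; case: (ex_coord a x).
  exact: continuous_cos.
have cc (b : bool) : continuous (fun t : R => if b then sin t else 0).
  by case: b => ?; [exact: continuous_sin | exact: cvg_cst].
have cx : continuous (fun t => qx (@ex R a t)).
  have -> : (fun t => qx (@ex R a t)) = fun t => if (if a is axI then true else false) then sin t else 0.
    by apply/funext => x; case: (ex_coord a x) => _ -> _ _; case: (a).
  exact: cc.
have cy : continuous (fun t => qy (@ex R a t)).
  have -> : (fun t => qy (@ex R a t)) = fun t => if (if a is axJ then true else false) then sin t else 0.
    by apply/funext => x; case: (ex_coord a x) => _ _ -> _; case: (a).
  exact: cc.
have cz : continuous (fun t => qz (@ex R a t)).
  have -> : (fun t => qz (@ex R a t)) = fun t => if (if a is axK then true else false) then sin t else 0.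
    by apply/funext => x; case: (ex_coord a x) => _ _ _ ->; case: (a).
  exact: cc.
by split; [exact: cw | exact: cx | exact: cy | exact: cz].
Qed.

End SU2Topology.

(** * Euler angles and compactness *)

Section EulerAngles.
Variable R : realType.
Local Notation C := R[i].

Lemma atan_le_norm (x : R) : `|atan x| <= `|x|.
Proof.
wlog x0 : x / 0 <= x => [H|].
  have [/H //|/ltW] := leP 0 x; rewrite -oppr_ge0 => /H.
  by rewrite atanN !normrN.
have [c _] := @MVT_segment R atan (fun x => (1 + x ^+ 2)^-1) 0 x x0
  (fun x _ => is_derive1_atan x) (continuous_subspaceT (@continuous_atan R)).
rewrite atan0 !subr0 => ->; rewrite normrM ler_piMl // ger0_norm ?invr_ge0 ?addr_ge0 ?sqr_ge0 //.
by rewrite invf_le1 ?lerDl ?sqr_ge0 // ltr_wpDr ?sqr_ge0.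
Qed.

(** The angle is atan (q / p) for p > 0, whence the last estimate; it is what makes the Euler angles
    small for elements close to 1. *)
Lemma polar (p q : R) : exists r t : R, [/\ 0 <= r, p = r * cos t, q = r * sin t,
   `|t| <= 2 * pi & 0 < p -> `|t| <= `|q| / p].
Proof.
have pi0 : 0 < pi :> R by exact: pi_gt0.
have pos (u v : R) : 0 < u -> exists r t : R, [/\ 0 <= r, u = r * cos t, v = r * sin t,
    `|t| <= pi & `|t| <= `|v| / u].
  move=> u0; pose t := atan (v / u).
  have ct : cos t = (Num.sqrt (1 + (v / u) ^+ 2))^-1 by rewrite cos_atan.
  have ct0 : 0 < cos t by rewrite ct invr_gt0 sqrtr_gt0 ltr_wpDr ?sqr_ge0.
  have st : sin t = v / u * cos t.
    by rewrite -[in v / u](atanK (v / u)) /tan -/t divfK // gt_eqF.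
  exists (u / cos t), t; split.
  - by rewrite divr_ge0 // ltW.
  - by rewrite divfK // gt_eqF.
  - by rewrite st; field; rewrite !gt_eqF.
  - rewrite ler_norml; apply/andP; split; apply: ltW.
      by apply: le_lt_trans (atan_gtNpi2 _); rewrite lerN2 ler_pdivrMr //; lra.
    by apply: lt_le_trans (atan_ltpi2 _) _; rewrite ler_pdivrMr //; lra.
  - by apply: (le_trans (atan_le_norm _)); rewrite normrM normfV (gtr0_norm u0).
have [p0|p0|<-] := ltgtP 0 p.
- have [r [t [r0 E1 E2 t1 t2]]] := pos p q p0; exists r, t; split=> //.
  by apply: le_trans t1 _; lra.
- have [|r [t [r0 E1 E2 t1 t2]]] := pos (- p) (- q); first by rewrite oppr_gt0.
  exists r, (t + pi); split=> //.
  + by rewrite cosDpi mulrN -E1 opprK.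
  + by rewrite sinDpi mulrN -E2 opprK.
  + by rewrite (le_trans (ler_normD _ _)) // (gtr0_norm pi0); lra.
- have npi : `|pi / 2| <= 2 * pi :> R by rewrite ger0_norm; lra.
  have [q0|q0] := leP 0 q.
    exists q, (pi / 2); rewrite cos_pihalf sin_pihalf mulr0 mulr1.
    by split.
  exists (- q), (- (pi / 2)); rewrite cosN sinN cos_pihalf sin_pihalf mulr0 mulrN1 opprK normrN.
  by split=> //; lra.
Qed.

Definition imnorm (h : su2 R) : R := `|qx h| + `|qy h| + `|qz h|.

(** Since exp(aI) J exp(aI) = J, the symmetric product exp(aI) exp(bJ) exp(aI) is cos b exp(2aI) +
    sin b J and has no K-coordinate. Unlike the classical Euler angles, this parametrization is
    nondegenerate at 1. *)
Lemma ex_IJIK (a b c : R) (g := (ex axI a * ex axJ b * ex axI a * ex axK c)%g) :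
  [/\ qw g = cos b * cos (a + a) * cos c,
      qx g = cos b * sin (a + a) * cos c + sin b * sin c,
      qy g = sin b * cos c - cos b * sin (a + a) * sin c
    & qz g = cos b * cos (a + a) * sin c].
Proof.
have [e1 e2 e3 e4] := qmul (ex axI a * ex axJ b * ex axI a)%g (ex axK c).
have [e1' e2' e3' e4'] := qmul (ex axI a * ex axJ b)%g (@ex R axI a).
have [e1'' e2'' e3'' e4''] := qmul (@ex R axI a) (ex axJ b).
have [u1 u2 u3 u4] := ex_coord axI a.
have [v1 v2 v3 v4] := ex_coord axJ b.
have [w1 w2 w3 w4] := ex_coord axK c.
have cs4 := cos2Dsin2 a.
rewrite cosD sinD {}/g.
move: u1 u2 u3 u4 v1 v2 v3 v4 w1 w2 w3 w4 e1 e2 e3 e4 e1' e2' e3' e4' e1'' e2'' e3'' e4'' cs4.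
move: (ex axI a * ex axJ b * ex axI a * ex axK c)%g (ex axI a * ex axJ b * ex axI a)%g
  (ex axI a * ex axJ b)%g (ex axI a) (ex axJ b) (ex axK c)
  (cos a) (sin a) (cos b) (sin b) (cos c) (sin c).
move=> g1 g2 g3 gi gj gk ca sa cb sb cc sc -> -> -> -> -> -> -> -> -> -> -> ->.
move=> -> -> -> -> -> -> -> -> -> -> -> -> n1.
split; first ring.
- have -> : sb * sc = sb * sc * (ca ^+ 2 + sa ^+ 2) by rewrite n1 mulr1.
  ring.
- have -> : sb * cc = sb * cc * (ca ^+ 2 + sa ^+ 2) by rewrite n1 mulr1.
  ring.
- ring.
Qed.

(** The coordinates (w, z) determine c; removing exp(cK) on the right leaves r1 + x' I + y' J, whose
    polar angles are A = 2a and b. The bounds by 2 pi give compactness, the linear bounds near 1 the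
    Lipschitz estimate for the commutator. *)
Lemma su2_euler (h : su2 R) : exists a b c : R,
  [/\ h = (ex axI a * ex axJ b * ex axI a * ex axK c)%g,
      [/\ `|a| <= 2 * pi, `|b| <= 2 * pi & `|c| <= 2 * pi] &
      1 / 2 <= qw h -> [/\ `|a| <= 2 * imnorm h, `|b| <= 2 * imnorm h & `|c| <= 2 * imnorm h]].
Proof.
have [r1 [c [r10 Ew Ez cpi cb]]] := polar (qw h) (qz h).
pose x' := qx h * cos c - qy h * sin c; pose y' := qy h * cos c + qx h * sin c.
have [r2 [A [r20 Ew' Ex' Api Ab]]] := polar r1 x'.
have [r3 [b [r30 Ew'' Ey bpi bb]]] := polar r2 y'.
have n1 := qnorm h.
have cs1 := cos2Dsin2 c; have cs2 := cos2Dsin2 A; have cs3 := cos2Dsin2 b.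
have bx' : `|x'| <= `|qx h| + `|qy h|.
  apply: (le_trans (ler_normB _ _)); rewrite !normrM lerD // ler_piMr //;
    by [exact: cos_max | exact: sin_max].
have by' : `|y'| <= `|qx h| + `|qy h|.
  rewrite addrC; apply: (le_trans (ler_normD _ _)); rewrite !normrM lerD // ler_piMr //;
    by [exact: cos_max | exact: sin_max].
have c1 := cos_le1 c; have c2 := cos_le1 A.
have [e1 e2 e3 e4] := ex_IJIK (A / 2) b c.
rewrite -splitr in e1 e2 e3 e4.
(* Here 1/2 <= qw h <= r1 <= r2, so each quotient in [polar] is at most twice its numerator. *)
have bnd : 1 / 2 <= qw h -> [/\ `|A / 2| <= 2 * imnorm h, `|b| <= 2 * imnorm h & `|c| <= 2 * imnorm h].
  move=> w12.
  have w0 : 0 < qw h by lra.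
  have x0 : 0 <= `|qx h| by []. have y0 : 0 <= `|qy h| by []. have z0 : 0 <= `|qz h| by [].
  have r1w : qw h <= r1 by rewrite Ew ler_piMr.
  have r12 : r1 <= r2 by rewrite Ew' ler_piMr.
  have r1p : 0 < r1 by exact: lt_le_trans r1w.
  have r2p : 0 < r2 by exact: lt_le_trans r12.
  have dv (u v : R) : 1 / 2 <= v -> 0 <= u -> u / v <= 2 * u.
    move=> v2 u0; rewrite ler_pdivrMr; last lra.
    by rewrite -[leLHS]mulr1 -[2 * u]mulrC -mulrA ler_wpM2l //; lra.
  have cb' := le_trans (cb w0) (dv _ _ w12 z0).
  have Ab' : `|A| <= 2 * `|x'|.
    by apply: le_trans (Ab r1p) (dv _ _ _ _) => //; exact: le_trans r1w.
  have bb' : `|b| <= 2 * `|y'|.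
    by apply: le_trans (bb r2p) (dv _ _ _ _) => //; apply: le_trans r12; exact: le_trans r1w.
  rewrite /imnorm normrM (@ger0_norm _ 2^-1) //.
  by clear -x0 y0 z0 cb' Ab' bb' bx' by'; split; lra.
have Api2 : `|A / 2| <= 2 * pi.
  by have := normr_ge0 A; rewrite normrM (@ger0_norm _ 2^-1) //; clear -Api; lra.
exists (A / 2), b, c; split=> // {bnd Api2 bpi cpi Api cb Ab bb bx' by'}.
have := cs1; have := cs2; have := cs3; move: Ew Ez Ew' Ex' Ew'' Ey.
have xE : qx h = x' * cos c + y' * sin c.
  by rewrite -[LHS]mulr1 -cs1 /x' /y'; ring.
have yE : qy h = y' * cos c - x' * sin c.
  by rewrite -[LHS]mulr1 -cs1 /x' /y'; ring.
move=> Ew Ez Ew' Ex' Ew'' Ey c3 c2' c1'.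
have N1 : r1 ^+ 2 + (x' ^+ 2 + y' ^+ 2) = 1.
  rewrite -n1 Ew Ez xE yE.
  by rewrite -[LHS]mulr1 -c1'; ring.
have N2 : r2 ^+ 2 + y' ^+ 2 = 1.
  by rewrite -N1 addrA; congr (_ + _); rewrite Ew' Ex' -[LHS]mulr1 -c2'; ring.
(* The last radius is the quaternion norm of h. *)
have r31 : r3 = 1.
  have : r3 ^+ 2 = 1.
    by rewrite -N2 Ew'' Ey -[LHS]mulr1 -c3; ring.
  move=> /eqP; rewrite sqrf_eq1 => /orP[/eqP//|/eqP r3N].
  by move: r30; rewrite r3N oppr_ge0 ler10.
rewrite r31 !mul1r in Ew'' Ey; rewrite Ew'' in Ew' Ex'.
rewrite Ew' in Ew Ez.
apply: eq_quat; rewrite ?e1 ?e2 ?e3 ?e4.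
- exact: Ew.
- by rewrite xE Ex' Ey.
- by rewrite yE Ex' Ey.
- exact: Ez.
Qed.

Definition euler_box : set (R * (R * R)) :=
  `[- (2 * pi), 2 * pi] `*` (`[- (2 * pi), 2 * pi] `*` `[- (2 * pi), 2 * pi]).

Lemma su2_compact : compact [set: su2 R].
Proof.
pose F (p : R * (R * R)) : su2 R := (ex axI p.1 * ex axJ p.2.1 * ex axI p.1 * ex axK p.2.2)%g.
have -> : [set: su2 R] = F @` euler_box.
  apply/seteqP; split=> // h _.
  have [a [b [c [hE [ba bb bc] _]]]] := su2_euler h.
  exists (a, (b, c)) => //.
  by split; [|split]; rewrite /= in_itv /= -ler_norml.
apply: continuous_compact; last by do 2?[apply: compact_setX]; exact: segment_compact.
apply: continuous_subspaceT => p; rewrite /F.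
have c1 : (fun p : R * (R * R) => p.1) @ p --> p.1 by exact: cvg_fst.
have c2 : (fun p : R * (R * R) => p.2.1) @ p --> p.2.1.
  by apply: (cvg_comp _ _ cvg_snd); exact: cvg_fst.
have c3 : (fun p : R * (R * R) => p.2.2) @ p --> p.2.2.
  by apply: (cvg_comp _ _ cvg_snd); exact: cvg_snd.
by apply: cvg_su2M; [apply: cvg_su2M; [apply: cvg_su2M|]|];
  apply: (continuous_cvg _ (@continuous_ex R _ _)).
Qed.

Lemma su2_max (u : su2 R -> R) : continuous u -> exists g, forall h, u h <= u g.
Proof.
move=> cu.
have [|g _ gmax] := @compact_EVT_max (su2 R) R u setT (ex_intro _ 1%g I) su2_compact.
  exact: continuous_subspaceT.
by exists g => h; apply: gmax; rewrite inE.
Qed.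
End EulerAngles.

(** * Commutators of invariant vector fields *)

Section CurveEstimates.
Variable R : realType.

Lemma mvt0 (f df : R -> R) (t : R) : (forall x : R, is_derive x 1 f (df x)) ->
  exists s, `|s| <= `|t| /\ f t - f 0 = df s * t.
Proof.
move=> fd.
have fc a b : {within `[a, b], continuous f}.
  apply: continuous_subspaceT => x.
  by apply: differentiable_continuous; apply/derivable1_diffP; have [] := fd x.
have [t0|/ltW t0] := leP 0 t.
  have [s] := MVT_segment t0 (fun x _ => fd x) (fc 0 t).
  rewrite in_itv /= => /andP[s0 st]; rewrite subr0 => E; exists s; split=> //.
  by rewrite !ger0_norm.
have [s] := MVT_segment t0 (fun x _ => fd x) (fc t 0).
rewrite in_itv /= => /andP[s0 st] E; exists s; split.
  by rewrite !ler0_norm // lerN2.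
by rewrite -opprB E sub0r mulrN opprK.
Qed.

Lemma sin_le_norm (x : R) : `|sin x| <= `|x|.
Proof.
have [s [_]] := mvt0 x (@is_derive_sin R); rewrite sin0 subr0 => ->.
by rewrite normrM ler_piMl // cos_max.
Qed.

Lemma cos_sub1_le (x : R) : `|cos x - 1| <= `|x|.
Proof.
have [s [_]] := mvt0 x (@is_derive_cos R); rewrite cos0 => ->.
by rewrite normrM normrN ler_piMl // sin_max.
Qed.

Lemma sin_sub_le (x : R) : `|sin x - x| <= x ^+ 2.
Proof.
have [s [sx]] := mvt0 x (@is_derive_sin R); rewrite sin0 subr0 => ->.
rewrite -[X in _ - X]mul1r -mulrBl normrM -real_normK ?num_real // expr2.
by rewrite ler_wpM2r // (le_trans (cos_sub1_le _)).
Qed.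

Definition nxt (a : axis) : axis := match a with axI => axJ | axJ => axK | axK => axI end.

(** Because [a, b] = 2c for consecutive axes, the group commutator of exp(sa) and exp(sb) is exp(2
    s^2 c) up to third order; this is the factor left over. *)
Definition axis_comm (a : axis) (s : R) : su2 R :=
  (ex (nxt (nxt a)) (- (2 * s ^+ 2)) * (ex a (- s) * (ex (nxt a) (- s) *
    (ex a s * ex (nxt a) s))))%g.

Lemma axis_commE a s : (ex a s * ex (nxt a) s)%g =
  (ex (nxt a) s * ex a s * ex (nxt (nxt a)) (2 * s ^+ 2) * axis_comm a s)%g.
Proof.
have H (x y z x' y' z' : su2 R) : (x * x' = 1 -> y * y' = 1 -> z * z' = 1 ->
    x * y = y * x * z * (z' * (x' * (y' * (x * y)))))%g.
  move=> X Y Z; rewrite !mulgA -(mulgA _ z z') Z mulg1 -(mulgA _ x x') X mulg1 Y.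
  by rewrite mul1g.
by apply: H; rewrite -exD subrr ex0.
Qed.

(** The imaginary coordinates come in an order and with signs depending on the axis. The sum of
    absolute values hides both, so one formula serves all three axes. *)
Lemma axis_comm_coord a s (S := sin s) (C := cos s) (c' := cos (2 * s ^+ 2))
   (s' := sin (2 * s ^+ 2)) :
  qw (axis_comm a s) = c' * (1 - 2 * S ^+ 4) + s' * (2 * S ^+ 2 * C ^+ 2) /\
  imnorm (axis_comm a s) = `|c' * (2 * S ^+ 3 * C) - s' * (2 * S ^+ 3 * C)|
    + `|c' * (2 * S ^+ 3 * C) + s' * (2 * S ^+ 3 * C)|
    + `|c' * (2 * S ^+ 2 * C ^+ 2) - s' * (1 - 2 * S ^+ 4)|.
Proof.
pose b := nxt a; pose c := nxt b.
pose h1 := (ex a s * ex b s)%g; pose h2 := (ex b (- s) * h1)%g; pose h3 := (ex a (- s) * h2)%g.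
have -> : axis_comm a s = (ex c (- (2 * s ^+ 2)) * h3)%g by [].
have [d1 d2 d3 d4] := qmul (ex a s) (ex b s).
have [e1 e2 e3 e4] := qmul (ex b (- s)) h1.
have [f1 f2 f3 f4] := qmul (ex a (- s)) h2.
have [g1 g2 g3 g4] := qmul (ex c (- (2 * s ^+ 2))) h3.
have [u1 u2 u3 u4] := ex_coord a s.
have [v1 v2 v3 v4] := ex_coord b s.
have [w1 w2 w3 w4] := ex_coord b (- s).
have [x1 x2 x3 x4] := ex_coord a (- s).
have [y1 y2 y3 y4] := ex_coord c (- (2 * s ^+ 2)).
rewrite !cosN !sinN -/s' -/c' -/S -/C in u1 u2 u3 u4 v1 v2 v3 v4 w1 w2 w3 w4 x1 x2 x3 x4 y1 y2 y3 y4.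
have n1 : C ^+ 2 = 1 - S ^+ 2 by rewrite /C cos2sin2.
rewrite /imnorm g1 g2 g3 g4 f1 f2 f3 f4 e1 e2 e3 e4.
move: d1 d2 d3 d4 u1 u2 u3 u4 v1 v2 v3 v4 w1 w2 w3 w4 x1 x2 x3 x4 y1 y2 y3 y4; rewrite -/h1.
move: {e1 e2 e3 e4 f1 f2 f3 f4 g1 g2 g3 g4 h2 h3} h1 (ex a s) (ex b s) (ex b (- s)) (ex a (- s)) (ex c (- (2 * s ^+ 2))).
rewrite {}/c {}/b; move: n1; move: {s} S C c' s' => S C c' s' n1 h1 k1 k2 k3 k4 k5.
move=> -> -> -> -> -> -> -> -> -> -> -> -> -> -> -> -> -> -> -> -> -> -> -> ->.
have n2 : 1 - 2 * S ^+ 4 = (C ^+ 2 + S ^+ 2) ^+ 2 - 2 * S ^+ 4 by rewrite n1 subrK expr1n.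
rewrite n2 {n1 n2}.
have n3 (x y z x' y' z' : R) : x = - x' -> y = y' -> z = z' ->
    `|x| + `|y| + `|z| = `|x'| + `|y'| + `|z'| by move=> -> -> ->; rewrite normrN.
have n3' (x y z x' y' z' : R) : x = x' -> y = - y' -> z = z' ->
    `|x| + `|y| + `|z| = `|x'| + `|y'| + `|z'| by move=> -> -> ->; rewrite normrN.
have n3'' (x y z x' y' z' : R) : x = x' -> y = y' -> z = - z' ->
    `|x| + `|y| + `|z| = `|x'| + `|y'| + `|z'| by move=> -> -> ->; rewrite normrN.
case: a => /=; (split; first by ring).
- by apply: n3; ring.
- by rewrite [RHS]addrC [RHS]addrA; apply: n3'; ring.
- by rewrite -[RHS]addrA [RHS]addrC; apply: n3''; ring.
Qed.

Lemma normM_le (x y p q : R) : `|x| <= p -> `|y| <= q -> `|x * y| <= p * q.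
Proof. by move=> xp yq; rewrite normrM ler_pM. Qed.

(** The second order terms in the direction c cancel and the rest is of order s^3. The bound on the
    real part makes the linear estimate of [su2_euler] applicable; the constants 1/4 and 26 are
    crude. *)
Lemma axis_comm_small (a : axis) (s : R) : `|s| <= 1 / 4 ->
  1 / 2 <= qw (axis_comm a s) /\ imnorm (axis_comm a s) <= 26 * `|s| ^+ 3.
Proof.
have [-> ->] := axis_comm_coord a s.
have S1 := sin_le_norm s; have C1 := cos_max s; have c1 := cos_max (2 * s ^+ 2).
have s1 := sin_le_norm (2 * s ^+ 2).
have c2 := cos_sub1_le (2 * s ^+ 2); have s2 := sin_sub_le (2 * s ^+ 2).
have S2 := sin_sub_le s; have CS := cos2sin2 s.
have e0 : 0 <= `|s| by [].
have sq : s ^+ 2 = `|s| ^+ 2 by rewrite real_normK ?num_real.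
have g0 : 0 <= 2 * s ^+ 2 by rewrite mulr_ge0 ?sqr_ge0.
rewrite (@ger0_norm _ (2 * s ^+ 2)) // in s1 c2; clear g0.
move: S1 C1 c1 s1 c2 s2 S2 CS e0; rewrite sq.
move: (`|s|) sq (cos (2 * _)) (sin (2 * _)) (sin s) (cos s) => e sq c' s' S C.
move=> S1 C1 c1 s1 c2 s2 S2 CS e0 e4.
have e2 : e ^+ 2 <= e / 4 by rewrite expr2 ler_wpM2l //; lra.
have e3 : e ^+ 3 <= e ^+ 2 / 4 by rewrite exprSr ler_wpM2l ?sqr_ge0 //; lra.
have e43 : e ^+ 4 <= e ^+ 3 / 4 by rewrite exprSr ler_wpM2l ?exprn_ge0 //; lra.
have p2 : 0 <= e ^+ 2 by exact: sqr_ge0.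
have p3 : 0 <= e ^+ 3 by exact: exprn_ge0.
have p4 : 0 <= e ^+ 4 by exact: exprn_ge0.
have s1' : `|s'| <= 1 by apply: (le_trans s1); lra.
have S4 : `|S ^+ 4| <= e ^+ 4 by rewrite normrX lerXn2r ?nnegrE.
have S3 : `|S ^+ 3| <= e ^+ 3 by rewrite normrX lerXn2r ?nnegrE.
have Sq : `|S ^+ 2| <= e ^+ 2 by rewrite normrX lerXn2r ?nnegrE.
have Cq : `|C ^+ 2| <= 1 by rewrite normrX exprn_ile1.
have T1 : `|c' * (S ^+ 2 - e ^+ 2)| <= 1 * (e ^+ 2 * (e + e)).
  have -> : S ^+ 2 - e ^+ 2 = (S - s) * (S + s) by rewrite -sq; ring.
  apply: normM_le => //; apply: normM_le => //.
  apply: (le_trans (ler_normD _ _)); rewrite lerD //.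
  by rewrite -(ler_pXn2r (n := 2)) ?nnegrE // real_normK ?num_real // sq.
have T2 := normM_le c1 S4; have T5 := normM_le s1' S4.
have T3 : `|e ^+ 2 * (c' - 1)| <= e ^+ 2 * (2 * e ^+ 2).
  by apply: normM_le => //; rewrite ger0_norm.
have X3 : `|S ^+ 3 * C| <= e ^+ 3 * 1 by exact: normM_le.
have Y1 := normM_le c1 X3; have Y2 := normM_le s1' X3.
have Z1 := normM_le s1' (normM_le Sq Cq).
have E4 : (2 * e ^+ 2) ^+ 2 = 4 * e ^+ 4 by ring.
have E4' : e ^+ 2 * (2 * e ^+ 2) = 2 * e ^+ 4 by ring.
have E3 : e ^+ 2 * (e + e) = 2 * e ^+ 3 by ring.
rewrite ?E4 ?E4' ?E3 ?mul1r ?mulr1 in s2 T1 T2 T3 T5 X3 Y1 Y2 Z1.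
split.
  have -> : c' * (1 - 2 * S ^+ 4) + s' * (2 * S ^+ 2 * C ^+ 2) =
    c' - 2 * (c' * S ^+ 4) + 2 * (s' * (S ^+ 2 * C ^+ 2)) by ring.
  move: c2 T2 Z1; rewrite !ler_norml.
  move: (c' * S ^+ 4) (s' * (S ^+ 2 * C ^+ 2)) => u v /andP[l1 l2] /andP[l3 l4] /andP[l5 l6].
  clear -l1 l3 l4 l5 l6 e4 e2 e3 e43 e0; lra.
have -> : c' * (2 * S ^+ 3 * C) - s' * (2 * S ^+ 3 * C) =
  2 * (c' * (S ^+ 3 * C)) - 2 * (s' * (S ^+ 3 * C)) by ring.
have -> : c' * (2 * S ^+ 3 * C) + s' * (2 * S ^+ 3 * C) =
  2 * (c' * (S ^+ 3 * C)) + 2 * (s' * (S ^+ 3 * C)) by ring.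
(* Comparing S^2 with e^2, c' with 1 and s' with 2 e^2 makes the cancellation of the second order
   terms explicit. *)
have -> : c' * (2 * S ^+ 2 * C ^+ 2) - s' * (1 - 2 * S ^+ 4) =
  2 * (c' * (S ^+ 2 - e ^+ 2)) - 2 * (c' * S ^+ 4) + 2 * (e ^+ 2 * (c' - 1))
   - (s' - 2 * e ^+ 2) + 2 * (s' * S ^+ 4) by rewrite CS; ring.
move: T1 T2 T3 s2 T5 Y1 Y2.
move: (c' * (S ^+ 2 - e ^+ 2)) (c' * S ^+ 4) (e ^+ 2 * (c' - 1)) (s' - 2 * e ^+ 2)
   (s' * S ^+ 4) (c' * (S ^+ 3 * C)) (s' * (S ^+ 3 * C)) => t1 t2 t3 t4 t5 y1 y2.
rewrite !ler_norml => /andP[h1 k1] /andP[h2 k2] /andP[h3 k3] /andP[h4 k4] /andP[h5 k5] /andP[h6 k6] /andP[h7 k7].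
(* Two coordinates are at most 4 e^3 each, the third at most 4 e^3 + 12 e^4, well below 18 e^3. *)
have -> : 26 * e ^+ 3 = 4 * e ^+ 3 + 4 * e ^+ 3 + 18 * e ^+ 3 by ring.
move: (e ^+ 3) (e ^+ 4) e43 p3 p4 h1 h2 h3 h4 h5 h6 h7 k1 k2 k3 k4 k5 k6 k7 => f3 f4.
clear=> *.
rewrite !lerD // ler_norml; apply/andP; split; lra.
Qed.
End CurveEstimates.

Section Commutator.
Variable R : realType.
Implicit Types (u v w : su2 R -> R) (g : su2 R) (a b c : axis).

Definition rder a u u' := forall g (t : R),
  is_derive t 1 (fun s : R => u (g * ex a s)%g) (u' (g * ex a t)%g).

Lemma rder_mvt a u u' g (t : R) : rder a u u' ->
  exists s : R, `|s| <= `|t| /\ u (g * ex a t)%g - u g = u' (g * ex a s)%g * t.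
Proof.
move=> du; have [s [st E]] := mvt0 t (du g).
by exists s; split; rewrite // -E ex0 mulg1.
Qed.

Lemma continuous_ex3 w a b c g (e : R) : continuous w -> 0 < e ->
  exists2 d : R, 0 < d & forall r s t, `|r| <= d -> `|s| <= d -> `|t| <= d ->
    `|w (g * ex a r * ex b s * ex c t)%g - w g| <= e.
Proof.
move=> cw e0.
pose F (p : R * (R * R)) : su2 R := (g * ex a p.1 * ex b p.2.1 * ex c p.2.2)%g.
have F0 : F (0, (0, 0)) = g by rewrite /F /= !ex0 !mulg1.
have cF : F @ (0, (0, 0)) --> g.
  rewrite -[X in _ --> X]F0.
  have c1 (p : R * (R * R)) : (fun p : R * (R * R) => p.1) @ p --> p.1 by exact: cvg_fst.
  have c2 (p : R * (R * R)) : (fun p : R * (R * R) => p.2.1) @ p --> p.2.1.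
    by apply: (cvg_comp _ _ cvg_snd); exact: cvg_fst.
  have c3 (p : R * (R * R)) : (fun p : R * (R * R) => p.2.2) @ p --> p.2.2.
    by apply: (cvg_comp _ _ cvg_snd); exact: cvg_snd.
  apply: cvg_su2M; [apply: cvg_su2M; [apply: cvg_su2M; first exact: cvg_cst|]|];
    apply: (continuous_cvg _ (@continuous_ex R _ _)); [exact: c1|exact: c2|exact: c3].
have /cvgrPdist_le/(_ e e0)/nbhs_ballP[d /= d0 dP] :
    (w \o F) @ (0, (0, 0)) --> w g by apply: (continuous_cvg _ (cw g) cF).
have bd (r : R) : `|r| <= d / 2 -> ball 0 d r.
  by move=> rd; rewrite -ball_normE /= sub0r normrN (le_lt_trans rd) // ltr_pdivrMr // ltr_pMr // ltr1n.
exists (d / 2); first by rewrite divr_gt0.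
move=> r s t /bd rd /bd sd /bd td; rewrite distrC.
by apply: (dP (r, (s, t))); do !split.
Qed.

(** The Euler factorization joins g to g h by four arcs of one-parameter subgroups, each estimated
    by the mean value theorem; the I-arc occurs twice, hence the coefficient 4. *)
Lemma rder_lipschitz u (u' : axis -> su2 R -> R) : continuous u -> (forall a, continuous (u' a)) ->
  (forall a, rder a u (u' a)) ->
  exists2 L : R, 0 <= L & forall g h, 1 / 2 <= qw h -> `|u (g * h)%g - u g| <= L * imnorm h.
Proof.
move=> cu cu' du.
have bnd a : exists B : R, forall g, `|u' a g| <= B.
  have [|g gm] := @su2_max R (fun g => `|u' a g|).
    by move=> g; apply: (continuous_comp (cu' a g)); exact: norm_continuous.
  by exists `|u' a g|.
have [B1 b1] := bnd axI; have [B2 b2] := bnd axJ; have [B3 b3] := bnd axK.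
have B10 : 0 <= B1 by apply: le_trans (b1 1%g).
have B20 : 0 <= B2 by apply: le_trans (b2 1%g).
have B30 : 0 <= B3 by apply: le_trans (b3 1%g).
have stp a B g (t m : R) : (forall g, `|u' a g| <= B) -> `|t| <= 2 * m ->
    `|u (g * ex a t)%g - u g| <= B * (2 * m).
  by move=> Bb tm; have [s [_ ->]] := rder_mvt g t (du a); rewrite normrM ler_pM.
exists (4 * B1 + 2 * B2 + 2 * B3); first by rewrite !addr_ge0 ?mulr_ge0.
move=> g h hw; have [x [y [z [hE _ /(_ hw)[xb yb zb]]]]] := su2_euler h.
rewrite {1}hE !mulgA; set m := imnorm _ in xb yb zb *.
have e1 := stp axI B1 g _ _ b1 xb.
have e2 := stp axJ B2 (g * ex axI x)%g _ _ b2 yb.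
have e3 := stp axI B1 (g * ex axI x * ex axJ y)%g _ _ b1 xb.
have e4 := stp axK B3 (g * ex axI x * ex axJ y * ex axI x)%g _ _ b3 zb.
have -> : (4 * B1 + 2 * B2 + 2 * B3) * m =
  B3 * (2 * m) + (B1 * (2 * m) + (B2 * (2 * m) + B1 * (2 * m))) by ring.
move: e1 e2 e3 e4; move: (u g) (u (g * ex axI x)%g) (u (g * ex axI x * ex axJ y)%g)
  (u (g * ex axI x * ex axJ y * ex axI x)%g)
  (u (g * ex axI x * ex axJ y * ex axI x * ex axK z)%g) => u0 u1 u2 u3 u4 e1 e2 e3 e4.
have -> : u4 - u0 = (u4 - u3) + ((u3 - u2) + ((u2 - u1) + (u1 - u0))) by ring.
by do 3![apply: (le_trans (ler_normD _ _)); apply: lerD => //].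
Qed.

Lemma double_difference a b u v v1 v2 g (e : R) :
  rder b u v -> rder a v v1 -> rder b v v2 -> continuous v1 -> continuous v2 -> 0 < e ->
  exists2 d : R, 0 < d & forall s, `|s| <= d ->
   `|u (g * ex a s * ex b s)%g - u (g * ex a s)%g - u (g * ex b s)%g + u g - s ^+ 2 * v1 g|
     <= e * s ^+ 2.
Proof.
move=> du dv1 dv2 c1 c2 e0.
have e3 : 0 < e / 3 by rewrite divr_gt0.
have [d1 d10 H1] := continuous_ex3 a b b g c1 e3.
have [d2 d20 H2] := continuous_ex3 a b b g c2 e3.
exists (Num.min d1 d2); first by rewrite lt_min d10.
move=> s; rewrite le_min => /andP[s1 s2].
pose f t := u (g * ex a s * ex b t)%g - u (g * ex b t)%g.
have df (t : R) : is_derive t 1 f (v (g * ex a s * ex b t)%g - v (g * ex b t)%g).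
  by have D1 := du (g * ex a s)%g t; have D2 := du g t; exact: is_deriveB.
have [t [ts E]] := mvt0 s df.
have -> : u (g * ex a s * ex b s)%g - u (g * ex a s)%g - u (g * ex b s)%g + u g = f s - f 0.
  by rewrite /f ex0 !mulg1; ring.
rewrite E.
have [t1 [t1s E1]] := rder_mvt (g * ex a s)%g t dv2.
have [t2 [t2s E2]] := rder_mvt g t dv2.
have [s' [s's E3]] := rder_mvt g s dv1.
have -> : (v (g * ex a s * ex b t)%g - v (g * ex b t)%g) * s - s ^+ 2 * v1 g =
   (v1 (g * ex a s')%g - v1 g) * s ^+ 2
   + ((v2 (g * ex a s * ex b t1)%g - v2 g) * (t * s) - (v2 (g * ex b t2)%g - v2 g) * (t * s)).
  have -> : v (g * ex a s * ex b t)%g = v (g * ex a s)%g + v2 (g * ex a s * ex b t1)%g * t.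
    by rewrite -E1; ring.
  have -> : v (g * ex b t)%g = v g + v2 (g * ex b t2)%g * t by rewrite -E2; ring.
  have -> : v (g * ex a s)%g = v g + v1 (g * ex a s')%g * s by rewrite -E3; ring.
  move: (v g) (v1 g) (v2 g) (v1 (g * ex a s')%g) (v2 (g * ex a s * ex b t1)%g)
    (v2 (g * ex b t2)%g) => *; ring.
have zr (d : R) : 0 < d -> `|0 : R| <= d by rewrite normr0 => /ltW.
have n1 : `|v1 (g * ex a s')%g - v1 g| <= e / 3.
  have := H1 s' 0 0 (le_trans s's s1) (zr _ d10) (zr _ d10).
  by rewrite !ex0 !mulg1.
have n2 : `|v2 (g * ex a s * ex b t1)%g - v2 g| <= e / 3.
  have := H2 s t1 0 s2 (le_trans t1s (le_trans ts s2)) (zr _ d20).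
  by rewrite !ex0 !mulg1.
have n3 : `|v2 (g * ex b t2)%g - v2 g| <= e / 3.
  have := H2 0 t2 0 (zr _ d20) (le_trans t2s (le_trans ts s2)) (zr _ d20).
  by rewrite !ex0 !mulg1.
have nts : `|t * s| <= s ^+ 2.
  by rewrite normrM -[s ^+ 2]real_normK ?num_real // expr2 ler_wpM2r.
have nss : `|s ^+ 2| <= s ^+ 2 by rewrite ger0_norm ?sqr_ge0.
have -> : e * s ^+ 2 = e / 3 * s ^+ 2 + (e / 3 * s ^+ 2 + e / 3 * s ^+ 2) by field.
apply: (le_trans (ler_normD _ _)); apply: lerD; first exact: normM_le.
by apply: (le_trans (ler_normB _ _)); apply: lerD; exact: normM_le.
Qed.

(* The second difference u(g e^sa e^sb) - u(g e^sb e^sa) is s^2 times the commutator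
   of the derivatives by the mean value theorem, and s^2 times twice the third
   derivative because of axis_commE and axis_comm_small. *)
Lemma rder_commutator a u (u1 : axis -> su2 R -> R) (u2 : axis -> axis -> su2 R -> R) :
  continuous u -> (forall b, continuous (u1 b)) -> (forall b c, continuous (u2 b c)) ->
  (forall b, rder b u (u1 b)) -> (forall b c, rder c (u1 b) (u2 b c)) ->
  forall g, u2 (nxt a) a g - u2 a (nxt a) g = 2 * u1 (nxt (nxt a)) g.
Proof.
move=> cu c1 c2 d1 d2 g; set b := nxt a; set c := nxt b.
apply/eqP; rewrite -subr_eq0; apply/eqP/normr0_eq0/le_anti/andP; split=> //.
apply/ler_addgt0Pr => e e0; rewrite add0r.
have [L L0 lip] := rder_lipschitz cu c1 d1.
have e5 : 0 < e / 5 by rewrite divr_gt0.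
have [da da0 Ha] := double_difference g (d1 b) (d2 b a) (d2 b b) (c2 _ _) (c2 _ _) e5.
have [db db0 Hb] := double_difference g (d1 a) (d2 a b) (d2 a a) (c2 _ _) (c2 _ _) e5.
have [dc dc0 Hc] := continuous_ex3 b a c g (c1 c) e5.
have L1 : 0 < 130 * L + 1 by rewrite ltr_wpDl ?mulr_ge0.
(* With 130 = 5 * 26 the defect contributes at most e / 5 times s^2; the added 1 keeps the
   denominator positive if L = 0. The derivative along c occurs with factor 2, so the error splits
   into five parts. *)
pose s : R := Num.min (Num.min da db) (Num.min (Num.min (1 / 4) (e / (130 * L + 1))) dc).
have s0 : 0 < s by rewrite !lt_min da0 db0 dc0 !divr_gt0.
have [[sa sb] [s4 sl] sc] : [/\ s <= da /\ s <= db, s <= 1 / 4 /\ s <= e / (130 * L + 1) & s <= dc].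
  by have := lexx s; rewrite {2}/s !le_min => /andP[/andP[? ?] /andP[/andP[? ?] ?]].
have sn : `|s| = s by rewrite gtr0_norm.
have s20 : 0 < s ^+ 2 by rewrite exprn_gt0.
have := Ha s; rewrite sn => /(_ sa) Ea; have := Hb s; rewrite sn => /(_ sb) Eb.
have [] := @axis_comm_small R a s; first by rewrite sn.
rewrite sn => hw hn.
have El := lip (g * ex b s * ex a s * ex c (2 * s ^+ 2))%g _ hw.
have El' : L * imnorm (axis_comm a s) <= e / 5 * s ^+ 2.
  apply: (le_trans (ler_wpM2l L0 hn)).
  have -> : L * (26 * s ^+ 3) = 26 * L * s * s ^+ 2 by ring.
  apply: ler_wpM2r; [exact: ltW|rewrite ler_pdivlMr //].
  move: sl; rewrite ler_pdivlMr // => /(le_trans _); apply.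
  have -> : s * (130 * L + 1) = 26 * L * s * 5 + s by ring.
  by rewrite lerDl ltW.
have [t [ts Et]] := rder_mvt (g * ex b s * ex a s)%g (2 * s ^+ 2) (d1 c).
have tdc : `|t| <= dc.
  apply: (le_trans ts); apply: le_trans sc.
  rewrite (@ger0_norm _ (2 * s ^+ 2)); last by rewrite mulr_ge0 // ltW.
  have -> : 2 * s ^+ 2 = 2 * s * s by ring.
  by apply: ler_piMl; [exact: ltW|lra].
have := Hc s s t; rewrite sn => /(_ sc sc tdc) Ec.
have Ec' : `|2 * (s ^+ 2 * (u1 c (g * ex b s * ex a s * ex c t)%g - u1 c g))| <= 2 * (s ^+ 2 * (e / 5)).
  apply: normM_le; first by rewrite ger0_norm.
  by apply: normM_le; first by rewrite ger0_norm ?sqr_ge0.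
have abE : (g * ex a s * ex b s)%g =
   (g * ex b s * ex a s * ex c (2 * s ^+ 2) * axis_comm a s)%g.
  by rewrite -!(mulgA g) axis_commE.
rewrite -(ler_pM2l s20).
have -> : s ^+ 2 * `|u2 b a g - u2 a b g - 2 * u1 c g| = `|s ^+ 2 * (u2 b a g - u2 a b g - 2 * u1 c g)|.
  by rewrite normrM (@gtr0_norm _ (s ^+ 2)).
move: El Et Ea Eb Ec'; rewrite -abE.
move: (u (g * ex a s * ex b s)%g) (u (g * ex b s * ex a s)%g) (u (g * ex a s)%g)
 (u (g * ex b s)%g) (u (g * ex b s * ex a s * ex c (2 * s ^+ 2))%g)
 (u1 c (g * ex b s * ex a s * ex c t)%g) (u g) (u2 b a g) (u2 a b g) (u1 c g) => xab xba xa xb xabc yc x0 yba yab yc0.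
move=> El Et Ea Eb Ec'.
have -> : s ^+ 2 * (yba - yab - 2 * yc0) = (xab - xabc)
   - (xab - xa - xb + x0 - s ^+ 2 * yba) + (xba - xb - xa + x0 - s ^+ 2 * yab) + 2 * (s ^+ 2 * (yc - yc0)).
  have -> : xab - xabc = xab - xba - yc * (2 * s ^+ 2) by rewrite -Et; ring.
  by ring.
have -> : s ^+ 2 * e = e / 5 * s ^+ 2 + e / 5 * s ^+ 2 + e / 5 * s ^+ 2 + 2 * (s ^+ 2 * (e / 5)) by field.
apply: (le_trans (ler_normD _ _)); apply: lerD => //.
apply: (le_trans (ler_normD _ _)); apply: lerD => //.
apply: (le_trans (ler_normB _ _)); apply: lerD => //.
exact: le_trans El El'.
Qed.
End Commutator.

(** * Derivatives of complex-valued functions *)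

Section ComplexCurves.
Variable R : realType.
Local Notation C := R[i].
Implicit Types (f h : su2 R -> C) (g : su2 R) (a b : axis).

(** Stated on real and imaginary part, so that the mean value theorem of real analysis applies to
    each. *)
Definition cder (phi : R -> C) (t : R) (d : C) :=
  is_derive t 1 (fun s => complex.Re (phi s)) (complex.Re d) /\
  is_derive t 1 (fun s => complex.Im (phi s)) (complex.Im d).

Lemma cReD (x y : C) : complex.Re (x + y) = complex.Re x + complex.Re y.
Proof. by case: x y => [? ?] [? ?]. Qed.
Lemma cImD (x y : C) : complex.Im (x + y) = complex.Im x + complex.Im y.
Proof. by case: x y => [? ?] [? ?]. Qed.
Lemma cReN (x : C) : complex.Re (- x) = - complex.Re x.
Proof. by case: x. Qed.
Lemma cImN (x : C) : complex.Im (- x) = - complex.Im x.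
Proof. by case: x. Qed.
Lemma cReM (x y : C) : complex.Re (x * y) =
  complex.Re x * complex.Re y - complex.Im x * complex.Im y.
Proof. by case: x y => [? ?] [? ?]. Qed.
Lemma cImM (x y : C) : complex.Im (x * y) =
  complex.Re x * complex.Im y + complex.Im x * complex.Re y.
Proof. by case: x y => [? ?] [? ?]. Qed.

Lemma cder_cst (c : C) t : cder (fun=> c) t 0.
Proof. by split; exact: is_derive_cst. Qed.

Lemma cderD phi psi t d e : cder phi t d -> cder psi t e ->
  cder (fun s => phi s + psi s) t (d + e).
Proof.
move=> [p1 p2] [q1 q2]; split.
  rewrite cReD; under eq_fun do rewrite cReD; exact: is_deriveD.
rewrite cImD; under eq_fun do rewrite cImD; exact: is_deriveD.
Qed.

Lemma cderM phi psi t d e : cder phi t d -> cder psi t e ->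
  cder (fun s => phi s * psi s) t (d * psi t + phi t * e).
Proof.
move=> [p1 p2] [q1 q2]; split.
  under eq_fun do rewrite cReM.
  apply: is_derive_eq.
  by rewrite cReD !cReM /GRing.scale /=; ring.
under eq_fun do rewrite cImM.
apply: is_derive_eq.
by rewrite cImD !cImM /GRing.scale /=; ring.
Qed.

Lemma cder_conj phi t d : cder phi t d -> cder (fun s => (phi s)^*) t (d^*).
Proof.
move=> [p1 p2]; split.
  have -> : (fun s => complex.Re (phi s)^*) = fun s => complex.Re (phi s).
    by apply/funext => s; case: (phi s).
  by case: d p1 {p2}.
have -> : (fun s => complex.Im (phi s)^*) = fun s => - complex.Im (phi s).
  by apply/funext => s; case: (phi s).
have -> : complex.Im (d^*) = - complex.Im d by case: (d).
exact: is_deriveN.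
Qed.

Lemma cder_uniq phi t d e : cder phi t d -> cder phi t e -> d = e.
Proof.
move=> [[_ p1] [_ p2]] [[_ q1] [_ q2]].
by rewrite [d]complexE [e]complexE -p1 -p2 -q1 -q2.
Qed.

Lemma cder_affine phi (k x t : R) d : cder phi (k * t + x) d ->
  cder (fun s => phi (k * s + x)) t (k%:C * d).
Proof.
have D : is_derive t 1 (fun s : R => k * s + x) k.
  by apply: is_derive_eq; rewrite /GRing.scale /=; ring.
move=> [p1 p2]; split.
  have -> : complex.Re (k%:C * d) = complex.Re d * k by rewrite cReM /=; ring.
  exact: (is_derive1_comp (f := fun s => complex.Re (phi s)) (g := fun s => k * s + x)).
have -> : complex.Im (k%:C * d) = complex.Im d * k by rewrite cImM /=; ring.
exact: (is_derive1_comp (f := fun s => complex.Im (phi s)) (g := fun s => k * s + x)).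
Qed.

End ComplexCurves.

HB.lock Definition dd (R : realType) (a : axis) (f : su2 R -> R[i]) (g : su2 R) : R[i] :=
  (derive1 (fun t : R => complex.Re (f (g * ex a t)%g)) 0) +i*
  (derive1 (fun t : R => complex.Im (f (g * ex a t)%g)) 0).

Section ComplexDerivative.
Variable R : realType.
Local Notation C := R[i].
Implicit Types (f h : su2 R -> C) (g : su2 R) (a b : axis).

Definition hasdd a f f' := forall g, cder (fun t => f (g * ex a t)%g) 0 (f' g).

Lemma hasdd_eq a f f' : hasdd a f f' -> dd a f = f'.
Proof.
move=> H; apply/funext => g; have [[_ p1] [_ p2]] := H g.
by rewrite dd.unlock !derive1E p1 p2; case: (f' g).
Qed.

(** Since [ex a] is a homomorphism, differentiability at 0 of the curves through all points gives
    differentiability at every time. *)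
Lemma hasdd_cder a f f' : hasdd a f f' -> forall g (t : R),
  cder (fun s => f (g * ex a s)%g) t (f' (g * ex a t)%g).
Proof.
move=> H g t.
have -> : (fun s => f (g * ex a s)%g) = (fun s => f (g * ex a t * ex a (1 * s + - t))%g).
  by apply/funext => s; rewrite -mulgA -exD mul1r addrCA subrr addr0.
rewrite -[f' _]mul1r.
apply: (@cder_affine R (fun s => f (g * ex a t * ex a s)%g)).
by rewrite mul1r subrr; exact: H.
Qed.

Lemma hasddD a f f' h h' : hasdd a f f' -> hasdd a h h' -> hasdd a (f + h) (f' + h').
Proof. by move=> H K g; exact: cderD. Qed.

Lemma hasddM a f f' h h' : hasdd a f f' -> hasdd a h h' ->
  hasdd a (f * h) (f' * h + f * h').
Proof. by move=> H K g; have := cderM (H g) (K g); rewrite ex0 mulg1. Qed.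

Lemma hasdd_cst a (c : C) : hasdd a (fun=> c) (fun=> 0).
Proof. by move=> g; exact: cder_cst. Qed.

Lemma hasddZ a (c : C) f f' : hasdd a f f' -> hasdd a (c *: f) (c *: f').
Proof.
move=> H g; have := cderM (cder_cst c 0) (H g); rewrite mul0r add0r.
exact.
Qed.

Definition cconj f : su2 R -> C := fun g => (f g)^*.

Lemma hasdd_conj a f f' : hasdd a f f' -> hasdd a (cconj f) (cconj f').
Proof. by move=> H g; exact: cder_conj. Qed.

Lemma rder_Re a f f' : hasdd a f f' ->
  rder a (fun g => complex.Re (f g)) (fun g => complex.Re (f' g)).
Proof. by move=> H g t; have [] := hasdd_cder H g t. Qed.

Lemma rder_Im a f f' : hasdd a f f' ->
  rder a (fun g => complex.Im (f g)) (fun g => complex.Im (f' g)).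
Proof. by move=> H g t; have [] := hasdd_cder H g t. Qed.

(** The scalar counterpart of [class_C]. As [dd] is a total function, [hasdd] is what says that it
    is the derivative. *)
Fixpoint CC (k : nat) f : Prop :=
  if k is k'.+1 then continuous f /\ forall a, hasdd a f (dd a f) /\ CC k' (dd a f)
  else continuous f.

Definition csmooth f := forall k, CC k f.

Lemma CCW k f : CC k.+1 f -> CC k f.
Proof.
elim: k f => [|k IH] f; first by case.
by move=> [cf df]; split; [exact: cf|] => a; have [h1 h2] := df a; split; [exact: h1|exact: IH].
Qed.

Lemma continuousM f h : continuous f -> continuous h -> continuous (f * h).
Proof.
move=> cf ch g.
change ((fun x => f x * h x) @ nbhs g --> f g * h g).
apply/cvg_complexP.
have [f1 f2] := (@cvg_complexP R _ (nbhs g) _ f (f g)).1 (cf g).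
have [h1 h2] := (@cvg_complexP R _ (nbhs g) _ h (h g)).1 (ch g).
split.
  rewrite cReM; under eq_fun do rewrite cReM.
  by apply: cvgB; apply: cvgM.
rewrite cImM; under eq_fun do rewrite cImM.
by apply: cvgD; apply: cvgM.
Qed.

Lemma continuousD f h : continuous f -> continuous h -> continuous (f + h).
Proof.
move=> cf ch g.
change ((fun x => f x + h x) @ nbhs g --> f g + h g).
apply/cvg_complexP.
have [f1 f2] := (@cvg_complexP R _ (nbhs g) _ f (f g)).1 (cf g).
have [h1 h2] := (@cvg_complexP R _ (nbhs g) _ h (h g)).1 (ch g).
split.
  by rewrite cReD; under eq_fun do rewrite cReD; apply: cvgD.
by rewrite cImD; under eq_fun do rewrite cImD; apply: cvgD.
Qed.

Lemma CCD k f h : CC k f -> CC k h -> CC k (f + h).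
Proof.
elim: k f h => [|k IH] f h; first by move=> cf ch; exact: (continuousD cf ch).
move=> [cf df] [ch dh]; split; first exact: (continuousD cf ch).
move=> a; have [f1 f2] := df a; have [h1 h2] := dh a.
have H := hasddD f1 h1; rewrite (hasdd_eq H).
by split; [exact: H|exact: IH].
Qed.

Lemma CCM k f h : CC k f -> CC k h -> CC k (f * h).
Proof.
elim: k f h => [|k IH] f h; first by move=> cf ch; exact: (continuousM cf ch).
move=> Hf Hh; have Hf' := CCW Hf; have Hh' := CCW Hh.
move: Hf Hh => [cf df] [ch dh]; split; first exact: (continuousM cf ch).
move=> a; have [f1 f2] := df a; have [h1 h2] := dh a.
have H := hasddM f1 h1; rewrite (hasdd_eq H); split; first exact: H.
by apply: CCD; exact: IH.
Qed.

Lemma CC_cst k (c : C) : CC k (fun=> c).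
Proof.
have cc (d : C) : continuous (fun _ : su2 R => d) by exact: cst_continuous.
elim: k c => [|k IH] c; first exact: cc.
split; first exact: cc.
by move=> a; have H := hasdd_cst a c; rewrite (hasdd_eq H); split; [exact: H|exact: IH].
Qed.

Lemma CC_conj k f : CC k f -> CC k (cconj f).
Proof.
have Re_c h x : complex.Re (cconj h x) = complex.Re (h x) by rewrite /cconj; case: (h x).
have Im_c h x : complex.Im (cconj h x) = - complex.Im (h x) by rewrite /cconj; case: (h x).
have cc h : continuous h -> continuous (cconj h).
  move=> ch g; change ((fun x => cconj h x) @ nbhs g --> cconj h g); apply/cvg_complexP.
  have [r i] := (@cvg_complexP R _ (nbhs g) _ h (h g)).1 (ch g).
  rewrite Re_c Im_c; split; first by under eq_fun do rewrite Re_c.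
  by under eq_fun do rewrite Im_c; apply: cvgN.
elim: k f => [|k IH] f; first exact: cc.
move=> [cf df]; split; first exact: cc.
move=> a; have [f1 f2] := df a; have H := hasdd_conj f1.
by rewrite (hasdd_eq H); split; [exact: H|exact: IH].
Qed.

Lemma csmooth_continuous f : csmooth f -> continuous f.
Proof. by move=> /(_ 0%N). Qed.
Lemma csmooth_dd a f : csmooth f -> csmooth (dd a f).
Proof. by move=> sf k; have [_ /(_ a)[]] := sf k.+1. Qed.
Lemma csmooth_hasdd a f : csmooth f -> hasdd a f (dd a f).
Proof. by move=> sf; have [_ /(_ a)[]] := sf 1%N. Qed.
Lemma csmoothD f h : csmooth f -> csmooth h -> csmooth (f + h).
Proof. by move=> sf sh k; exact: CCD. Qed.
Lemma csmoothM f h : csmooth f -> csmooth h -> csmooth (f * h).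
Proof. by move=> sf sh k; exact: CCM. Qed.
Lemma csmooth_cst (c : C) : csmooth (fun=> c).
Proof. by move=> k; exact: CC_cst. Qed.
Lemma csmoothZ (c : C) f : csmooth f -> csmooth (c *: f).
Proof. by move=> sf; have := csmoothM (csmooth_cst c) sf. Qed.
Lemma csmooth_conj f : csmooth f -> csmooth (cconj f).
Proof. by move=> sf k; exact: CC_conj. Qed.

Lemma ddD a f h : csmooth f -> csmooth h -> dd a (f + h) = dd a f + dd a h.
Proof. by move=> sf sh; apply: hasdd_eq; apply: hasddD; exact: csmooth_hasdd. Qed.
Lemma ddZ a c f : csmooth f -> dd a (c *: f) = c *: dd a f.
Proof. by move=> sf; apply: hasdd_eq; apply: hasddZ; exact: csmooth_hasdd. Qed.
Lemma ddM a f h : csmooth f -> csmooth h -> dd a (f * h) = dd a f * h + f * dd a h.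
Proof. by move=> sf sh; apply: hasdd_eq; apply: hasddM; exact: csmooth_hasdd. Qed.
Lemma dd_conj a f : csmooth f -> dd a (cconj f) = cconj (dd a f).
Proof. by move=> sf; apply: hasdd_eq; apply: hasdd_conj; exact: csmooth_hasdd. Qed.

Lemma dd_commutator a f : csmooth f ->
  dd a (dd (nxt a) f) - dd (nxt a) (dd a f) = 2 *: dd (nxt (nxt a)) f.
Proof.
move=> sf; apply/funext => g.
have cRe h : csmooth h -> continuous (fun g => complex.Re (h g)).
  by move=> /csmooth_continuous sh x; have [] := (@cvg_complexP R _ (nbhs x) _ h (h x)).1 (sh x).
have cIm h : csmooth h -> continuous (fun g => complex.Im (h g)).
  by move=> /csmooth_continuous sh x; have [] := (@cvg_complexP R _ (nbhs x) _ h (h x)).1 (sh x).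
have s1 b : csmooth (dd b f) by exact: csmooth_dd.
have s2 b c : csmooth (dd c (dd b f)) by exact: csmooth_dd.
have re := @rder_commutator R a _ (fun b g => complex.Re (dd b f g))
  (fun b c g => complex.Re (dd c (dd b f) g)) (cRe _ sf) (fun b => cRe _ (s1 b))
  (fun b c => cRe _ (s2 b c)) (fun b => rder_Re (csmooth_hasdd b sf))
  (fun b c => rder_Re (csmooth_hasdd c (s1 b))) g.
have im := @rder_commutator R a _ (fun b g => complex.Im (dd b f g))
  (fun b c g => complex.Im (dd c (dd b f) g)) (cIm _ sf) (fun b => cIm _ (s1 b))
  (fun b c => cIm _ (s2 b c)) (fun b => rder_Im (csmooth_hasdd b sf))
  (fun b c => rder_Im (csmooth_hasdd c (s1 b))) g.
have two : (2 : C) = 2%:C by rewrite -(rmorph_nat (real_complex R)).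
change (dd a (dd (nxt a) f) g - dd (nxt a) (dd a f) g = 2 * dd (nxt (nxt a)) f g).
apply/eqP; rewrite eq_complex cReD cReN re cImD cImN im two cReM cImM /=.
by rewrite !mul0r subr0 addr0 !eqxx.
Qed.

(** Passing to phi(t) + phi(-t) makes the first derivative vanish at 0 for free. If the second one
    were positive, two applications of the mean value theorem would produce a value above the
    maximum. *)
Lemma second_derivative_max a f g : csmooth f ->
  (forall g', complex.Re (f g') <= complex.Re (f g)) ->
  complex.Re (dd a (dd a f) g) <= 0.
Proof.
move=> sf fmax; rewrite leNgt; apply/negP => pos.
pose phi t := complex.Re (f (g * ex a t)%g).
pose psi t := complex.Re (dd a f (g * ex a t)%g).
pose chi t := complex.Re (dd a (dd a f) (g * ex a t)%g).
have dphi : forall t : R, is_derive t 1 phi (psi t).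
  exact: (rder_Re (csmooth_hasdd a sf) g).
have dpsi : forall t : R, is_derive t 1 psi (chi t).
  exact: (rder_Re (csmooth_hasdd a (csmooth_dd a sf)) g).
have cchi : continuous chi.
  move=> t; apply: (continuous_cvg _ (@continuous_Re R _)).
  apply: (continuous_cvg _ (@csmooth_continuous _ (csmooth_dd a (csmooth_dd a sf)) _)).
  by apply: cvg_su2M; [exact: cvg_cst|exact: continuous_ex].
have chi0 : 0 < chi 0 by rewrite /chi ex0 mulg1.
have /nbhs_ballP[d /= d0 dP] : \forall t \near (0 : R), 0 < chi t.
  exact: (cvgr_gt _ (cchi 0) _ chi0).
have chip t : `|t| < d -> 0 < chi t.
  by move=> td; apply: dP; rewrite -ball_normE /= sub0r normrN.
pose e := d / 2.
have e0 : 0 < e by rewrite divr_gt0.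
have ed : e < d by rewrite ltr_pdivrMr // ltr_pMr // ltr1n.
have dN (u v : R -> R) : (forall t : R, is_derive t 1 u (v t)) ->
    forall t : R, is_derive t 1 (fun t => u (- t)) (- v (- t)).
  move=> du t; rewrite -mulrN1.
  exact: (is_derive1_comp (f := u) (g := fun s => - s)).
pose P t := phi t + phi (- t); pose Q t := psi t - psi (- t).
have dP' (t : R) : is_derive t 1 P (Q t).
  by have D1 := dphi t; have D2 := dN _ _ dphi t; exact: is_deriveD.
have dQ (t : R) : is_derive t 1 Q (chi t + chi (- t)).
  have D1 := dpsi t; have D2 := dN _ _ dpsi t.
  by rewrite -[chi (- t)]opprK; exact: is_deriveB.
have cnt (u v : R -> R) (x y : R) : (forall t : R, is_derive t 1 u (v t)) -> {within `[x, y], continuous u}.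
  move=> du; apply: continuous_subspaceT => t.
  by apply: differentiable_continuous; apply/derivable1_diffP; have [] := du t.
have [s] := MVT e0 (fun t _ => dP' t) (cnt _ _ _ _ dP').
rewrite in_itv /= => /andP[s0 se] E.
have [r] := MVT s0 (fun t _ => dQ t) (cnt _ _ _ _ dQ).
rewrite in_itv /= => /andP[r0 rs] E'.
have rd : `|r| < d by rewrite gtr0_norm // (lt_trans rs) // (lt_trans se).
have Q0 : Q 0 = 0 by rewrite /Q oppr0 subrr.
have Qs : 0 < Q s.
  move: E'; rewrite Q0 !subr0 => ->; apply: mulr_gt0 => //.
  by apply: addr_gt0; apply: chip; rewrite ?normrN.
have : P e - P 0 <= 0.
  rewrite subr_le0 /P oppr0 lerD // /phi ex0 mulg1; exact: fmax.
by rewrite E subr0 leNgt mulr_gt0.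
Qed.
End ComplexDerivative.

(** * The maximum principle *)

Section MaximumPrinciple.
Variable R : realType.
Local Notation C := R[i].
Implicit Types (f h : su2 R -> C) (g : su2 R) (a b : axis).

Definition sqn (z : C) : R := complex.Re z ^+ 2 + complex.Im z ^+ 2.

Lemma sqn_ge0 z : 0 <= sqn z.
Proof. by rewrite addr_ge0 ?sqr_ge0. Qed.

Lemma sqn_eq0 z : (sqn z == 0) = (z == 0).
Proof. by rewrite paddr_eq0 ?sqr_ge0 // !sqrf_eq0 eq_complex. Qed.

Lemma sqnM x y : sqn (x * y) = sqn x * sqn y.
Proof. by rewrite /sqn cReM cImM; ring. Qed.

Lemma Re_mulJ (z : C) : complex.Re (z * z^*) = sqn z.
Proof. by case: z => a b; rewrite /sqn cReM /=; ring. Qed.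

(** Young's inequality, by completing the square. *)
Lemma Re_mulJ_ge (x y : C) (t : R) : 0 < t ->
  - (t * sqn x + sqn y / t) <= 2 * complex.Re (x * y^*).
Proof.
move=> t0; have tn0 : t != 0 by rewrite gt_eqF.
case: x y => a b [c d]; rewrite /sqn cReM /= -subr_ge0.
have -> : 2 * (a * c - b * - d) - - (t * (a ^+ 2 + b ^+ 2) + (c ^+ 2 + d ^+ 2) / t)
  = ((t * a + c) ^+ 2 + (t * b + d) ^+ 2) / t by field.
by rewrite divr_ge0 ?(ltW t0) // addr_ge0 ?sqr_ge0.
Qed.

Lemma csmooth_n2 f : csmooth f -> csmooth (f * cconj f).
Proof. by move=> sf; apply: csmoothM => //; exact: csmooth_conj. Qed.

Lemma Re_dd2_n2 a f g : csmooth f ->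
  complex.Re (dd a (dd a (f * cconj f)) g) =
  2 * complex.Re (dd a (dd a f) g * (f g)^*) + 2 * sqn (dd a f g).
Proof.
move=> sf; have sc := csmooth_conj sf; have sd := csmooth_dd a sf.
have sdc := csmooth_conj sd.
have s1 := csmoothM sd sc; have s2 := csmoothM sf sdc.
rewrite (ddM a sf sc) (dd_conj a sf) (ddD a s1 s2) (ddM a sd sc) (ddM a sf sdc).
rewrite (dd_conj a sf) (dd_conj a sd).
change (complex.Re (dd a (dd a f) g * (f g)^* + dd a f g * (dd a f g)^* +
  (dd a f g * (dd a f g)^* + f g * (dd a (dd a f) g)^*)) =
  2 * complex.Re (dd a (dd a f) g * (f g)^*) + 2 * sqn (dd a f g)).
rewrite /sqn; move: (f g) (dd a f g) (dd a (dd a f) g) => [x y] [x' y'] [x'' y''].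
rewrite !(cReD, cReM) /=; ring.
Qed.

Lemma max_laplacian f (t : R) : csmooth f -> 0 <= t -> exists g,
  (forall g', complex.Re (f g') <= complex.Re (f g)) /\
  t * complex.Re (dd axI (dd axI f) g) + complex.Re (dd axJ (dd axJ f) g)
   + complex.Re (dd axK (dd axK f) g) <= 0.
Proof.
move=> sf t0.
have [|g gmax] := @su2_max R (fun g => complex.Re (f g)).
  move=> g; have cf := @csmooth_continuous R f sf g.
  exact: (continuous_cvg _ (@continuous_Re R _) cf).
exists g; split=> //.
have hJ := second_derivative_max axJ sf gmax.
have hK := second_derivative_max axK sf gmax.
have := ler_wpM2l t0 (second_derivative_max axI sf gmax); rewrite mulr0 => hI.
rewrite -[X in _ <= X]addr0; apply: lerD; last exact: hK.
by rewrite -[X in _ <= X]addr0; apply: lerD; [exact: hI | exact: hJ].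
Qed.

Lemma n2E f g : complex.Re ((f * cconj f) g) = sqn (f g).
Proof. exact: Re_mulJ. Qed.

(** At a maximum of |f|^2 its Laplacian is nonpositive, and it equals 2 Re k |f|^2 plus twice the
    squared derivatives, of which the one along I is already p^2 |f|^2. *)
Lemma weight_bound f (p : R) (k : C) g0 : csmooth f -> f g0 != 0 ->
  dd axI f = ('i * p%:C) *: f ->
  dd axI (dd axI f) + dd axJ (dd axJ f) + dd axK (dd axK f) = k *: f ->
  p ^+ 2 <= - complex.Re k.
Proof.
move=> sf f0 If Lf.
have [g [gmax]] := max_laplacian (csmooth_n2 sf) ler01.
rewrite mul1r (Re_dd2_n2 axI g sf) (Re_dd2_n2 axJ g sf) (Re_dd2_n2 axK g sf).
have sg : 0 < sqn (f g).
  apply: lt_le_trans (_ : sqn (f g0) <= _); first by rewrite lt_def sqn_ge0 sqn_eq0 f0.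
  by have := gmax g0; rewrite !n2E.
have Lg : dd axI (dd axI f) g + dd axJ (dd axJ f) g + dd axK (dd axK f) g = k * f g.
  by have := congr1 (fun u => u g) Lf.
have -> : sqn (dd axI f g) = p ^+ 2 * sqn (f g).
  rewrite If; change (sqn ('i * p%:C * f g) = p ^+ 2 * sqn (f g)).
  by rewrite !sqnM /sqn /=; ring.
have RL : complex.Re (dd axI (dd axI f) g * (f g)^*) + complex.Re (dd axJ (dd axJ f) g * (f g)^*)
   + complex.Re (dd axK (dd axK f) g * (f g)^*) = complex.Re k * sqn (f g).
  rewrite -!cReD -!mulrDl Lg; move: (f g) (k) => [x y] [u v]; rewrite /sqn !cReM /=; ring.
have := sqn_ge0 (dd axJ f g); have := sqn_ge0 (dd axK f g).
rewrite -(ler_pM2r sg (p ^+ 2)) mulNr -RL.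
move: (complex.Re (dd axI _ g * _)) (complex.Re (dd axJ _ g * _)) (complex.Re (dd axK _ g * _))
  (sqn (dd axJ f g)) (sqn (dd axK f g)) (p ^+ 2 * sqn (f g)).
by clear=> *; lra.
Qed.

Definition lap (t : R) f : su2 R -> C :=
  t%:C *: dd axI (dd axI f) + dd axJ (dd axJ f) + dd axK (dd axK f).

(** Half of the gradient term 2 t |I f|^2 absorbs the first order term b0 I f by Young's inequality;
    the other half is the gain on the left. *)
Lemma Re_laplacian_n2 (t : R) (a0 b0 : C) f g : 0 < t -> csmooth f ->
  lap t f = a0 *: f + b0 *: dd axI f ->
  t * sqn (dd axI f g) - (2 * `|complex.Re a0| + sqn b0 / t) * sqn (f g) <=
  t * complex.Re (dd axI (dd axI (f * cconj f)) g)
   + complex.Re (dd axJ (dd axJ (f * cconj f)) g)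
   + complex.Re (dd axK (dd axK (f * cconj f)) g).
Proof.
move=> t0 sf Lf; rewrite (Re_dd2_n2 axI g sf) (Re_dd2_n2 axJ g sf) (Re_dd2_n2 axK g sf).
have RL : t * complex.Re (dd axI (dd axI f) g * (f g)^*) + complex.Re (dd axJ (dd axJ f) g * (f g)^*)
   + complex.Re (dd axK (dd axK f) g * (f g)^*) =
   complex.Re a0 * sqn (f g) + complex.Re (dd axI f g * (b0^* * f g)^*).
  have Lg : t%:C * dd axI (dd axI f) g + dd axJ (dd axJ f) g + dd axK (dd axK f) g =
    a0 * f g + b0 * dd axI f g by have := congr1 (fun u => u g) Lf.
  have -> : t * complex.Re (dd axI (dd axI f) g * (f g)^*) =
     complex.Re (t%:C * dd axI (dd axI f) g * (f g)^*).
    by rewrite -mulrA [RHS]cReM /= mul0r subr0.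
  rewrite -!cReD -!mulrDl Lg; move: (f g) (a0) (b0) (dd axI f g) => [x y] [u v] [u' v'] [x' y'].
  by rewrite /sqn !(cReD, cReM, cImM, cImD) /=; ring.
have := Re_mulJ_ge (dd axI f g) (b0^* * f g) t0.
rewrite sqnM; have -> : sqn b0^* = sqn b0 by case: (b0) => x y; rewrite /sqn /= sqrrN.
have := sqn_ge0 (dd axJ f g); have := sqn_ge0 (dd axK f g).
have a0n : - `|complex.Re a0| <= complex.Re a0 by have /ler_normlP[] := lexx `|complex.Re a0|; lra.
have := ler_wpM2r (sqn_ge0 (f g)) a0n.
move: RL.
move: (complex.Re (dd axI _ g * _)) (complex.Re (dd axJ _ g * _)) (complex.Re (dd axK _ g * _))
  (sqn (dd axI f g)) (sqn (dd axJ f g)) (sqn (dd axK f g)) (sqn (f g)) (sqn b0) (t^-1)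
  (complex.Re (dd axI f g * _)) (complex.Re a0) => X1 X2 X3 sI sJ sK s sb ti Y ra.
clear=> RL h1 h2 h3 h4.
have -> : t * (2 * X1 + 2 * sI) + (2 * X2 + 2 * sJ) + (2 * X3 + 2 * sK) =
   2 * (t * X1 + X2 + X3) + 2 * (t * sI) + 2 * sJ + 2 * sK by ring.
rewrite RL.
have -> : t * sI - (2 * `|ra| + sb * ti) * s = t * sI - 2 * (`|ra| * s) - sb * s * ti by ring.
move: h1 h2 h3 h4; rewrite mulNr; move: (`|ra| * s) (ra * s) (t * sI) (sb * s * ti).
by clear=> *; lra.
Qed.

(** The constant D depends on the equation alone, so the estimate can be iterated. With c from
    [Re_laplacian_n2], the choice B = (c + 1) / t makes B t - c = 1: at a maximum of |I f|^2 + B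
    |f|^2 one gets |I f|^2 <= B c |f|^2, which gives D = B c + B everywhere. *)
Lemma bernstein (t : R) (a0 b0 : C) : 0 < t -> exists2 D : R, 0 <= D &
  forall f, csmooth f -> lap t f = a0 *: f + b0 *: dd axI f ->
    lap t (dd axI f) = a0 *: dd axI f + b0 *: dd axI (dd axI f) ->
  forall Q, (forall g, sqn (f g) <= Q) -> forall g, sqn (dd axI f g) <= D * Q.
Proof.
move=> t0; pose c : R := 2 * `|complex.Re a0| + sqn b0 / t.
have c0 : 0 <= c by rewrite addr_ge0 ?mulr_ge0 ?invr_ge0 ?sqn_ge0 ?(ltW t0).
pose B := (c + 1) / t.
have B0 : 0 <= B by rewrite divr_ge0 ?(ltW t0) // addr_ge0.
exists (B * c + B); first by apply: addr_ge0; [exact: mulr_ge0 | exact: B0].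
move=> f sf Lf Lf' Q fQ g1; set f' := dd axI f in Lf' *.
have sf' : csmooth f' by exact: csmooth_dd.
have sn := csmooth_n2 sf; have sn' := csmooth_n2 sf'.
pose Phi := f' * cconj f' + B%:C *: (f * cconj f).
have sB := csmoothZ B%:C sn.
have sP : csmooth Phi by exact: csmoothD.
have PE g : complex.Re (Phi g) = sqn (f' g) + B * sqn (f g).
  change (complex.Re ((f' * cconj f') g + B%:C * (f * cconj f) g) = sqn (f' g) + B * sqn (f g)).
  by rewrite cReD n2E cReM n2E /= mul0r subr0.
have ddP a g : complex.Re (dd a (dd a Phi) g) = complex.Re (dd a (dd a (f' * cconj f')) g)
    + B * complex.Re (dd a (dd a (f * cconj f)) g).
  rewrite (ddD a sn' sB) (ddZ a _ sn) (ddD a (csmooth_dd a sn') (csmoothZ _ (csmooth_dd a sn))).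
  rewrite (ddZ a _ (csmooth_dd a sn)).
  change (complex.Re (dd a (dd a (f' * cconj f')) g + B%:C * dd a (dd a (f * cconj f)) g)
    = complex.Re (dd a (dd a (f' * cconj f')) g) + B * complex.Re (dd a (dd a (f * cconj f)) g)).
  by rewrite cReD cReM /= mul0r subr0.
have [g [gmax]] := max_laplacian sP (ltW t0); rewrite !ddP.
have H1 := Re_laplacian_n2 g t0 sf Lf; have H2 := Re_laplacian_n2 g t0 sf' Lf'.
have := ler_wpM2l B0 H1; move: H2; rewrite -/c -/f'.
have tB : B * t = c + 1 by rewrite /B divfK // gt_eqF.
have p1 := mulr_ge0 (ltW t0) (sqn_ge0 (dd axI f' g)).
have M1 : B * c * sqn (f g) <= B * c * Q by apply: ler_wpM2l; [exact: mulr_ge0 | exact: fQ].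
have M2 : B * sqn (f g) <= B * Q by apply: ler_wpM2l; [exact: B0 | exact: fQ].
have := gmax g1; rewrite !PE.
have q1 : 0 <= B * sqn (f g1) by rewrite mulr_ge0 ?sqn_ge0.
move: p1 M1 M2 q1.
move: (sqn (f' g1)) (sqn (f' g)) (sqn (f g)) (sqn (f g1)) (sqn (dd axI f' g)).
move: (complex.Re (dd axI (dd axI (f' * _)) g)) (complex.Re (dd axI (dd axI (f * _)) g))
 (complex.Re (dd axJ (dd axJ (f' * _)) g)) (complex.Re (dd axJ (dd axJ (f * _)) g))
 (complex.Re (dd axK (dd axK (f' * _)) g)) (complex.Re (dd axK (dd axK (f * _)) g)).
clearbody B c; move: tB; clear -B c => tB x1 x2 x3 x4 x5 x6 sf1' sf' sf sf1 sf'' p1 M1 M2 q1 gm H2 H1 L.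
have H1' : (c + 1) * sf' - B * c * sf <= B * (t * x2 + x4 + x6).
  by rewrite -tB; move: H1; congr (_ <= _); ring.
have L' : (t * x1 + x3 + x5) + B * (t * x2 + x4 + x6) <= 0.
  by move: L; congr (_ <= _); ring.
have K : sf' <= B * c * sf.
  move: H1' H2 L'; rewrite mulrDl mul1r.
  move: (B * (t * x2 + x4 + x6)) (t * x1 + x3 + x5) (B * c * sf) (c * sf') (t * sf'') p1.
  by clear=> *; lra.
rewrite mulrDl.
move: K M1 M2 q1 gm; move: (B * c * sf) (B * c * Q) (B * sf) (B * Q) (B * sf1).
by clear=> *; lra.
Qed.
End MaximumPrinciple.

(** * Periodic functions with geometrically bounded derivatives *)

Section BandLimited.
Variable R : realType.
Local Notation C := R[i].
Local Notation nc := (@ComplexField.Normc.normc R).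

Lemma nc_ge0 (z : C) : 0 <= nc z.
Proof. by case: z => a b; exact: sqrtr_ge0. Qed.

Lemma nc_Re (z : C) : `|complex.Re z| <= nc z.
Proof.
by case: z => a b; rewrite /= -sqrtr_sqr ler_wsqrtr // lerDl sqr_ge0.
Qed.

Lemma nc_Im (z : C) : `|complex.Im z| <= nc z.
Proof.
by case: z => a b; rewrite /= -sqrtr_sqr ler_wsqrtr // lerDr sqr_ge0.
Qed.

Lemma nc_ReIm (z : C) : nc z <= `|complex.Re z| + `|complex.Im z|.
Proof. by have := normc_le_ReIm z; rewrite normc_def lecR; case: z. Qed.

Lemma nc_eq0 (z : C) : nc z <= 0 -> z = 0.
Proof.
move=> z0; apply: ComplexField.Normc.eq0_normc; apply/eqP.
by rewrite eq_le z0 nc_ge0.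
Qed.

Lemma ncM (x y : C) : nc (x * y) = nc x * nc y.
Proof. exact: ComplexField.Normc.normcM. Qed.

Lemma ncD (x y : C) : nc (x + y) <= nc x + nc y.
Proof. exact: le_normcD. Qed.

Lemma nc_real (x : R) : nc x%:C = `|x|.
Proof. by rewrite /= expr0n /= addr0 sqrtr_sqr. Qed.

Lemma nc_i : nc 'i = 1.
Proof. by rewrite /= expr0n /= add0r expr1n sqrtr1. Qed.

Lemma nc_expi (x : R) : nc (expi x) = 1.
Proof. by rewrite /= cos2Dsin2 sqrtr1. Qed.

Lemma expiD (x y : R) : expi (x + y) = expi x * expi y.
Proof.
by apply/eqP; rewrite eq_complex cReM cImM /= cosD sinD eqxx /= addrC mulrC eqxx.
Qed.

Lemma expi0 : expi (0 : R) = 1.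
Proof. by rewrite /expi cos0 sin0. Qed.

Lemma cder_expi (k t : R) : cder (fun s => expi (k * s)) t ('i * k%:C * expi (k * t)).
Proof.
have D : is_derive t 1 (fun s : R => k * s) k.
  by apply: is_derive_eq; rewrite /GRing.scale /=; ring.
split.
  have -> : complex.Re ('i * k%:C * expi (k * t)) = - sin (k * t) * k.
    by rewrite /expi !(cReM, cImM) /=; ring.
  exact: (is_derive1_comp (f := cos) (g := fun s => k * s)).
have -> : complex.Im ('i * k%:C * expi (k * t)) = cos (k * t) * k.
  by rewrite /expi !(cReM, cImM) /=; ring.
exact: (is_derive1_comp (f := sin) (g := fun s => k * s)).
Qed.

Lemma cder_lipschitz (phi phi' : R -> C) (B : R) (s t : R) :
  (forall t, cder phi t (phi' t)) -> (forall t, nc (phi' t) <= B) ->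
  nc (phi t - phi s) <= 2 * (B * `|t - s|).
Proof.
move=> dphi Bb.
have shift (u v : R -> R) : (forall t : R, is_derive t 1 u (v t)) ->
    (forall t, `|v t| <= B) -> `|u t - u s| <= B * `|t - s|.
  move=> du vB.
  have D (x : R) : is_derive x 1 (fun y => u (y + s)) (v (x + s)).
    rewrite -[v _]mulr1.
    apply: (is_derive1_comp (f := u) (g := fun y => y + s)).
    by apply: is_derive_eq; rewrite addr0.
  have [y [_ E]] := mvt0 (t - s) D.
  by rewrite subrK add0r in E; rewrite E normrM ler_wpM2r.
have re := shift _ _ (fun t => (dphi t).1) (fun t => le_trans (nc_Re _) (Bb t)).
have im := shift _ _ (fun t => (dphi t).2) (fun t => le_trans (nc_Im _) (Bb t)).
apply: (le_trans (nc_ReIm _)); rewrite cReD cReN cImD cImN.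
by rewrite mulr_natl mulr2n lerD.
Qed.

(** A bound that implies its own half can be halved forever, while the weight c x stays fixed. *)
Lemma zero_of_contraction (T : Type) (P : R -> Prop) (n c : T -> R) (Q : R) :
  (forall Q, P Q -> forall x, n x <= Q * c x) -> (forall Q, P Q -> P (Q / 2)) -> P Q ->
  forall x, n x <= 0.
Proof.
move=> Pn Phalf PQ x.
have Pi i : P (Q / 2 ^+ i).
  elim: i => [|i IH]; first by rewrite expr0 divr1.
  by rewrite exprSr invfM mulrA; exact: Phalf.
apply/ler_addgt0Pr => e e0; rewrite add0r.
have [m] : exists m : nat, Q * c x / e < 2 ^+ m.
  by exists (Num.bound (Q * c x / e)); exact: upper_nthrootP.
rewrite ltr_pdivrMr // => H.
apply: (le_trans (Pn _ (Pi m) x)).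
by rewrite mulrAC ler_pdivrMr ?exprn_gt0 // (mulrC e); exact: ltW.
Qed.

Variables (eps c : R).
Hypotheses (eps0 : 0 < eps) (c0 : 0 <= c).

(** The members are the iterates of -i d/dt, which is how A acts along t |-> exp(tI); [shift_sub k]
    below is then the action of A - k. *)
Definition derivative_chain (u : nat -> R -> C) :=
  forall j t, cder (u j) t ('i * u j.+1 t).
Definition geometric_bound (u : nat -> R -> C) (Q : R) := forall j t, nc (u j t) <= Q * c ^+ j.
Definition quasi_periodic (w : C) (u : nat -> R -> C) := forall j t, u j (t + eps) = w * u j t.
Definition shift_sub (k : C) (u : nat -> R -> C) := fun j t => u j.+1 t - k * u j t.

Lemma cderB phi psi (t : R) (d e : C) : cder phi t d -> cder psi t e ->
  cder (fun s => phi s - psi s) t (d - e).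
Proof.
move=> hd he; have := cderD hd (cderM (cder_cst (-1) t) he).
by rewrite mul0r add0r mulN1r; under [X in cder X]eq_fun do rewrite mulN1r.
Qed.

Lemma derivative_chain_shift k u : derivative_chain u -> derivative_chain (shift_sub k u).
Proof.
move=> du j t; rewrite /shift_sub.
have := cderM (cder_cst k t) (du j t); rewrite mul0r add0r => h.
have := cderB (du j.+1 t) h.
by rewrite mulrBr !mulrA (mulrC k).
Qed.

Lemma geometric_bound_shift (k : R) u Q : 0 <= Q -> geometric_bound u Q ->
  geometric_bound (shift_sub k%:C u) (Q * (c + `|k|)).
Proof.
move=> Q0 uQ j t; rewrite /shift_sub.
apply: (le_trans (ncD _ _)); rewrite normcN ncM nc_real.
have -> : Q * (c + `|k|) * c ^+ j = Q * c ^+ j.+1 + `|k| * (Q * c ^+ j) by rewrite exprS; ring.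
by apply: lerD => //; apply: ler_wpM2l.
Qed.

Lemma quasi_periodic_shift k w u : quasi_periodic w u -> quasi_periodic w (shift_sub k u).
Proof. by move=> pu j t; rewrite /shift_sub !pu; ring. Qed.

(** Quasi-periodicity turns |w - 1| |u_j(t)| into the increment of u_j over eps, at most 2 eps Q
    c^(j+1), with 2 for the separate real and imaginary parts. By hypothesis this is at most |w - 1|
    Q c^j / 2, so the bound Q may be halved. *)
Lemma vanish_off_resonance (w : C) (u : nat -> R -> C) (Q : R) : 0 <= Q ->
  derivative_chain u -> geometric_bound u Q -> quasi_periodic w u ->
  w != 1 -> 4 * eps * c <= nc (w - 1) -> forall j t, u j t = 0.
Proof.
move=> Q0 du uQ pu w1 wc j t.
have n0 : 0 < nc (w - 1).
  rewrite lt_def nc_ge0 andbT; apply: contra w1 => /eqP n1; rewrite -subr_eq0.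
  by apply/eqP; apply: nc_eq0; rewrite n1.
apply: nc_eq0.
have := @zero_of_contraction (nat * R)%type (fun Q => 0 <= Q /\ geometric_bound u Q)
  (fun p => nc (u p.1 p.2)) (fun p => c ^+ p.1) Q _ _ (conj Q0 uQ) (j, t).
apply => {Q Q0 uQ j t} Q [Q0 uQ]; first by move=> [j t]; exact: uQ.
split; first by rewrite divr_ge0.
move=> j t.
have L : nc (u j (t + eps) - u j t) <= 2 * (Q * c ^+ j.+1 * `|t + eps - t|).
  by apply: (cder_lipschitz _ _ (du j)) => s; rewrite ncM nc_i mul1r; exact: uQ.
rewrite addrAC subrr add0r gtr0_norm // in L.
rewrite pu -[X in _ - X]mul1r -mulrBl ncM in L.
rewrite -(ler_pM2l n0); apply: (le_trans L).
have -> : 2 * (Q * c ^+ j.+1 * eps) = 4 * eps * c * (Q / 2 * c ^+ j) by rewrite exprS; field.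
by apply: ler_wpM2r => //; rewrite mulr_ge0 ?divr_ge0 ?exprn_ge0.
Qed.

(** The function exp(-ikt) u_j has period eps, so by Rolle the real and the imaginary part of its
    derivative each vanish once in a period. That derivative is (A - k) u_j up to a phase, hence at
    most 2 eps times a bound for the next derivative: the bound for (A - k) u is halved. *)
Lemma exact_weight (k : R) (u : nat -> R -> C) (Q : R) : 0 <= Q ->
  derivative_chain u -> geometric_bound u Q -> quasi_periodic (expi (eps * k)) u ->
  2 * (2 * eps * (c + `|k|)) <= 1 -> forall j t, u j.+1 t = k%:C * u j t.
Proof.
move=> Q0 du uQ pu small j t.
pose w := shift_sub k%:C u.
have dw := derivative_chain_shift k%:C du.
have pw := quasi_periodic_shift k%:C pu.
have wQ : geometric_bound w (Q * (c + `|k|)) by exact: geometric_bound_shift.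
have ck : 0 <= c + `|k| by rewrite addr_ge0.
apply/eqP; rewrite -subr_eq0; apply/eqP; apply: nc_eq0.
have := @zero_of_contraction (nat * R)%type (fun Q => 0 <= Q /\ geometric_bound w Q)
  (fun p => nc (w p.1 p.2)) (fun p => c ^+ p.1) (Q * (c + `|k|)) _ _
  (conj (mulr_ge0 Q0 ck) wQ) (j, t).
apply => {Q Q0 uQ wQ j t} Q [Q0 wQ]; first by move=> [j t]; exact: wQ.
split; first by rewrite divr_ge0.
move=> j t.
pose rho s := expi (- k * s) * u j s.
pose v s := 'i * (expi (- k * s) * w j s).
have drho s : cder rho s (v s).
  have -> : v s = 'i * (- k)%:C * expi (- k * s) * u j s + expi (- k * s) * ('i * u j.+1 s).
    by rewrite /v /w /shift_sub rmorphN /=; ring.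
  exact: cderM (cder_expi (- k) s) (du j s).
have dv s : cder v s (- (expi (- k * s) * shift_sub k%:C w j s)).
  have i2 : 'i * 'i = -1 :> C by rewrite -expr2 sqr_i.
  have -> : - (expi (- k * s) * shift_sub k%:C w j s) = 0 * (expi (- k * s) * w j s) +
      'i * ('i * (- k)%:C * expi (- k * s) * w j s + expi (- k * s) * ('i * w j.+1 s)).
    rewrite -mulN1r -i2 /shift_sub rmorphN /=; ring.
  exact: cderM (cder_cst 'i s) (cderM (cder_expi (- k) s) (dw j s)).
have perio : rho (t + eps) = rho t.
  rewrite /rho pu mulrDr expiD -[in RHS](mul1r (u j t)).
  have -> : 1 = expi (- k * eps) * expi (eps * k) :> C.
    by rewrite -expiD mulNr (mulrC k) addNr expi0.
  by ring.
have vb s : nc (- (expi (- k * s) * shift_sub k%:C w j s)) <= Q * (c + `|k|) * c ^+ j.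
  by rewrite normcN ncM nc_expi mul1r; exact: geometric_bound_shift.
have bnd (a a' a'' : R -> R) : (forall s : R, is_derive s 1 a (a' s)) ->
    (forall s : R, is_derive s 1 a' (a'' s)) -> a (t + eps) = a t ->
    (forall s, `|a'' s| <= Q * (c + `|k|) * c ^+ j) ->
    `|a' t| <= eps * (Q * (c + `|k|) * c ^+ j).
  move=> da da' pa ab.
  have cnt (p q : R -> R) (x y : R) : (forall t : R, is_derive t 1 p (q t)) ->
      {within `[x, y], continuous p}.
    move=> dp; apply: continuous_subspaceT => z.
    by apply: differentiable_continuous; apply/derivable1_diffP; have [] := dp z.
  have te : t < t + eps by rewrite ltrDl.
  have [s] := MVT te (fun x _ => da x) (cnt _ _ _ _ da).
  rewrite in_itv /= pa subrr => /andP[ts se] /esym/eqP.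
  rewrite addrAC subrr add0r mulf_eq0 (gt_eqF eps0) orbF => /eqP a's.
  have [y] := MVT ts (fun x _ => da' x) (cnt _ _ _ _ da').
  rewrite a's sub0r => _ E.
  rewrite -normrN E mulrC normM_le // gtr0_norm ?subr_gt0 //.
  by rewrite lerBlDl ltW.
have re := bnd _ _ _ (fun s => (drho s).1) (fun s => (dv s).1)
  (congr1 (@complex.Re R) perio) (fun s => le_trans (nc_Re _) (vb s)).
have im := bnd _ _ _ (fun s => (drho s).2) (fun s => (dv s).2)
  (congr1 (@complex.Im R) perio) (fun s => le_trans (nc_Im _) (vb s)).
have -> : nc (w j t) = nc (v t) by rewrite /v !ncM nc_i nc_expi !mul1r.
apply: (le_trans (nc_ReIm _)); apply: (le_trans (lerD re im)).
have -> : eps * (Q * (c + `|k|) * c ^+ j) + eps * (Q * (c + `|k|) * c ^+ j) =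
   2 * (2 * eps * (c + `|k|)) * (Q / 2 * c ^+ j) by field.
by rewrite -[leRHS]mul1r; apply: ler_wpM2r => //; rewrite mulr_ge0 ?divr_ge0 ?exprn_ge0.
Qed.

End BandLimited.

(** * Discrete Fourier components of a periodic function *)

Section DiscreteFourier.
Variable R : realType.
Local Notation C := R[i].
Local Notation nc := (@ComplexField.Normc.normc R).

Definition shift_prod (ks : seq C) (u : nat -> R -> C) := foldr (@shift_sub R) u ks.

Lemma shift_prod_weight ks (k : C) u : (forall j t, u j.+1 t = k * u j t) ->
  forall j t, shift_prod ks u j t = \prod_(k' <- ks) (k - k') * u j t.
Proof.
move=> uk; elim: ks => [|k' ks IH] j t; first by rewrite big_nil mul1r.
by rewrite /= /shift_sub -/(shift_prod ks u) !IH big_cons uk; ring.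
Qed.

Lemma shift_prod0 ks u : (forall j t, u j t = 0) -> forall j t, shift_prod ks u j t = 0.
Proof.
move=> u0; elim: ks => [|k' ks IH] j t //=.
by rewrite /shift_sub -/(shift_prod ks u) !IH mulr0 subr0.
Qed.

Lemma shift_prod_sum (n : nat) ks (r : 'I_n -> nat -> R -> C) u :
  (forall j t, u j t = \sum_(l < n) r l j t) ->
  forall j t, shift_prod ks u j t = \sum_(l < n) shift_prod ks (r l) j t.
Proof.
move=> ur; elim: ks => [|k' ks IH] j t //=.
rewrite /shift_sub -/(shift_prod ks u) !IH mulr_sumr -sumrB.
by apply: eq_bigr.
Qed.

Lemma expiX (x : R) n : expi x ^+ n = expi (n%:R * x).
Proof.
elim: n => [|n IH]; first by rewrite mul0r expi0.
by rewrite exprS IH -expiD -[X in X + _]mul1r -mulrDl -natr1 addrC.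
Qed.

Lemma expi_2pi (n : nat) : expi (n%:R * (2 * pi)) = 1 :> C.
Proof.
rewrite -expiX; suff -> : expi (2 * pi) = 1 :> C by rewrite expr1n.
by rewrite /expi mulr_natl sin2pi cos2pi.
Qed.

Lemma expi_neq1 (x : R) : 0 < x < 2 * pi -> expi x != 1.
Proof.
move=> /andP[x0 x2]; apply/negP => /eqP/(congr1 (@complex.Re R)) /= c1.
have s0 : 0 < sin (x / 2).
  by apply: sin_gt0_pi; rewrite divr_gt0 //= ltr_pdivrMr // mulrC.
have : cos x = 1 - 2 * sin (x / 2) ^+ 2.
  by rewrite {1}(splitr x) cosD -!expr2 cos2sin2; ring.
rewrite c1 => /eqP; rewrite eq_sym -subr_eq0 addrAC subrr add0r oppr_eq0.
by rewrite mulf_eq0 pnatr_eq0 /= sqrf_eq0 (gt_eqF s0).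
Qed.

Lemma cder_sum (n : nat) (phi : 'I_n -> R -> C) t (d : 'I_n -> C) :
  (forall i, cder (phi i) t (d i)) -> cder (fun s => \sum_(i < n) phi i s) t (\sum_(i < n) d i).
Proof.
elim: n phi d => [|n IH] phi d H.
  rewrite big_ord0; have -> : (fun s => \sum_(i < 0) phi i s) = fun=> 0.
    by apply/funext => s; rewrite big_ord0.
  exact: cder_cst.
rewrite big_ord_recr /=.
have -> : (fun s => \sum_(i < n.+1) phi i s) =
    fun s => \sum_(i < n) phi (widen_ord (leqnSn n) i) s + phi ord_max s.
  by apply/funext => s; rewrite big_ord_recr.
exact: cderD (IH _ _ (fun i => H _)) (H _).
Qed.

Section Components.
Variables (K : nat) (h : nat -> R -> C).
Local Notation M := (K.*2.+1).
Local Notation eps := (2 * pi / M%:R : R).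
Hypothesis hper : forall j t, h j (t + 2 * pi) = h j t.

Definition freq (l : nat) : R := l%:R - K%:R.

(** The projection to the functions that translation by eps multiplies by [expi (eps * freq l)]. It
    sees frequencies only modulo M, so a component need not be an exponential. *)
Definition fourier_comp (l : nat) (j : nat) (t : R) : C :=
  M%:R^-1 * \sum_(i < M) expi (- (i%:R * eps * freq l)) * h j (t + i%:R * eps).

Lemma M_neq0 : (M%:R : R) != 0. Proof. by rewrite pnatr_eq0. Qed.
Lemma MC_neq0 : (M%:R : C) != 0. Proof. by rewrite pnatr_eq0. Qed.

Lemma expi_freq l : expi (- (2 * pi * freq l)) = 1 :> C.
Proof.
have -> : - (2 * pi * freq l) = K%:R * (2 * pi) + - (l%:R * (2 * pi)) by rewrite /freq; ring.
have := expiN (l%:R * (2 * pi) : R); rewrite expi_2pi mul1r => e.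
by rewrite expiD e expi_2pi mulr1.
Qed.

Lemma fourier_comp_quasi_periodic l :
  quasi_periodic eps (expi (eps * freq l)) (fourier_comp l).
Proof.
move=> j t; rewrite /fourier_comp mulrCA; congr (_ * _).
pose G i := expi (- (i%:R * eps * freq l)) * h j (t + i%:R * eps).
have GM : G M = G 0%N.
  rewrite /G mul0r mul0r oppr0 expi0 mul1r addr0.
  have -> : M%:R * eps = 2 * pi by rewrite mulrC divfK // M_neq0.
  by rewrite hper expi_freq mul1r.
have -> : \sum_(i < M) expi (- (i%:R * eps * freq l)) * h j (t + eps + i%:R * eps) =
    \sum_(i < M) expi (eps * freq l) * G i.+1.
  apply: eq_bigr => i _; rewrite /G [RHS]mulrA -expiD -natr1; congr (expi _ * h j _); ring.
rewrite -mulr_sumr; congr (_ * _).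
have E : \sum_(i < M.+1) G i = G 0%N + \sum_(i < M) G i.+1 by rewrite big_ord_recl.
by apply: (addrI (G 0%N)); rewrite -E big_ord_recr /= GM addrC.
Qed.

(** Summing over l first leaves geometric sums of M-th roots of unity, which vanish for every
    translation but the zero one. *)
Lemma sum_fourier_comp j t : \sum_(l < M) fourier_comp l j t = h j t.
Proof.
rewrite /fourier_comp -mulr_sumr exchange_big /= big_ord_recl /=.
have orth (i : nat) : (0 < i < M)%N -> \sum_(l < M) expi (- (i%:R * eps * freq l)) = 0 :> C.
  move=> /andP[i0 iM].
  pose z : C := expi (- (i%:R * eps)).
  have ip : 0 < i%:R * eps by rewrite mulr_gt0 ?ltr0n // divr_gt0 ?mulr_gt0 ?pi_gt0 ?ltr0n.
  have z1 : z != 1.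
    have : expi (i%:R * eps) != 1.
      apply: expi_neq1; rewrite ip /= mulrA ltr_pdivrMr ?ltr0n // mulrC ltr_pM2l ?ltr_nat //.
      by rewrite mulr_gt0 ?pi_gt0.
    apply: contra => /eqP zE; have := expiN (i%:R * eps); rewrite -/z zE mulr1 => ->.
    exact: eqxx.
  have zM : z ^+ M = 1.
    rewrite expiX; have -> : M%:R * - (i%:R * eps) = - (i%:R * (2 * pi)).
      by rewrite mulrN mulrCA (mulrC M%:R) divfK ?M_neq0.
    by have := expiN (i%:R * (2 * pi) : R); rewrite expi_2pi mul1r.
  have -> : \sum_(l < M) expi (- (i%:R * eps * freq l)) =
      expi (i%:R * eps * K%:R) * \sum_(l < M) z ^+ l.
    rewrite mulr_sumr; apply: eq_bigr => l _; rewrite expiX -expiD; congr expi.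
    by rewrite /freq; ring.
  suff -> : \sum_(l < M) z ^+ l = 0 by rewrite mulr0.
  have := subrX1 z M; rewrite zM subrr => /esym/eqP.
  by rewrite mulf_eq0 subr_eq0 (negbTE z1) => /eqP.
rewrite [X in _ * (_ + X)]big1 ?addr0; last first.
  by move=> i _; rewrite -mulr_suml orth ?mul0r //= ltnS.
rewrite mul0r addr0 -mulr_suml.
rewrite [X in _ * (X * _)](_ : _ = M%:R).
  by rewrite mulrA mulVf ?mul1r // MC_neq0.
transitivity (\sum_(l < M) (1 : C)); last by rewrite sumr_const card_ord.
by apply: eq_bigr => l _; rewrite mul0r oppr0 expi0.
Qed.

Lemma fourier_comp_chain l : derivative_chain h -> derivative_chain (fourier_comp l).
Proof.
move=> dh j t; rewrite /fourier_comp.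
have -> : 'i * (M%:R^-1 * \sum_(i < M) expi (- (i%:R * eps * freq l)) * h j.+1 (t + i%:R * eps))
  = 0 * (\sum_(i < M) expi (- (i%:R * eps * freq l)) * h j (t + i%:R * eps)) + M%:R^-1 *
    \sum_(i < M) (0 * h j (t + i%:R * eps) +
      expi (- (i%:R * eps * freq l)) * ('i * h j.+1 (t + i%:R * eps))).
  rewrite mul0r add0r mulrCA mulr_sumr; congr (_ * _); apply: eq_bigr => i _; ring.
apply: cderM (cder_cst _ _) _; apply: cder_sum => i; apply: cderM (cder_cst _ _) _.
have := @cder_affine R (h j) 1 (i%:R * eps) t _ (dh j _).
rewrite mul1r mul1r; congr (cder _ _ _).
by apply/funext => s; rewrite mul1r.
Qed.

Lemma fourier_comp_bound (c : R) l Q : geometric_bound c h Q ->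
  geometric_bound c (fourier_comp l) Q.
Proof.
move=> hQ j t; rewrite /fourier_comp ncM.
have ncsum (n : nat) (F : 'I_n -> C) (B : R) : (forall i, nc (F i) <= B) ->
    nc (\sum_(i < n) F i) <= n%:R * B.
  elim: n F => [|n IH] F FB; first by rewrite big_ord0 mul0r nc_real normr0.
  rewrite big_ord_recr /=; apply: (le_trans (ncD _ _)).
  by rewrite -natr1 mulrDl mul1r lerD // IH.
have -> : nc (M%:R^-1) = M%:R^-1.
  by rewrite -(rmorph_nat (real_complex R)) -fmorphV nc_real ger0_norm.
rewrite mulrC ler_pdivrMr ?ltr0n // [leRHS]mulrC; apply: ncsum => i.
by rewrite ncM nc_expi mul1r.
Qed.
End Components.

Lemma cos_le_of_le (x y : R) : 0 <= x -> x <= y -> y <= pi -> cos y <= cos x.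
Proof.
move=> x0 xy yp; rewrite leNgt; apply/negP => H.
have : y < x by rewrite -ltr_cos //; rewrite ?in_itv /= ?x0 ?yp ?(le_trans xy yp) ?(le_trans x0 xy).
by rewrite ltNge xy.
Qed.

(* The discrete Fourier components of h with respect to translation by 2 pi / M,
   M = 2 K + 1, inherit the growth bound. Comparing the translation factor with the
   mean value theorem halves the bound of a component of large frequency again and
   again, so that it vanishes, and likewise shows the others to be exponentials. *)
Lemma band_limited (c : R) : 0 <= c -> exists K : nat, forall h Q, 0 <= Q ->
  derivative_chain h -> geometric_bound c h Q -> (forall j t, h j (t + 2 * pi) = h j t) ->
  forall j t, shift_prod [seq (freq K l)%:C | l <- iota 0 K.*2.+1] h j t = 0.
Proof.
move=> c0; pose delta : R := 1 - cos (1 / 8).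
have d8 : delta <= 1 / 8.
  have := cos_sub1_le (1 / 8 : R); rewrite distrC ger0_norm ?subr_ge0 ?cos_le1 //.
  by rewrite ger0_norm // divr_ge0.
have pi2 : 2 <= pi :> R by exact: pi_ge2.
have d0 : 0 < delta.
  have p8 : 1 / 8 <= pi :> R by apply: le_trans pi2; lra.
  have z8 : 0 < 1 / 8 :> R by rewrite divr_gt0.
  have H : cos (1 / 8) < cos 0 :> R.
    by rewrite ltr_cos //; rewrite ?in_itv /= ?lexx ?p8 ?pi_ge0 ?(ltW z8).
  by rewrite /delta subr_gt0 -[X in _ < X](cos0 R).
exists (Num.bound (8 * pi * c / delta)); set K := Num.bound _ => h Q Q0 dh hQ hper j t.
have KB : 8 * pi * c / delta < K%:R.
  apply: archi_boundP; rewrite divr_ge0 ?(ltW d0) //.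
  by rewrite mulr_ge0 // mulr_ge0 // pi_ge0.
set M := K.*2.+1; pose eps : R := 2 * pi / M%:R.
have M0 : 0 < M%:R :> R by rewrite ltr0n.
have ME : M%:R = 2 * K%:R + 1 :> R by rewrite /M -natr1 -mul2n natrM.
have K0 : 0 <= K%:R :> R by [].
have eps0 : 0 < eps by rewrite divr_gt0 // mulr_gt0 // pi_gt0.
have epsc : 4 * eps * c <= delta.
  have -> : 4 * eps * c = (8 * pi * c) / M%:R by rewrite /eps; field; rewrite gt_eqF.
  rewrite ler_pdivrMr // [leRHS]mulrC -ler_pdivrMr //; apply: ltW; apply: (lt_le_trans KB).
  by rewrite ME; lra.
rewrite (@shift_prod_sum M _ (fun l => fourier_comp K h l)); last first.
  by move=> i s; rewrite sum_fourier_comp.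
apply: big1 => l _.
pose k := freq K l.
have kK : `|k| <= K%:R.
  have lM : l%:R <= 2 * K%:R :> R.
    by rewrite -natrM ler_nat mul2n -ltnS; exact: ltn_ord.
  have l0 : 0 <= l%:R :> R by [].
  by rewrite /k /freq ler_norml; apply/andP; split; lra.
have ku := fourier_comp_quasi_periodic K hper l.
have kd := fourier_comp_chain K l dh.
have kb := fourier_comp_bound K l hQ.
have [small|big] := leP (2 * (2 * eps * (c + `|k|))) 1.
  have ew := exact_weight eps0 c0 Q0 kd kb ku small.
  rewrite (shift_prod_weight _ ew).
  have -> : \prod_(k' <- [seq (freq K l)%:C | l <- iota 0 M]) ((freq K l)%:C - k') = 0.
    apply/eqP; rewrite prodf_seq_eq0; apply/hasP.
    exists (freq K l)%:C; last by rewrite /= subrr eqxx.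
    by apply/mapP; exists (l : nat) => //; rewrite mem_iota add0n ltn_ord.
  by rewrite mul0r.
(* From 4 eps (c + |k|) > 1 and 4 eps c <= delta <= 1/8, eps |k| is in fact at least 7/32. *)
have ek : 1 / 8 <= eps * `|k|.
  have -> : eps * `|k| = (2 * (2 * eps * (c + `|k|)) - 4 * eps * c) / 4 by field.
  by lra.
have ekp : eps * `|k| <= pi.
  rewrite /eps mulrAC ler_pdivrMr //.
  have := pi_gt0 R; move: (pi : R) => p p0.
  by rewrite ME -mulrA mulrC -mulrA ler_pM2l //; lra.
have wd : delta <= nc (expi (eps * k) - 1).
  apply: le_trans (nc_Re _); rewrite cReD cReN /= distrC.
  apply: le_trans (ler_norm _); rewrite lerD2l lerN2.
  rewrite -cos_norm normrM (gtr0_norm eps0).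
  by apply: cos_le_of_le.
apply: shift_prod0; apply: (vanish_off_resonance eps0 c0 Q0 kd kb ku).
  apply/negP => /eqP w1; move: wd; rewrite -/eps -/k in w1; rewrite w1 subrr.
  by rewrite nc_real normr0 leNgt d0.
exact: le_trans epsc wd.
Qed.
End DiscreteFourier.

(** * Weights and the Dirac equation, abstractly *)

Section Dimension.
Variable K : fieldType.
Implicit Types W : lmodType K.

Definition subsp W (P : W -> Prop) := P 0 /\ forall a u v, P u -> P v -> P (a *: u + v).

(** The ambient space may be infinite-dimensional, so dimension means a finite list with unique
    coordinates, in the form of [has_dim]. *)
Definition dim_is W (P : W -> Prop) (d : nat) := exists b : 'I_d -> W,
  (forall i, P (b i)) /\
  forall w, P w -> exists! c : 'rV[K]_d, w = \sum_(i < d) c 0 i *: b i.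

Lemma subspZ W (P : W -> Prop) a u : subsp P -> P u -> P (a *: u).
Proof. by move=> [P0 PD] Pu; rewrite -[a *: u]addr0; exact: PD. Qed.

Lemma subspD W (P : W -> Prop) u v : subsp P -> P u -> P v -> P (u + v).
Proof. by move=> [P0 PD] Pu Pv; rewrite -[u]scale1r; exact: PD. Qed.

Lemma subspB W (P : W -> Prop) u v : subsp P -> P u -> P v -> P (u - v).
Proof. by move=> sP Pu Pv; rewrite -scaleN1r addrC; apply: (proj2 sP). Qed.

Lemma subsp_sum W (P : W -> Prop) d (c : 'I_d -> K) (b : 'I_d -> W) :
  subsp P -> (forall i, P (b i)) -> P (\sum_(i < d) c i *: b i).
Proof.
move=> sP Pb; elim/big_ind: _ => //; first by case: sP.
  by move=> u v; exact: subspD.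
by move=> i _; exact: subspZ.
Qed.

Lemma dim_ext W (P P' : W -> Prop) d : (forall w, P w <-> P' w) -> dim_is P d -> dim_is P' d.
Proof.
move=> PP [b [Pb Hb]]; exists b; split=> [i|w /PP]; last exact: Hb.
exact/PP.
Qed.

Lemma dim0 W (P : W -> Prop) : (forall w, P w -> w = 0) -> dim_is P 0.
Proof.
move=> P0; exists (fun=> 0); split=> [[]//|w /P0 ->].
exists 0; split=> [|c _]; first by rewrite big_ord0.
by apply/rowP => -[].
Qed.

Lemma dim_iso W W' (P : W -> Prop) (P' : W' -> Prop) (phi : W -> W')
    (psi : W' -> W) d : subsp P -> linear phi ->
  (forall w, P w -> P' (phi w)) -> (forall w, P' w -> P (psi w)) ->
  (forall w, P w -> psi (phi w) = w) -> (forall w, P' w -> phi (psi w) = w) ->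
  dim_is P d -> dim_is P' d.
Proof.
move=> sP lphi Pphi Ppsi K1 K2 [b [Pb Hb]]; exists (fun i => phi (b i)).
split=> [i|w Pw]; first exact: Pphi.
have phi0 : phi 0 = 0.
  by have := lphi (-1) 0 0; rewrite scaler0 addr0 scaleN1r addNr.
have E (c : 'rV_d) : \sum_(i < d) c 0 i *: phi (b i) = phi (\sum_(i < d) c 0 i *: b i).
  by elim/big_rec2: _ => // i u v _ ->; rewrite lphi.
have [c [cE cU]] := Hb _ (Ppsi _ Pw).
exists c; split=> [|c']; first by rewrite E -cE K2.
rewrite E => wE; apply: cU; rewrite wE K1 //.
exact: subsp_sum.
Qed.

Lemma dim_pos W (P : W -> Prop) d : dim_is P d -> (0 < d)%N -> exists2 w, P w & w != 0.
Proof.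
case: d => // d [b [Pb Hb]] _; exists (b ord0) => //; apply/eqP => b0.
have [c [_ cU]] := Hb _ (Pb ord0).
have e (a : K) : b ord0 = \sum_(i < d.+1) (a *: delta_mx 0 ord0 : 'rV_d.+1) 0 i *: b i.
  rewrite (bigD1 ord0) //= !mxE eqxx /= big1 ?addr0; first by rewrite b0 scaler0.
  by move=> i i0; rewrite !mxE (negbTE i0) mulr0 scale0r.
have := cU _ (e 1); rewrite (cU _ (e 0)) scale0r scale1r => /rowP/(_ ord0)/eqP.
by rewrite !mxE eqxx /= eq_sym oner_eq0.
Qed.

Lemma dim_add W (P P1 P2 : W -> Prop) d1 d2 : subsp P1 -> subsp P2 ->
  (forall w, P w <-> exists w1 w2, [/\ P1 w1, P2 w2 & w = w1 + w2]) ->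
  (forall w, P1 w -> P2 w -> w = 0) ->
  dim_is P1 d1 -> dim_is P2 d2 -> dim_is P (d1 + d2).
Proof.
move=> s1 s2 PE P12 [b1 [Pb1 Hb1]] [b2 [Pb2 Hb2]].
pose b (i : 'I_(d1 + d2)) := match fintype.split i with inl j => b1 j | inr j => b2 j end.
have bl j : b (lshift d2 j) = b1 j by rewrite /b -[lshift d2 j]/(unsplit (inl j)) unsplitK.
have br j : b (rshift d1 j) = b2 j by rewrite /b -[rshift d1 j]/(unsplit (inr j)) unsplitK.
have Q1 w : P1 w -> P w.
  by move=> h; apply/PE; exists w, 0; rewrite addr0; split=> //; case: s2.
have Q2 w : P2 w -> P w.
  by move=> h; apply/PE; exists 0, w; rewrite add0r; split=> //; case: s1.
have E (c : 'rV_(d1 + d2)) : \sum_(i < d1 + d2) c 0 i *: b i =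
    \sum_(j < d1) (lsubmx c) 0 j *: b1 j + \sum_(j < d2) (rsubmx c) 0 j *: b2 j.
  by rewrite big_split_ord; congr (_ + _); apply: eq_bigr => j _; rewrite mxE ?bl ?br.
exists b; split=> [i|w /PE[w1 [w2 [Pw1 Pw2 wE]]]].
  by rewrite /b; case: (fintype.split i) => j; [exact: Q1|exact: Q2].
have [c1 [c1E c1U]] := Hb1 _ Pw1; have [c2 [c2E c2U]] := Hb2 _ Pw2.
exists (row_mx c1 c2); split=> [|c']; first by rewrite E row_mxKl row_mxKr -c1E -c2E.
rewrite E => cE.
have P1' := subsp_sum (fun j => lsubmx c' 0 j) s1 Pb1.
have P2' := subsp_sum (fun j => rsubmx c' 0 j) s2 Pb2.
set u1 := \sum_(j < d1) _ in cE P1'; set u2 := \sum_(j < d2) _ in cE P2'.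
have e1 : w1 - u1 = u2 - w2.
  by apply/eqP; rewrite subr_eq addrAC -subr_eq opprK -wE cE addrC.
have z : w1 - u1 = 0 by apply: P12; [exact: subspB|rewrite e1; exact: subspB].
have e2 : u2 - w2 = 0 by rewrite -e1.
rewrite (c1U (lsubmx c')) ?(c2U (rsubmx c')) ?hsubmxK //.
  by apply/esym/eqP; rewrite -subr_eq0 e2.
by apply/eqP; rewrite -subr_eq0 z.
Qed.

Section EigenDecomposition.
Variables (W : lmodType K) (B : {linear W -> W}) (P : W -> Prop).
Hypotheses (sP : subsp P) (PB : forall w, P w -> P (B w)).

Definition eig_prod (s : seq K) (w : W) := foldr (fun k u => B u - k *: u) w s.

Lemma eig_prod_eig s k w : B w = k *: w -> eig_prod s w = \prod_(l <- s) (k - l) *: w.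
Proof.
move=> Bw; elim: s => [|l s IH]; first by rewrite big_nil scale1r.
by rewrite /= IH linearZ /= Bw !scalerA -scalerBl big_cons; congr (_ *: _); ring.
Qed.

Lemma eig_prodB s u v : eig_prod s (u - v) = eig_prod s u - eig_prod s v.
Proof.
elim: s => //= l s ->; rewrite linearB /= scalerBr.
by move: (B _) (B _) (l *: _) (l *: _) => x y z t; rewrite !opprD !opprK addrACA.
Qed.

Lemma eig_prod_stable s w : P w -> P (eig_prod s w).
Proof.
by move=> Pw; elim: s => //= l s IH; apply: subspB => //; [exact: PB|exact: subspZ].
Qed.

Lemma eig_prodC s k w : eig_prod s (B w - k *: w) = B (eig_prod s w) - k *: eig_prod s w.
Proof.
elim: s => //= l s ->; move: (eig_prod s w) => u.
have BB a : B (B u - a *: u) = B (B u) - a *: B u by rewrite linearB linearZ.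
have key (x y z t : W) : x - z - (y - t) = x - y - (z - t).
  by rewrite !opprB addrACA [RHS]addrACA (addrC (- z)).
by rewrite !BB !scalerBr !scalerA (mulrC l) key.
Qed.

Lemma eig_prod_0 s : eig_prod s 0 = 0.
Proof. by elim: s => //= l s ->; rewrite linear0 scaler0 subrr. Qed.

Lemma eig_prod_rem s k w : k \in s -> eig_prod s w = eig_prod (rem k s) (B w - k *: w).
Proof.
elim: s => //= l s IH; rewrite inE [k == l]eq_sym.
by case: eqVneq => [-> _|_ /= ks]; [rewrite eig_prodC|rewrite IH].
Qed.

(** The factors commute, so further ones do no harm; thus weight ranges of different components can
    be merged into one. *)
Lemma eig_prod_subset s s' w : uniq s' -> uniq s -> {subset s <= s'} ->
  eig_prod s w = 0 -> eig_prod s' w = 0.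
Proof.
elim: s s' w => [s' w _ _ _ /= ->|k s IH s' w us' /= /andP[ks us] ss' w0].
  exact: eig_prod_0.
rewrite (eig_prod_rem w (ss' k (mem_head _ _))).
apply: IH => //; first exact: rem_uniq.
  move=> l ls; rewrite mem_rem_uniq // inE ss' ?inE ?ls ?orbT // andbT.
  by apply: contra ks => /eqP <-.
by rewrite eig_prodC.
Qed.

Definition eigenpart k w := P w /\ B w = k *: w.

Lemma subsp_eigenpart k : subsp (eigenpart k).
Proof.
split=> [|a u v [Pu Bu] [Pv Bv]].
  by split; [case: sP|rewrite linear0 scaler0].
split; first exact: (proj2 sP).
by rewrite linearP Bu Bv scalerDr !scalerA mulrC.
Qed.

(** On the kernel of the product over k :: s, the map e^-1 [eig_prod s] is the projection to the
    eigenspace of k, where e is nonzero because k is not in s. The kernel thus loses one eigenspace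
    at a time. *)
Lemma dim_eigen_sum (s : seq K) (d : K -> nat) : uniq s ->
  (forall k, k \in s -> dim_is (eigenpart k) (d k)) ->
  dim_is (fun w => P w /\ eig_prod s w = 0) (\sum_(k <- s) d k)%N.
Proof.
elim: s => [_ _|k s IH /= /andP[ks us] Hd].
  by rewrite big_nil; apply: dim0 => w [].
pose e := \prod_(l <- s) (k - l).
have e0 : e != 0.
  rewrite prodf_seq_neq0; apply/allP => l ls /=; rewrite subr_eq0.
  by apply: contra ks => /eqP ->.
have ss : subsp (fun w => P w /\ eig_prod s w = 0).
  have E0 : eig_prod s 0 = 0 by rewrite -{1}(subrr 0) eig_prodB subrr.
  have EZ a u : eig_prod s (a *: u) = a *: eig_prod s u.
    by elim: (s) => //= l s0 ->; rewrite linearZ /= scalerBr !scalerA (mulrC l).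
  split=> [|a u v [Pu u0] [Pv v0]]; first by split; [case: sP|].
  split; first exact: (proj2 sP).
  by rewrite -[v]opprK eig_prodB EZ u0 scaler0 sub0r -[- v]sub0r eig_prodB E0 v0 subrr oppr0.
rewrite big_cons; apply: (@dim_add _ _ (eigenpart k) (fun w => P w /\ eig_prod s w = 0)) => //.
- exact: subsp_eigenpart.
- move=> w; split=> [[Pw /= w0]|[w1 [w2 [[Pw1 Bw1] [Pw2 w20] ->]]]].
    pose u := eig_prod s w.
    have Bu : B u = k *: u by apply/eqP; rewrite -subr_eq0 w0.
    have Pu : P u by exact: eig_prod_stable.
    exists (e^-1 *: u), (w - e^-1 *: u).
    have Pu' : P (e^-1 *: u) by exact: subspZ.
    have Bu' : B (e^-1 *: u) = k *: (e^-1 *: u).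
      by rewrite linearZ /= Bu !scalerA mulrC.
    split=> //; last by rewrite addrC subrK.
    split; first exact: subspB.
    by rewrite eig_prodB (eig_prod_eig s Bu') scalerA divff // scale1r subrr.
  split; first exact: subspD.
  have -> : w1 + w2 = w2 - (- w1) by rewrite opprK addrC.
  have BN : B (- w1) = k *: (- w1) by rewrite linearN Bw1 scalerN.
  rewrite /= eig_prodB w20 (eig_prod_eig s BN) sub0r; set v := _ *: _.
  have Bv : B v = k *: v by rewrite /v linearZ /= BN !scalerA mulrC.
  by rewrite linearN Bv scalerN subrr.
- move=> w [Pw Bw] [_]; rewrite (eig_prod_eig s Bw) => /eqP.
  by rewrite scaler_eq0 (negbTE e0) => /eqP.
- by apply: Hd; rewrite mem_head.
- by apply: IH => // l ls; apply: Hd; rewrite inE ls orbT.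
Qed.
End EigenDecomposition.
End Dimension.

(** * The ladder of weight spaces and the quantization of the Casimir value *)

Section Ladder.
Variable R : realType.
Local Notation C := R[i].
Variables (V : lmodType C) (A E F : {linear V -> V}).
Hypothesis AE : forall v, A (E v) = E (A v) - 2 *: E v.
Hypothesis AF : forall v, A (F v) = F (A v) + 2 *: F v.
Hypothesis EF : forall v, E (F v) = F (E v) - 4 *: A v.
Hypothesis weight_ineq : forall v (p : int) (k : C), v != 0 -> A v = p%:~R *: v ->
  E (F v) = k *: v -> 0 <= 2 * p%:~R + complex.Re k.
Hypothesis dim_highest : forall n : nat, dim_is (fun v => A v = n%:R *: v /\ F v = 0) n.+1.

Lemma raise_weight v (p : int) : A v = p%:~R *: v -> A (F v) = (p + 2)%:~R *: F v.
Proof. by move=> Av; rewrite AF Av linearZ /= -scalerDl intrD. Qed.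

Lemma lower_weight v (p : int) : A v = p%:~R *: v -> A (E v) = (p - 2)%:~R *: E v.
Proof. by move=> Av; rewrite AE Av linearZ /= -scalerBl intrB. Qed.

Lemma raise_casimir v (p : int) (k : C) : A v = p%:~R *: v -> E (F v) = k *: v ->
  E (F (F v)) = (k - (4 * (p + 2))%:~R) *: F v.
Proof.
move=> Av Ev; rewrite EF Ev linearZ /= (raise_weight Av) scalerA -scalerBl.
by rewrite intrM.
Qed.

Lemma Re_int (z : int) : complex.Re (z%:~R : C) = z%:~R.
Proof. by rewrite -(rmorph_int (real_complex R)). Qed.

Lemma int_C_inj (a b : int) : (a%:~R = b%:~R :> C) -> a = b.
Proof. by move=> /eqP; rewrite eqr_int => /eqP. Qed.

(** The Casimir element E F + (A + 1)^2 takes the same value k + (p + 1)^2 on all of v, F v, F (F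
    v), and so on. *)
Lemma raise_iter v (p : int) (k : C) (j : nat) : A v = p%:~R *: v -> E (F v) = k *: v ->
  A (iter j F v) = (p + 2 * j%:Z)%:~R *: iter j F v /\
  E (F (iter j F v)) = (k + ((p + 1) ^+ 2 - (p + 2 * j%:Z + 1) ^+ 2)%:~R) *: iter j F v.
Proof.
move=> Av Ev; elim: j => [|j [IH1 IH2]] /=.
  by rewrite !mulr0 addr0 subrr mulr0z addr0.
split; first by rewrite (raise_weight IH1); congr (_%:~R *: _); lia.
rewrite (raise_casimir IH1 IH2) -addrA -intrB; congr ((_ + _%:~R) *: _); lia.
Qed.

(** As long as F^j v is nonzero, [weight_ineq] keeps (p + 2j)^2 + 1 below the constant Re k + (p +
    1)^2, so the chain stops. On its last nonzero member, of weight n, E F vanishes and the Casimir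
    value is (n + 1)^2. Applied to v itself, the inequality then says p^2 < (n + 1)^2. *)
Lemma casimir_quantization v (p : int) (k : C) : v != 0 -> A v = p%:~R *: v ->
  E (F v) = k *: v -> exists n j : nat,
  [/\ k = ((n%:Z + 1) ^+ 2 - (p + 1) ^+ 2)%:~R, n%:Z = p + 2 * j%:Z & - n%:Z <= p].
Proof.
move=> v0 Av Ev.
have stop : exists j, iter j F v == 0.
  apply: contrapT => /forallNP nz.
  have b j : ((p + 2 * j%:Z) ^+ 2 + 1)%:~R <= complex.Re k + ((p + 1) ^+ 2)%:~R :> R.
    have [a e] := raise_iter j Av Ev.
    have nzj : iter j F v != 0 by apply/negP; exact: nz.
    have := weight_ineq nzj a e; rewrite cReD Re_int => h.
    have -> : (p + 2 * j%:Z) ^+ 2 + 1 = (p + 1) ^+ 2 -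
      (2 * (p + 2 * j%:Z) + ((p + 1) ^+ 2 - (p + 2 * j%:Z + 1) ^+ 2)) by ring.
    rewrite intrB (intrD _ (2 * _)) (intrM _ 2); move: h.
    by move: (complex.Re k) ((p + 2 * j%:Z)%:~R) (((p + 1) ^+ 2)%:~R) (((_ - _))%:~R) => *; lra.
  pose x := complex.Re k + ((p + 1) ^+ 2)%:~R.
  pose j := (Num.bound `|x| + `|p|)%N.
  have := b j; rewrite -/x leNgt => /negP; apply.
  apply: le_lt_trans (ler_norm x) _; apply: lt_le_trans (archi_boundP (normr_ge0 x)) _.
  have -> : (Num.bound `|x|)%:R = (Num.bound `|x|)%:Z%:~R :> R by [].
  rewrite ler_int /j; move: (Num.bound `|x|) => m; nia.
have [j /eqP j0 jmin] := ex_minnP stop.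
case: j j0 jmin => [/= v00|j j0 jmin]; first by rewrite v00 eqxx in v0.
have nz : iter j F v != 0 by apply/negP => /jmin; rewrite ltnn.
have [a e] := raise_iter j Av Ev.
have := e; rewrite -[F _]/(iter j.+1 F v) j0 linear0 => /esym/eqP.
rewrite scaler_eq0 (negbTE nz) orbF => /eqP k0.
have kE : k = ((p + 2 * j%:Z + 1) ^+ 2 - (p + 1) ^+ 2)%:~R.
  by rewrite -[LHS]subr0 -k0 opprD addrA subrr sub0r -intrN opprB.
have := weight_ineq nz a; rewrite e k0 => /(_ 0 erefl).
rewrite addr0 pmulr_rge0 // ler0z => n0.
have := weight_ineq v0 Av Ev; rewrite kE Re_int => b.
have {b} : (0 <= 2 * p + ((p + 2 * j%:Z + 1) ^+ 2 - (p + 1) ^+ 2))%R.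
  by rewrite -(ler0z R) intrD intrM.
have [n nE] : exists n : nat, p + 2 * j%:Z = n%:Z by exists `|(p + 2 * j%:Z)%R|%N; lia.
rewrite nE => b; exists n, j; split; [by []|by rewrite -nE|nia].
Qed.

(** The vectors of weight p in the isotypic component of highest weight n; the second condition
    fixes the Casimir value. *)
Definition wt (n : nat) (p : int) (v : V) := A v = p%:~R *: v /\
  E (F v) = ((n%:Z + 1) ^+ 2 - (p + 1) ^+ 2)%:~R *: v.

Lemma subsp_wt n p : subsp (wt n p).
Proof.
split=> [|a u v [Au Eu] [Av Ev]]; first by split; rewrite !linear0.
by split; rewrite scalerDr !linearP /= ?Au ?Av ?Eu ?Ev !scalerA mulrC.
Qed.

Lemma wt_bound n p v : wt n p v -> v != 0 -> - n%:Z <= p <= n%:Z.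
Proof.
move=> [Av Ev] v0; have [m [j [kE mE pm]]] := casimir_quantization v0 Av Ev.
have {kE} /int_C_inj kE := kE.
by apply/andP; split; nia.
Qed.

Lemma wt_top n v : wt n n%:Z v <-> A v = n%:R *: v /\ F v = 0.
Proof.
split=> [[Av Ev]|[Av Fv]]; last first.
  by split; rewrite ?Av // Fv linear0 subrr scale0r.
split; first exact: Av.
have e := raise_casimir Av Ev.
have w : wt n (n%:Z + 2) (F v).
  by split; [exact: raise_weight|rewrite e -intrB; congr (_%:~R *: _); ring].
apply/eqP/negP => /negP Fv; have := wt_bound w Fv; lia.
Qed.

(** E carries weight p + 2 to weight p with inverse F / q, where q = (n + 1)^2 - (p + 1)^2 is
    nonzero for -n <= p < n. *)
Lemma dim_wt n j : (j <= n)%N -> dim_is (wt n (n%:Z - 2 * j%:Z)) n.+1.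
Proof.
elim: j => [_|j IH jn].
  rewrite mulr0 subr0; apply: dim_ext (dim_highest n) => w; split=> /wt_top //.
set p := n%:Z - 2 * j.+1%:Z.
have pE : n%:Z - 2 * j%:Z = p + 2 by rewrite /p; lia.
pose q : int := (n%:Z + 1) ^+ 2 - (p + 1) ^+ 2.
have q0 : q%:~R != 0 :> C by rewrite intr_eq0 /q /p; nia.
have FE v : wt n (p + 2) v -> F (E v) = q%:~R *: v.
  move=> [Av Ev]; have := EF v; rewrite Ev Av => /eqP.
  rewrite eq_sym subr_eq scalerA -scalerDl => /eqP ->.
  by rewrite -(intrM _ 4) -intrD; congr (_%:~R *: _); rewrite /q; ring.
apply: (@dim_iso _ _ _ (wt n (p + 2)) _ E (fun v => q%:~R^-1 *: F v)).
- exact: subsp_wt.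
- exact: linearP.
- move=> v wv; have [Av Ev] := wv; split.
    by rewrite (lower_weight Av); congr (_%:~R *: _); lia.
  by rewrite FE // linearZ.
- move=> v [Av Ev]; split; first by rewrite linearZ /= (raise_weight Av) !scalerA mulrC.
  rewrite !linearZ /= (raise_casimir Av Ev) -intrB !scalerA.
  by congr (_ * _%:~R *: _); ring.
- by move=> v wv; rewrite FE // scalerA mulVf // scale1r.
- by move=> v [Av Ev]; rewrite linearZ /= Ev scalerA mulVf // scale1r.
- by rewrite -pE; apply: IH; apply: ltnW.
Qed.

(** * The Dirac equation on one total weight *)

Section Dirac.
Variables (x t : C).
Hypotheses (t0 : t != 0).

(* The eigenvalue equation on the part of weight k, with t = 1/T and
   x = lambda + T/2. *)
Definition dirac_wt (k : int) (w : V * V) :=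
  [/\ A w.1 = (k - 1)%:~R *: w.1, A w.2 = (k + 1)%:~R *: w.2,
      E w.2 = (x + k%:~R * t) *: w.1 & F w.1 = (x - k%:~R * t) *: w.2].

Lemma dirac_wt_EF k w : dirac_wt k w ->
  E (F w.1) = (x ^+ 2 - (k%:~R * t) ^+ 2) *: w.1 /\
  E (F w.2) = (x ^+ 2 - (k%:~R * t) ^+ 2 - (4 * (k + 1))%:~R) *: w.2.
Proof.
move=> [w1 w2 w3 w4]; split.
  by rewrite w4 linearZ /= w3 scalerA; congr (_ *: _); ring.
rewrite EF w3 linearZ /= w4 w2 !scalerA -scalerBl intrM; congr (_ *: _); ring.
Qed.

(** The first alternative is missed only if f1 = 0 or f1 has the highest weight k - 1 = n. Then one
    component vanishes, the other one satisfies a linear equation, and the bounds on its weight fix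
    the sign of k; both situations lead to x = -|k| t. *)
Lemma dirac_wt_cases k w : dirac_wt k w -> w != 0 ->
  (exists n j : nat, [/\ n%:Z = k - 1 + 2 * j%:Z, - n%:Z <= k - 1 < n%:Z &
     x ^+ 2 - (k%:~R * t) ^+ 2 = ((n%:Z + 1) ^+ 2 - k ^+ 2)%:~R]) \/
  (k != 0 /\ x = - (`|k|%:~R * t)).
Proof.
move=> sw w0; have [w1 w2 w3 w4] := sw; have [e1 e2] := dirac_wt_EF sw.
(* If x^2 - (k t)^2 = 0, a nonzero f2 sits at the lowest weight k + 1 = -n. *)
have f2q : w.2 != 0 -> x ^+ 2 - (k%:~R * t) ^+ 2 = 0 -> k < 0.
  move=> f2 q0; rewrite q0 sub0r -intrN in e2.
  have [n [j [/int_C_inj nE jE nk]]] := casimir_quantization f2 w2 e2.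
  nia.
have [f1|f1] := eqVneq w.1 0.
  have f2 : w.2 != 0.
    by apply: contra w0 => /eqP f2; apply/eqP; case: (w) f1 f2 => a b /= -> ->.
  have xE : x = k%:~R * t.
    move: w4; rewrite f1 linear0 => /esym/eqP.
    by rewrite scaler_eq0 (negbTE f2) orbF subr_eq0 => /eqP.
  have k0 : k < 0 by apply: f2q => //; rewrite xE subrr.
  right; split; first by rewrite lt_eqF.
  by rewrite ltr0_norm // intrN mulNr opprK.
have kk : k = k - 1 + 1 by rewrite subrK.
have [n [j [nE jE nk]]] := casimir_quantization f1 w1 e1.
rewrite subrK in nE.
have [kn|kn] := ltP (k - 1) n%:Z; first by left; exists n, j; split=> //; rewrite kn andbT.
have kn' : k = n%:Z + 1 by lia.
have q0 : x ^+ 2 - (k%:~R * t) ^+ 2 = 0 by rewrite nE kn' subrr.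
right; split; first by lia.
have f20 : w.2 = 0.
  by apply/eqP/negP => /negP /f2q /(_ q0); lia.
move: w3; rewrite f20 linear0 => /esym/eqP; rewrite scaler_eq0 (negbTE f1) orbF addr_eq0 => /eqP ->.
by rewrite ger0_norm //; lia.
Qed.

(** Here x^2 - (k t)^2 is nonzero, so F f1 = (x - k t) f2 determines f2, and f1 ranges over a full
    weight space. *)
Lemma dim_dirac_wt1 (k : int) (n j : nat) : n%:Z = k - 1 + 2 * j%:Z -> - n%:Z <= k - 1 < n%:Z ->
  x ^+ 2 - (k%:~R * t) ^+ 2 = ((n%:Z + 1) ^+ 2 - k ^+ 2)%:~R ->
  dim_is (dirac_wt k) n.+1.
Proof.
move=> nj nk qE.
pose q := x ^+ 2 - (k%:~R * t) ^+ 2.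
have q0 : q != 0 by rewrite /q qE intr_eq0; nia.
have qM : q = (x + k%:~R * t) * (x - k%:~R * t) by rewrite /q; ring.
have [xp xm] : x + k%:~R * t != 0 /\ x - k%:~R * t != 0.
  by apply/andP; rewrite -negb_or -mulf_eq0 -qM.
have pE : k - 1 = n%:Z - 2 * j%:Z by lia.
have qw v : wt n (k - 1) v -> E (F v) = q *: v.
  by move=> [_ ->]; rewrite /q qE subrK.
apply: (@dim_iso _ _ _ (wt n (k - 1)) _
  (fun v => (v, (x - k%:~R * t)^-1 *: F v)) (fun w : V * V => w.1)).
- exact: subsp_wt.
- move=> a u v; rewrite [RHS]surjective_pairing /=; congr (_, _).
  by rewrite linearP scalerDr !scalerA mulrC.
- move=> v wv; have [Av _] := wv; split=> //=.
  + rewrite linearZ /= (raise_weight Av) !scalerA mulrC; congr (_%:~R * _ *: _); lia.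
  + by rewrite linearZ /= qw // scalerA qM mulrC mulfK.
  + by rewrite scalerA divff // scale1r.
- move=> w sw; have [w1 w2 w3 w4] := sw; split=> //.
  by have [-> _] := dirac_wt_EF sw; rewrite qE subrK.
- by [].
- move=> [f1 f2] [/= w1 w2 w3 w4]; rewrite w4 scalerA mulVf // scale1r //.
- by rewrite pE; apply: dim_wt; lia.
Qed.

(** With n = |k| - 1 the solutions are (f1, 0) with f1 of highest weight n for k > 0, and (0, f2)
    with f2 of lowest weight -n for k < 0: the other component would have a weight outside
    [-n, n]. *)
Lemma dim_dirac_wt2 (k : int) : k != 0 -> x = - (`|k|%:~R * t) -> dim_is (dirac_wt k) `|k|%N.
Proof.
move=> k0 xE.
have q0 : x ^+ 2 - (k%:~R * t) ^+ 2 = 0.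
  rewrite xE sqrrN !exprMn -mulrBl; have -> : (`|k|%:~R : C) ^+ 2 = k%:~R ^+ 2.
    by have [k'|k'] := leP 0 k; [rewrite ger0_norm|rewrite ltr0_norm // intrN sqrrN].
  by rewrite subrr mul0r.
have [n nE] : exists n : nat, `|k|%N = n.+1 by exists `|k|.-1; lia.
have Bd m p v : wt m p v -> ~~ (- m%:Z <= p <= m%:Z) -> v = 0.
  by move=> wv; apply: contraNeq; exact: wt_bound.
rewrite nE; have [kp|kn] := ltP 0 k.
  have kE : k - 1 = n%:Z by lia.
  have xk : x + k%:~R * t = 0 by rewrite xE gtr0_norm // addNr.
  apply: (@dim_iso _ _ _ (fun v => A v = n%:R *: v /\ F v = 0) _ (fun v => (v, 0))
    (fun w : V * V => w.1)).
  - split=> [|a u v [Au Fu] [Av Fv]]; first by rewrite !linear0.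
    by rewrite scalerDr !linearP /= Au Av Fu Fv linear0 addr0 !scalerA mulrC.
  - by move=> a u v; rewrite [RHS]surjective_pairing /= scaler0 addr0.
  - move=> v [Av Fv]; split; rewrite /= ?linear0 ?scaler0 //; last by rewrite xk scale0r.
    by rewrite kE.
  - move=> w sw; have [w1 w2 w3 w4] := sw; have [e1 e2] := dirac_wt_EF sw.
    apply/wt_top; split; first by rewrite -kE.
    by rewrite e1 q0 subrr.
  - by [].
  - move=> [f1 f2] sw; have [/= w1 w2 w3 w4] := sw; have [e1 e2] := dirac_wt_EF sw.
    congr (_, _); apply/esym; apply: (Bd n (k + 1)); last by lia.
    split=> //; rewrite e2 q0 sub0r -intrN; congr (_%:~R *: _).
    by rewrite -kE; ring.
  - exact: dim_highest.
have kE : k + 1 = - n%:Z by lia.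
have xk : x - k%:~R * t = 0 by rewrite xE ltr0_norm ?intrN ?mulNr ?opprK ?subrr //; lia.
apply: (@dim_iso _ _ _ (wt n (- n%:Z)) _ (fun v => (0, v)) (fun w : V * V => w.2)).
- exact: subsp_wt.
- by move=> a u v; rewrite [RHS]surjective_pairing /= scaler0 addr0.
- move=> v wv; have [Av Ev] := wv; split; rewrite /= ?linear0 ?scaler0 //.
  + by rewrite kE.
  (* E kills a lowest weight vector: F E v = 0 by the Casimir value, and a nonzero E v of weight -n
     - 2 would contradict [weight_ineq]. *)
  + have FE : F (E v) = 0.
      have := EF v; rewrite Ev Av => /eqP; rewrite eq_sym subr_eq scalerA -scalerDl -(intrM _ 4) -intrD.
      by move=> /eqP ->; rewrite (_ : _ + _ = 0) ?scale0r //; ring.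
    apply/eqP/negP => /negP Ev0.
    have := weight_ineq Ev0 (lower_weight Av); rewrite FE linear0 => /(_ 0).
    rewrite scale0r => /(_ erefl); rewrite addr0 pmulr_rge0 // ler0z; lia.
  + by rewrite xk scale0r.
- move=> w sw; have [w1 w2 w3 w4] := sw; have [e1 e2] := dirac_wt_EF sw.
  split; first by rewrite -kE.
  rewrite e2 q0 sub0r -intrN; congr (_%:~R *: _); rewrite kE; ring.
- by [].
- move=> [f1 f2] sw; have [/= w1 w2 w3 w4] := sw; have [e1 e2] := dirac_wt_EF sw.
  congr (_, _); apply/esym; apply: (Bd n (k - 1)); last by lia.
  split=> //; rewrite e1 q0 subrK (_ : _ - _ = 0) //.
  have -> : k = - n%:Z - 1 by lia. 
  ring.
- by have := dim_wt (leqnn n); congr (dim_is (wt n _) _); lia.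
Qed.
End Dirac.
End Ladder.

Definition int_range (K : nat) : seq int := [seq l%:Z - K%:Z | l <- iota 0 K.*2.+1].

Lemma mem_int_range K (k : int) : (k \in int_range K) = (`|k| <= K)%N.
Proof.
apply/mapP/idP => [[l] | kK]; first by rewrite mem_iota => lK ->; lia.
by exists `|(k + K%:Z)%R|%N; [rewrite mem_iota; lia|lia].
Qed.

Lemma int_range_uniq K : uniq (int_range K).
Proof. by rewrite map_inj_uniq ?iota_uniq // => a b; lia. Qed.

(** * Decomposition of the solution space into finitely many total weights *)

Section Total.
Variable R : realType.
Local Notation C := R[i].
Variables (V : lmodType C) (A E F : {linear V -> V}).
Hypothesis AE : forall v, A (E v) = E (A v) - 2 *: E v.
Hypothesis AF : forall v, A (F v) = F (A v) + 2 *: F v.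
Hypothesis EF : forall v, E (F v) = F (E v) - 4 *: A v.
Hypothesis band : forall (tau : R) (al be : C), 0 < tau -> exists K : nat, forall v,
  E (F v) = al *: v + be *: A v - tau%:C *: A (A v) ->
  eig_prod A [seq k%:~R | k <- int_range K] v = 0.
Variables (N : nat) (Q1 Q2 : V -> Prop).
Hypotheses (sQ1 : subsp Q1) (sQ2 : subsp Q2).
Hypotheses (Q1A : forall v, Q1 v -> Q1 (A v)) (Q2A : forall v, Q2 v -> Q2 (A v)).
Hypothesis Q1w : forall v (k : int), v != 0 -> A v = (k - 1)%:~R *: v -> Q1 v <-> (N%:Z %| k)%Z.
Hypothesis Q2w : forall v (k : int), v != 0 -> A v = (k + 1)%:~R *: v -> Q2 v <-> (N%:Z %| k)%Z.
Variables (x : C) (t : R).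
Hypothesis t0 : 0 < t.

Definition affine (a b : C) (v : V) : V := a *: v + b *: A v.

Lemma lin2 (G : {linear V -> V}) c d u v : G (c *: u + d *: v) = c *: G u + d *: G v.
Proof. by rewrite linearD !linearZ. Qed.

Lemma affineP a b : linear (affine a b).
Proof.
move=> c u v; rewrite /affine [A _]linearP !scalerDr !scalerA addrACA.
by rewrite (mulrC a) (mulrC b).
Qed.

Lemma affineM a b c d v : affine a b (affine c d v) =
  (a * c) *: v + (a * d + b * c) *: A v + (b * d) *: A (A v).
Proof. by rewrite /affine (lin2 A) !scalerDr !scalerA scalerDl !addrA. Qed.

Lemma affineC a b c d v : affine a b (affine c d v) = affine c d (affine a b v).
Proof. by rewrite !affineM (mulrC a c) (mulrC b d) addrC (mulrC a d) (mulrC b c) [X in X *: A v]addrC addrC. Qed.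

Lemma E_affine a b v : E (affine a b v) = affine (a + 2 * b) b (E v).
Proof.
have EA : E (A v) = A (E v) + 2 *: E v by rewrite AE subrK.
by rewrite /affine (lin2 E) EA scalerDr scalerA scalerDl (mulrC b) -!addrA; congr (_ + _); rewrite addrC.
Qed.

Lemma F_affine a b v : F (affine a b v) = affine (a - 2 * b) b (F v).
Proof.
have FA : F (A v) = A (F v) - 2 *: F v by rewrite AF addrK.
by rewrite /affine (lin2 F) FA scalerBr scalerA scalerBl (mulrC b) -!addrA; congr (_ + _); rewrite addrC.
Qed.

Definition dirac_eq (w : V * V) :=
  [/\ E w.2 = affine (x + t%:C) t%:C w.1, F w.1 = affine (x + t%:C) (- t%:C) w.2,
      Q1 w.1 & Q2 w.2].

Definition total_weight (w : V * V) : V * V := (affine 1 1 w.1, affine (- 1) 1 w.2).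

Lemma total_weight_linear : linear total_weight.
Proof.
by move=> a u v; rewrite [RHS]surjective_pairing /total_weight /= !affineP.
Qed.

Lemma subsp_dirac_eq : subsp dirac_eq.
Proof.
have aff0 a b : affine a b 0 = 0 by rewrite /affine !linear0 addr0.
split=> [|a u v [u1 u2 u3 u4] [v1 v2 v3 v4]].
  by split; rewrite /= ?linear0 ?aff0 //; [case: sQ1|case: sQ2].
split; rewrite /=; [| |exact: (proj2 sQ1)|exact: (proj2 sQ2)].
  by rewrite affineP [E _]linearP /= u1 v1.
by rewrite affineP [F _]linearP /= u2 v2.
Qed.

Lemma Q1_affine a b v : Q1 v -> Q1 (affine a b v).
Proof. by move=> q; apply: subspD => //; apply: subspZ => //; exact: Q1A. Qed.

Lemma Q2_affine a b v : Q2 v -> Q2 (affine a b v).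
Proof. by move=> q; apply: subspD => //; apply: subspZ => //; exact: Q2A. Qed.

Lemma dirac_eq_stable w : dirac_eq w -> dirac_eq (total_weight w).
Proof.
move=> [w1 w2 w3 w4]; split; rewrite /=.
- by rewrite E_affine w1 affineC; congr (affine _ _ (affine _ _ _)); ring.
- by rewrite F_affine w2 affineC; congr (affine _ _ (affine _ _ _)); ring.
- exact: Q1_affine.
- exact: Q2_affine.
Qed.

HB.instance Definition _ := GRing.isLinear.Build C (V * V)%type (V * V)%type *:%R
  total_weight total_weight_linear.

Local Notation Bw := (total_weight : {linear (V * V)%type -> (V * V)%type}).

Lemma eig_prod_total s w : eig_prod Bw s w =
  (eig_prod A [seq k - 1 | k <- s] w.1, eig_prod A [seq k + 1 | k <- s] w.2).
Proof.
elim: s => [|k s IH] /=; first by case: w.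
rewrite IH; set u1 := eig_prod A _ _; set u2 := eig_prod A _ _.
rewrite /= /total_weight /= [LHS]surjective_pairing /=; congr (_, _).
  by rewrite /affine !scale1r scalerBl scale1r opprB [RHS]addrCA addrA.
by rewrite /affine scale1r scaleN1r scalerDl scale1r opprD (addrC (- u2)) -addrA (addrC (- u2)).
Qed.

Lemma eig_prod_range (c : int) K K' v : (K + `|c| <= K')%N ->
  eig_prod A [seq k%:~R | k <- int_range K] v = 0 ->
  eig_prod A [seq l + c%:~R | l <- [seq k%:~R | k <- int_range K']] v = 0.
Proof.
have injC : injective (fun k : int => k%:~R : C).
  by move=> k l /eqP; rewrite eqr_int => /eqP.
have uK L : uniq [seq k%:~R : C | k <- int_range L] by rewrite (map_inj_uniq injC) int_range_uniq.
move=> KK; apply: eig_prod_subset.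
- by rewrite (map_inj_uniq (@addIr _ _)).
- exact: uK.
- move=> _ /mapP[k kK ->]; apply/mapP; exists (k - c)%:~R; last by rewrite intrB subrK.
  apply/mapP; exists (k - c) => //.
  by move: kK; rewrite !mem_int_range; lia.
Qed.

(** Substituting one equation into the other writes E F on each component as a quadratic polynomial
    in A with leading coefficient -t^2, the form required by [band]. The weights of the components
    differ from the total weight by 1, hence the successor in the range. *)
Lemma total_weight_bounded : exists K, forall w, dirac_eq w ->
  eig_prod Bw [seq k%:~R | k <- int_range K] w = 0.
Proof.
pose a := x + t%:C; pose b := - t%:C : C.
have t20 : 0 < t ^+ 2 by rewrite exprn_gt0.
have [K1 H1] := band ((a + 2 * b) * (x + t%:C)) ((a + 2 * b) * t%:C + b * (x + t%:C)) t20.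
have [K2 H2] := band ((x - t%:C) * (x + t%:C)) ((x - t%:C) * b + t%:C * a - 4) t20.
have bt : b * t%:C = - (t ^+ 2)%:C by rewrite /b mulNr rmorphXn /= expr2.
exists (K1 + K2).+1 => w [w1 w2 _ _].
rewrite eig_prod_total; have -> : 0 = (0, 0) :> V * V by [].
congr (_, _).
  apply: (@eig_prod_range (-1) K1); first by lia.
  by apply: H1; rewrite w2 E_affine w1 affineM -/a -/b bt scaleNr.
apply: (@eig_prod_range 1 K2); first by lia.
apply: H2; rewrite EF w1 F_affine w2 affineM -/a -/b.
have -> : x + t%:C - 2 * t%:C = x - t%:C by ring.
by rewrite [in RHS]scalerBl (mulrC t%:C b) bt scaleNr [LHS]addrAC addrA.
Qed.

Lemma eigenpart_total (k : int) w : eigenpart Bw dirac_eq k%:~R w <->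
  dirac_wt A E F x t%:C k w /\ (w = 0 \/ (N%:Z %| k)%Z).
Proof.
have wtE w' : total_weight w' = k%:~R *: w' <->
    A w'.1 = (k - 1)%:~R *: w'.1 /\ A w'.2 = (k + 1)%:~R *: w'.2.
  rewrite [k%:~R *: w']surjective_pairing /total_weight /affine /= !scale1r scaleN1r; split.
    case=> e1 e2; split; first by rewrite intrB scalerBl scale1r -e1 addrAC subrr add0r.
    by rewrite intrD scalerDl scale1r -e2 addrAC addNr add0r.
  case=> -> ->; rewrite intrB intrD scalerBl scalerDl !scale1r.
  by congr (_, _); [rewrite addrC subrK|rewrite addrC addrK].
have affE a b c (v : V) : A v = c *: v -> affine a b v = (a + c * b) *: v.
  by move=> Av; rewrite /affine Av scalerA -scalerDl (mulrC b).
have e1 : x + t%:C + (k - 1)%:~R * t%:C = x + k%:~R * t%:C by rewrite intrB; ring.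
have e2 : x + t%:C + (k + 1)%:~R * - t%:C = x - k%:~R * t%:C by rewrite intrD; ring.
split=> [[[w1 w2 w3 w4] /wtE[a1 a2]]|[[a1 a2 w1 w2] Nk]].
  split; first by split=> //; [rewrite w1 (affE _ _ _ _ a1) e1|rewrite w2 (affE _ _ _ _ a2) e2].
  have [f1|f1] := eqVneq w.1 0; last by right; apply/(Q1w f1 a1).
  have [f2|f2] := eqVneq w.2 0; last by right; apply/(Q2w f2 a2).
  by left; case: (w) f1 f2 => u v /= -> ->.
split; last exact/wtE.
have q0 Q (sQ : subsp Q) : Q 0 by case: sQ.
have F1 : Q1 w.1.
  have [->|f1] := eqVneq w.1 0; first exact: q0.
  by case: Nk => [w0|Nk]; [rewrite w0 eqxx in f1|apply/(Q1w f1 a1)].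
have F2 : Q2 w.2.
  have [->|f2] := eqVneq w.2 0; first exact: q0.
  by case: Nk => [w0|Nk]; [rewrite w0 eqxx in f2|apply/(Q2w f2 a2)].
by split=> //; [rewrite (affE _ _ _ _ a1) e1|rewrite (affE _ _ _ _ a2) e2].
Qed.

(** The last nonzero partial product applied to w is an eigenvector of the total weight and still a
    solution. *)
Lemma dirac_eq_weight w : dirac_eq w -> w != 0 -> exists (k : int) w',
  [/\ dirac_wt A E F x t%:C k w', w' != 0 & (N%:Z %| k)%Z].
Proof.
move=> Pw w0; have [K HK] := total_weight_bounded.
have := HK _ Pw; move: (int_range K) => s.
elim: s => [/= wz|k s IH /=]; first by rewrite wz eqxx in w0.
set u := eig_prod _ _ _ => uk.
have [/IH //|u0] := eqVneq u 0.
have Pu : dirac_eq u by apply: eig_prod_stable => //; [exact: subsp_dirac_eq|exact: dirac_eq_stable].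
have Bu : Bw u = k%:~R *: u by apply/eqP; rewrite -subr_eq0 uk.
have [du [uz|Nk]] := (eigenpart_total k u).1 (conj Pu Bu).
  by rewrite uz eqxx in u0.
by exists k, u.
Qed.

(** The last conclusion says that s misses no contributing weight; it allows the sum to be compared
    with sums over other index sets. *)
Lemma dim_dirac_eq (d : int -> nat) :
  (forall k, (N%:Z %| k)%Z -> dim_is (dirac_wt A E F x t%:C k) (d k)) ->
  (forall k, ~~ (N%:Z %| k)%Z -> d k = 0%N) ->
  exists s : seq int, [/\ uniq s, dim_is dirac_eq (\sum_(k <- s) d k)%N &
    forall k, d k != 0%N -> k \in s].
Proof.
move=> dN dN0; have [K HK] := total_weight_bounded.
have injC : injective (fun k : int => k%:~R : C).
  by move=> k l /eqP; rewrite eqr_int => /eqP.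
have dE k : dim_is (eigenpart Bw dirac_eq k%:~R) (d k).
  have [Nk|Nk] := boolP (N%:Z %| k)%Z.
    apply: dim_ext (dN k Nk) => w; split=> [wk|/eigenpart_total[]//].
    by apply/eigenpart_total; split=> //; right.
  rewrite dN0 //; apply: dim0 => w /eigenpart_total[_ [//|]].
  by rewrite (negbTE Nk).
exists (int_range K); split; first exact: int_range_uniq.
  have us : uniq [seq k%:~R : C | k <- int_range K].
    by rewrite (map_inj_uniq injC) int_range_uniq.
  (* [dim_eigen_sum] indexes eigenspaces by scalars, so d is extended by 0 to the complex
     numbers. *)
  pose dC (z : C) := if pselect (exists k : int, z = k%:~R) is left H then d (projT1 (cid H)) else 0%N.
  have dCE (k : int) : dC k%:~R = d k.
    rewrite /dC; case: pselect => [H|[]]; last by exists k.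
    by case: (cid H) => l /= /injC ->.
  have := @dim_eigen_sum _ _ Bw dirac_eq subsp_dirac_eq dirac_eq_stable _ dC us.
  rewrite big_map; under eq_bigr do rewrite dCE.
  move=> H; apply: dim_ext (H _); last by move=> _ /mapP[k _ ->]; rewrite dCE.
  by move=> w; split=> [[]//|Pw]; split=> //; exact: HK.
move=> k dk.
have [|w [Pw Bwk] w0] := dim_pos (dE k); first by rewrite lt0n.
have := HK _ Pw; rewrite (eig_prod_eig _ Bwk) => /eqP.
rewrite scaler_eq0 (negbTE w0) orbF prodf_seq_eq0 => /hasP[_ /mapP[l ls ->]] /=.
by rewrite subr_eq0 => /eqP/injC ->.
Qed.
End Total.

(** * Smooth functions on SU(2) *)

Section SmoothFunctions.
Variable R : realType.
Local Notation C := R[i].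
Local Notation ii := ('i%C : R[i]).

Definition csmooth_pred : {pred su2 R -> C} := fun f => `[< csmooth f >].

Lemma csmooth_submod : submod_closed csmooth_pred.
Proof.
split; first by apply/asboolP; exact: csmooth_cst.
by move=> a f h /asboolP sf /asboolP sh; apply/asboolP; apply: csmoothD => //; exact: csmoothZ.
Qed.

HB.instance Definition _ := GRing.isSubmodClosed.Build C (su2 R -> C) csmooth_pred csmooth_submod.

(** Bundled as a submodule of all functions, so that A, E and F are linear endomorphisms of one
    space and the abstract results apply. *)
Record smoothfun := SFun { sfun_val :> su2 R -> C; _ : sfun_val \in csmooth_pred }.
HB.instance Definition _ := [isSub for sfun_val].
HB.instance Definition _ := [Choice of smoothfun by <:].
HB.instance Definition _ := [SubChoice_isSubLmodule of smoothfun by <:].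

Lemma sfunP (f : smoothfun) : csmooth f.
Proof. by apply/asboolP; exact: (valP f). Qed.

Lemma mk_sfunP f : csmooth f -> f \in csmooth_pred.
Proof. by move=> sf; apply/asboolP. Qed.

Definition mk_sfun f (sf : csmooth f) : smoothfun := SFun (mk_sfunP sf).

Definition sd (a : axis) (f : smoothfun) : smoothfun := mk_sfun (csmooth_dd a (sfunP f)).

Lemma sdP a : linear (sd a).
Proof.
move=> k f h; apply: val_inj => /=.
by rewrite ddD ?ddZ //; first [exact: csmoothZ (sfunP _)|exact: sfunP].
Qed.

HB.instance Definition _ a := GRing.isLinear.Build C smoothfun smoothfun *:%R (sd a) (sdP a).

Arguments sfun_val : simpl never.

(** E and F are the off-diagonal entries of the Dirac operator. With these signs F raises the
    eigenvalue of A by 2 and E lowers it. *)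
Definition opA (f : smoothfun) : smoothfun := - ii *: sd axI f.
Definition opE (f : smoothfun) : smoothfun := sd axJ f + ii *: sd axK f.
Definition opF (f : smoothfun) : smoothfun := - sd axJ f + ii *: sd axK f.

Lemma sfun_ext (f h : smoothfun) : (forall g, f g = h g) -> f = h.
Proof. by move=> fh; apply: val_inj; apply/funext. Qed.

Lemma sfunDE (f h : smoothfun) g : (f + h) g = f g + h g. Proof. by []. Qed.
Lemma sfunNE (f : smoothfun) g : (- f) g = - f g. Proof. by []. Qed.
Lemma sfunZE (k : C) (f : smoothfun) g : (k *: f) g = k * f g. Proof. by []. Qed.
Lemma sfun0E g : (0 : smoothfun) g = 0. Proof. by []. Qed.
Definition sfunE := (sfunDE, sfunNE, sfunZE, sfun0E).

Lemma opAP : linear opA.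
Proof. by move=> k f h; apply: sfun_ext => g; rewrite /opA !linearP /= !sfunE; ring. Qed.
Lemma opEP : linear opE.
Proof. by move=> k f h; apply: sfun_ext => g; rewrite /opE !linearP /= !sfunE; ring. Qed.
Lemma opFP : linear opF.
Proof. by move=> k f h; apply: sfun_ext => g; rewrite /opF !linearP /= !sfunE; ring. Qed.

HB.instance Definition _ := GRing.isLinear.Build C smoothfun smoothfun *:%R opA opAP.
HB.instance Definition _ := GRing.isLinear.Build C smoothfun smoothfun *:%R opE opEP.
HB.instance Definition _ := GRing.isLinear.Build C smoothfun smoothfun *:%R opF opFP.

Lemma sd_comm a (f : smoothfun) g :
  sd a (sd (nxt a) f) g = sd (nxt a) (sd a f) g + 2 * sd (nxt (nxt a)) f g.
Proof.
have := congr1 (fun u => u g) (dd_commutator a (sfunP f)) => e.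
have {e} e : dd a (dd (nxt a) f) g - dd (nxt a) (dd a f) g = 2 * dd (nxt (nxt a)) f g by [].
by rewrite -[LHS]/(dd a (dd (nxt a) f) g) -[sd (nxt a) _ g]/(dd (nxt a) (dd a f) g)
  -[sd (nxt (nxt a)) f g]/(dd (nxt (nxt a)) f g) -e addrC subrK.
Qed.

Lemma i2 : ii * ii = -1 :> C.
Proof. by rewrite -expr2 sqr_i. Qed.

Lemma op_AE f : opA (opE f) = opE (opA f) - 2 *: opE f.
Proof.
apply: sfun_ext => g; rewrite /opA /opE !(linearD, linearZ) /= !sfunE.
have e1 := sd_comm axI f g; have e2 := sd_comm axK f g; rewrite /= in e1 e2.
rewrite e1 e2.
move: (sd axI _ g) (sd axJ _ g) (sd axJ f g) (sd axK f g) => x y u v.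
by ring: i2.
Qed.

Lemma op_AF f : opA (opF f) = opF (opA f) + 2 *: opF f.
Proof.
apply: sfun_ext => g; rewrite /opA /opF !(linearD, linearZ, linearN) /= !sfunE.
have e1 := sd_comm axI f g; have e2 := sd_comm axK f g; rewrite /= in e1 e2.
rewrite e1 e2.
move: (sd axI _ g) (sd axJ _ g) (sd axJ f g) (sd axK f g) => x y u v.
by ring: i2.
Qed.

Lemma op_EF f : opE (opF f) = opF (opE f) - 4 *: opA f.
Proof.
apply: sfun_ext => g; rewrite /opA /opE /opF !(linearD, linearZ, linearN) /= !sfunE.
have e1 := sd_comm axJ f g; rewrite /= in e1.
rewrite e1.
move: (sd axJ (sd axJ f) g) (sd axK (sd axJ f) g) (sd axK (sd axK f) g) (sd axI f g) => x y u v.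
by ring: i2.
Qed.

(** The mixed second derivatives combine to [J, K] = 2 I, a first order term. *)
Lemma op_EF_laplacian f g : opE (opF f) g =
  - (sd axJ (sd axJ f) g + sd axK (sd axK f) g) + 2 * ii * sd axI f g.
Proof.
rewrite /opE /opF !(linearD, linearZ, linearN) /= !sfunE.
have e1 := sd_comm axJ f g; rewrite /= in e1.
rewrite e1.
move: (sd axJ (sd axJ f) g) (sd axK (sd axJ f) g) (sd axK (sd axK f) g) (sd axI f g) => x y u v.
by ring: i2.
Qed.

Lemma opA_sd f : sd axI f = ii *: opA f.
Proof. by rewrite /opA scalerA mulrN i2 opprK scale1r. Qed.

Lemma sfun_neq0 (f : smoothfun) : f != 0 -> exists g, f g != 0.
Proof.
move=> f0; apply: contrapT => /forallNP H; case/eqP: f0.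
by apply: sfun_ext => g; apply/eqP/negPn/negP; exact: H.
Qed.

Lemma op_weight_ineq f (p : int) (k : C) : f != 0 -> opA f = p%:~R *: f ->
  opE (opF f) = k *: f -> 0 <= 2 * p%:~R + complex.Re k.
Proof.
move=> /sfun_neq0[g0 f0] Af Ef.
have If : sd axI f = (ii * p%:~R) *: f by rewrite opA_sd Af scalerA.
have If' : dd axI f = (ii * (p%:~R : R)%:C) *: (f : su2 R -> C).
  by have := congr1 (@sfun_val) If; rewrite rmorph_int.
have L : dd axI (dd axI f) + dd axJ (dd axJ f) + dd axK (dd axK f) =
    (- (p ^+ 2 + 2 * p)%:~R - k) *: (f : su2 R -> C).
  apply/funext => g.
  have := congr1 (fun h : smoothfun => h g) Ef; rewrite op_EF_laplacian sfunZE => e.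
  have II : sd axI (sd axI f) g = - (p ^+ 2)%:~R * f g.
    rewrite If linearZ /= If scalerA sfunZE rmorphXn /=; by ring: i2.
  have e' : sd axJ (sd axJ f) g + sd axK (sd axK f) g = - k * f g - 2 * p%:~R * f g.
    rewrite If !sfunZE in e; move: e.
    move: (sd axJ _ g + _) (f g) (p%:~R : C) => S u q e.
    transitivity (2 * ii * (ii * q * u) - k * u); first by rewrite -e; ring.
    by ring: i2.
  change (sd axI (sd axI f) g + sd axJ (sd axJ f) g + sd axK (sd axK f) g =
    (- (p ^+ 2 + 2 * p)%:~R - k) * f g).
  by rewrite -addrA e' II intrD intrM; ring.
have := weight_bound (sfunP f) f0 If' L.
rewrite cReD !cReN Re_int; rewrite intrD intrM rmorphXn /=.
by move: (complex.Re k) (p%:~R : R) => r q; lra.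
Qed.

Lemma opA_EF f : opE (opF (opA f)) = opA (opE (opF f)).
Proof.
have e1 := op_AF f; have e2 := op_AE (opF f).
rewrite e2 e1.
have -> : opE (opF (opA f) + 2 *: opF f) = opE (opF (opA f)) + 2 *: opE (opF f).
  by rewrite addrC opEP addrC.
by rewrite addrK.
Qed.

Lemma sqn_opA f g : sqn (opA f g) = sqn (dd axI f g).
Proof.
change (sqn (- ii * dd axI f g) = sqn (dd axI f g)).
by rewrite sqnM /sqn /=; ring.
Qed.

Lemma lapZ (tau : R) (k : C) (h : su2 R -> C) : csmooth h -> lap tau (k *: h) = k *: lap tau h.
Proof.
move=> sh; rewrite /lap; have s a := csmooth_dd a sh.
rewrite (ddZ axI k sh) (ddZ axJ k sh) (ddZ axK k sh).
rewrite (ddZ axI k (s axI)) (ddZ axJ k (s axJ)) (ddZ axK k (s axK)).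
by rewrite !scalerDr !scalerA mulrC.
Qed.

Lemma continuous_sqn (h : su2 R -> C) : csmooth h -> continuous (fun g => sqn (h g)).
Proof.
move=> sh; have c := csmooth_continuous (csmooth_n2 sh).
have -> : (fun g => sqn (h g)) = fun g => complex.Re ((h * cconj h) g).
  by apply/funext => g; rewrite n2E.
by move=> g; exact: (continuous_cvg _ (@continuous_Re R _) (c g)).
Qed.

(** A commutes with E F, so all iterates A^j f satisfy the same equation and [bernstein] applies
    with a single D: |A^j f|^2 <= D^j max |f|^2. Along g exp(tI) this is a geometric bound of ratio
    sqrt D, for which [band_limited] yields K independent of f and g. *)
Lemma op_band (tau : R) (al be : C) : 0 < tau -> exists K : nat, forall f,
  opE (opF f) = al *: f + be *: opA f - tau%:C *: opA (opA f) ->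
  eig_prod opA [seq k%:~R | k <- int_range K] f = 0.
Proof.
move=> tau0.
have [D D0 HD] := bernstein (- al) (ii * (be + 2)) tau0.
have [K HK] := band_limited (sqrtr_ge0 D).
exists K => f Ef.
pose fj j := iter j opA f.
have Efj j : opE (opF (fj j)) = al *: fj j + be *: fj j.+1 - tau%:C *: fj j.+2.
  have A3 (a b c : C) (u v w : smoothfun) :
      opA (a *: u + b *: v - c *: w) = a *: opA u + b *: opA v - c *: opA w.
    have A1 (k : C) (y : smoothfun) : opA (k *: y) = k *: opA y.
      by have := opAP k y 0; rewrite [opA 0]linear0 !addr0.
    by rewrite -!scaleNr -!addrA !opAP A1.
  elim: j => [|j IH]; first exact: Ef.
  by rewrite -[fj j.+1]/(opA (fj j)) opA_EF IH A3.
have Lfj j : lap tau (fj j) = (- al) *: (fj j : su2 R -> C) + (ii * (be + 2)) *: dd axI (fj j).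
  apply/funext => g; have := congr1 (fun h : smoothfun => h g) (Efj j).
  rewrite op_EF_laplacian !sfunE => e.
  have e1 : fj j.+1 g = - ii * sd axI (fj j) g by [].
  have e2 : fj j.+2 g = - sd axI (sd axI (fj j)) g.
    rewrite /fj /= -/(fj j) /opA linearZ /= scalerA !sfunZE; by ring: i2.
  change (tau%:C * sd axI (sd axI (fj j)) g + sd axJ (sd axJ (fj j)) g + sd axK (sd axK (fj j)) g
    = - al * fj j g + ii * (be + 2) * sd axI (fj j) g).
  have e' : sd axJ (sd axJ (fj j)) g + sd axK (sd axK (fj j)) g =
     2 * ii * sd axI (fj j) g - (al * fj j g + be * fj j.+1 g - tau%:C * fj j.+2 g).
    by rewrite -e; ring.
  rewrite -addrA e' e1 e2; ring.
have Lfj' j : lap tau (dd axI (fj j)) = (- al) *: dd axI (fj j) +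
     (ii * (be + 2)) *: dd axI (dd axI (fj j)).
  have L := Lfj j.+1.
  have dE : dd axI (fj j) = ii *: (fj j.+1 : su2 R -> C).
    by have := congr1 (@sfun_val) (opA_sd (fj j)).
  have s1 := sfunP (fj j.+1).
  rewrite dE (lapZ _ _ s1) L (ddZ axI _ s1); apply/funext => g.
  change (ii * (- al * fj j.+1 g + ii * (be + 2) * dd axI (fj j.+1) g) =
    - al * (ii * fj j.+1 g) + ii * (be + 2) * (ii * dd axI (fj j.+1) g)).
  by move: (fj j.+1 g) (dd axI _ g) => u v; ring.
apply: sfun_ext => g; rewrite sfun0E.
have [g0 gmax] := @su2_max R (fun g => sqn (f g)) (continuous_sqn (sfunP f)).
pose Q := sqn (f g0).
have bnd j g' : sqn (fj j g') <= D ^+ j * Q.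
  elim: j g' => [|j IH] g'; first by rewrite expr0 mul1r.
  rewrite exprS -mulrA /fj /= -/(fj j) sqn_opA.
  exact: (HD _ (sfunP (fj j)) (Lfj j) (Lfj' j)).
pose h j t := fj j (g * ex axI t)%g.
have ncE (z : C) : ComplexField.Normc.normc z = Num.sqrt (sqn z) by case: z.
have hQ : geometric_bound (Num.sqrt D) h (Num.sqrt Q).
  have sX j : Num.sqrt D ^+ j = Num.sqrt (D ^+ j).
    by elim: j => [|j IH]; rewrite ?sqrtr1 // !exprS IH -sqrtrM.
  move=> j t; rewrite ncE mulrC sX -sqrtrM ?exprn_ge0 //.
  exact: ler_wsqrtr (bnd _ _).
have dh : derivative_chain h.
  move=> j t.
  have e : dd axI (fj j) (g * ex axI t)%g = ii * h j.+1 t.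
    by rewrite -[LHS]/(sd axI (fj j) (g * ex axI t)%g) opA_sd.
  by rewrite -e; exact: hasdd_cder (csmooth_hasdd axI (sfunP (fj j))) g t.
have hper j t : h j (t + 2 * pi) = h j t by rewrite /h ex_2pi.
have key s j t : iter j opA (eig_prod opA s f) (g * ex axI t)%g = shift_prod s h j t.
  elim: s j t => [//|k s IH] j t /=.
  have itl (i : nat) (u v : smoothfun) : iter i opA (u - k *: v) = iter i opA u - k *: iter i opA v.
    by elim: i => [//|i IHi] /=; rewrite IHi addrC -scaleNr opAP scaleNr addrC.
  rewrite itl -iterSr !sfunE /shift_sub -/(shift_prod s h) -!IH //.
have key0 s : eig_prod opA s f g = shift_prod s h 0 0 by rewrite -key ex0 mulg1.
rewrite key0; have -> : [seq k%:~R | k <- int_range K] = [seq (freq R K l)%:C | l <- iota 0 K.*2.+1].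
  rewrite /int_range; move: (iota 0 K.*2.+1) => s; elim: s => [//|l s IHs] /=; rewrite IHs.
  by congr (_ :: _); rewrite /freq intrB rmorphB /= !rmorph_nat.
exact: (HK _ _ (sqrtr_ge0 Q) dh hQ hper).
Qed.
End SmoothFunctions.

(** * Highest weight vectors as polynomials in the matrix entries *)

Section HighestWeight.
Variable R : realType.
Local Notation C := R[i].
Local Notation ii := ('i%C : R[i]).
Local Notation smoothfun := (smoothfun R).

Lemma hasdd_entry a i j : hasdd a (fun g : su2 R => su2_mx g i j)
  (fun g => axis_mx R a 0 j * su2_mx g i 0 + axis_mx R a 1 j * su2_mx g i 1).
Proof.
move=> g; set d := _ + _.
have e t : su2_mx (g * ex a t)%g i j = (cos t)%:C * su2_mx g i j + (sin t)%:C * d.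
  rewrite su2_mulE quat_mx_rot mulmxDr -!scalemxAr mulmx1 mxE.
  by rewrite [X in X + _]mxE [X in _ + X]mxE mulmx2 /d; congr (_ + _ * _); ring.
under eq_fun do rewrite e.
have cder_real (u : R -> R) (r : R) : is_derive (0 : R) 1 u r -> cder (fun s => (u s)%:C : C) 0 r%:C.
  by move=> h; split=> //=; exact: is_derive_cst.
suff dE : d = ((- sin 0)%:C * su2_mx g i j + (cos 0)%:C * 0) + ((cos 0)%:C * d + (sin 0)%:C * 0).
  have := cderD (cderM (cder_real _ _ (is_derive_cos 0)) (cder_cst (su2_mx g i j) 0))
    (cderM (cder_real _ _ (is_derive_sin 0)) (cder_cst d 0)).
  by rewrite -dE.
by rewrite sin0 cos0 oppr0 !rmorph0 rmorph1; ring.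
Qed.

Lemma csmooth_entry i j : csmooth (fun g : su2 R => su2_mx g i j).
Proof.
have cE i' j' : continuous (fun g : su2 R => su2_mx g i' j').
  move=> g.
  have H := (@cvg_su2_mx R _ _ (nbhs_filter g) idfun g).1 (fun A => id).
  exact: ((cvg_mxP (nbhs_filter g) _ _).1 H).
move=> k; elim: k i j => [|k IH] i j; first exact: cE.
split=> [|a]; first exact: cE.
have H := hasdd_entry a i j; rewrite (hasdd_eq H); split; first exact: H.
by apply: CCD; apply: CCM; rewrite //; exact: CC_cst.
Qed.

(** For fixed al and ga the functions with j = 0, 1 transform like the basis of the two-dimensional
    representation, with weights 1 and -1. *)
Definition row_fun (al ga : C) (j : 'I_2) : smoothfun :=
  al *: mk_sfun (csmooth_entry 0 j) + ga *: mk_sfun (csmooth_entry 1 j).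

Lemma row_funE al ga j g : row_fun al ga j g = al * su2_mx g 0 j + ga * su2_mx g 1 j.
Proof. by []. Qed.

Lemma sd_row_fun a al ga j g : sd a (row_fun al ga j) g =
  axis_mx R a 0 j * row_fun al ga 0 g + axis_mx R a 1 j * row_fun al ga 1 g.
Proof.
have e i : sd a (mk_sfun (csmooth_entry i j)) g =
    axis_mx R a 0 j * su2_mx g i 0 + axis_mx R a 1 j * su2_mx g i 1.
  by rewrite -[LHS]/(dd a _ g) (hasdd_eq (hasdd_entry a i j)).
rewrite [sd a _](lin2 (sd a)) !sfunE !e.
move: (axis_mx R a 0 j) (axis_mx R a 1 j) => p q.
rewrite -![mk_sfun _ g]/(su2_mx g _ _); ring.
Qed.

Lemma op_row_fun al ga g :
  [/\ opA (row_fun al ga 0) = row_fun al ga 0, opA (row_fun al ga 1) = - row_fun al ga 1,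
      opE (row_fun al ga 0) g = - 2 * row_fun al ga 1 g & opE (row_fun al ga 1) g = 0] /\
  (opF (row_fun al ga 0) = 0 /\ opF (row_fun al ga 1) g = - 2 * row_fun al ga 0 g).
Proof.
have i2 := i2 R.
have e0 a h := sd_row_fun a al ga 0 h; have e1 a h := sd_row_fun a al ga 1 h.
move: (row_fun al ga 0) (row_fun al ga 1) e0 e1 => y z e0 e1.
split; split; rewrite ?/opA ?/opE ?/opF; try apply: sfun_ext => h;
  rewrite !sfunE !(e0, e1) /axis_mx !mx2E.
all: by rewrite -?complexiE; move: (y _) (z _) => u v; ring: i2.
Qed.

Fact csmooth_mul (f h : smoothfun) : csmooth ((f : su2 R -> C) * (h : su2 R -> C)).
Proof. by apply: csmoothM; exact: sfunP. Qed.

Definition smul (f h : smoothfun) : smoothfun := mk_sfun (csmooth_mul f h).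
Definition sone : smoothfun := mk_sfun (csmooth_cst 1).
Definition spow (f : smoothfun) (n : nat) : smoothfun := iter n (smul f) sone.

Lemma smulE f h g : smul f h g = f g * h g. Proof. by []. Qed.
Lemma soneE g : sone g = 1. Proof. by []. Qed.
Lemma spowE f n g : spow f n g = f g ^+ n.
Proof. by elim: n => [//|n IH]; rewrite exprS -IH. Qed.

Definition derivation (D : smoothfun -> smoothfun) :=
  forall f h g, D (smul f h) g = D f g * h g + f g * D h g.

Lemma derivation_sd a : derivation (sd a).
Proof.
move=> f h g; have := congr1 (fun u => u g) (ddM a (sfunP f) (sfunP h)).
exact.
Qed.

Lemma derivation_op : [/\ derivation (@opA R), derivation (@opE R) & derivation (@opF R)].
Proof.
by split=> f h g; rewrite /opA /opE /opF !sfunE !derivation_sd;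
  move: (f g) (h g) (sd axI f g) (sd axI h g) (sd axJ f g) (sd axJ h g) (sd axK f g) (sd axK h g)
    => *; ring.
Qed.

Lemma derivation_pow D f n g : derivation D -> D (spow f n) g = n%:R * f g ^+ n.-1 * D f g.
Proof.
move=> dD; elim: n => [|n IH].
  have := dD sone sone g; have -> : smul sone sone = sone by apply: sfun_ext => x; exact: mulr1.
  by rewrite soneE mulr1 mul1r mul0r mul0r -{1}[D sone g]addr0 => /addrI.
rewrite /spow iterS dD -/(spow f n) IH spowE /=.
by case: n {IH} => [|n] /=; rewrite ?expr0 ?exprS -?natr1; ring.
Qed.

Lemma sfun_constant (f : smoothfun) : (forall a g, sd a f g = 0) -> forall g, f g = f 1%g.
Proof.
move=> f0.
have step a g t : f (g * ex a t)%g = f g.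
  have := @cder_lipschitz R (fun s => f (g * ex a s)%g) (fun=> 0) 0 0 t.
  rewrite ex0 mulg1 mul0r mulr0 => H.
  apply/eqP; rewrite -subr_eq0; apply/eqP/nc_eq0/H => [x|x].
    by rewrite -(f0 a (g * ex a x)%g); exact: hasdd_cder (csmooth_hasdd a (sfunP f)) g x.
  by rewrite ComplexField.Normc.normc0.
move=> h; have [a [b [c [-> _ _]]]] := su2_euler h.
by rewrite !step -[ex axI a]mul1g step.
Qed.
Lemma opZ1 (G : {linear smoothfun -> smoothfun}) k u : G (k *: u) = k *: G u.
Proof. by rewrite linearZ. Qed.

Lemma op_EFg (f : smoothfun) g : opE (opF f) g = opF (opE f) g - 4 * opA f g.
Proof. by rewrite op_EF. Qed.

Section Spanning.
Variables (n : nat) (f : smoothfun).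
Hypotheses (Af : opA f = n%:R *: f) (Ff : opF f = 0).
Local Notation Ej := (fun j => iter j (@opE R) f).

Lemma op_lower j : opA (Ej j) = (n%:R - j.*2%:R) *: Ej j /\
  opF (Ej j.+1) = (4 * j.+1%:R * (n%:R - j%:R)) *: Ej j.
Proof.
elim: j => [|j [IH1 IH2]].
  split; first by rewrite subr0.
  apply: sfun_ext => g; have e : 0 = opF (opE f) g - 4 * (n%:R * f g).
    by have := op_EFg f g; rewrite Ff Af [opE 0]linear0.
  change (opF (opE f) g = (4 * 1 * (n%:R - 0)) * f g).
  by move: (opF _ g) (f g) e => u v /esym/eqP; rewrite subr_eq0 => /eqP ->; ring.
have a1 : opA (Ej j.+1) = (n%:R - j.+1.*2%:R) *: Ej j.+1.
  apply: sfun_ext => g; rewrite [opA (Ej j.+1)]op_AE IH1 (opZ1 (@opE R)) !sfunE doubleS -!natr1; ring.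
split=> //; apply: sfun_ext => g.
have e : 4 * j.+1%:R * (n%:R - j%:R) * Ej j.+1 g =
    opF (opE (Ej j.+1)) g - 4 * ((n%:R - j.+1.*2%:R) * Ej j.+1 g).
  by have := op_EFg (Ej j.+1) g; rewrite IH2 a1 (opZ1 (@opE R)).
change (opF (opE (Ej j.+1)) g = (4 * j.+2%:R * (n%:R - j.+1%:R)) * Ej j.+1 g).
move: (opF _ g) (Ej j.+1 g) e => u v e.
have -> : u = (u - 4 * ((n%:R - j.+1.*2%:R) * v)) + 4 * ((n%:R - j.+1.*2%:R) * v) by ring.
rewrite -e -mul2n natrM -!natr1; ring.
Qed.

(** A nonzero vector here would have weight -n - 2 and be killed by E F, which [op_weight_ineq]
    forbids. *)
Lemma op_lower_top : iter n.+1 (@opE R) f = 0.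
Proof.
have [a1 a2] := op_lower n; have [a3 _] := op_lower n.+1.
apply/eqP/negP => /negP nz.
have a3' : opA (Ej n.+1) = (- n%:Z - 2)%:~R *: Ej n.+1.
  rewrite a3; congr (_ *: _); rewrite intrB intrN doubleS -addnn; rewrite -!natr1 natrD /=; ring.
have e0 : opE (opF (Ej n.+1)) = 0 *: Ej n.+1.
  by rewrite a2 subrr mulr0 !scale0r [opE 0]linear0.
have := op_weight_ineq nz a3' e0; rewrite addr0 pmulr_rge0 // ler0z; lia.
Qed.

Variables (al ga : C).
Local Notation y := (row_fun al ga 0).
Local Notation z := (row_fun al ga 1).
(* With these coefficients the sum below telescopes to 0 under both E and F. *)
Definition pairing_coef (j : nat) : C := (2 ^ j * j`!)%:R^-1.
Local Notation ka := pairing_coef.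

Lemma pairing_coefS j : 2 * j.+1%:R * ka j.+1 = ka j.
Proof.
rewrite /ka factS expnS -!mulnA [(2 ^ j * _)%N]mulnCA mulnA natrM invfM mulrA natrM divff ?mul1r //.
Qed.

(** A term of the invariant pairing between the representation generated by f and the homogeneous
    polynomials of degree n in y and z. *)
Definition pairing_term j : smoothfun := ka j *: smul (Ej j) (smul (spow y j) (spow z (n - j))).
Definition pairing : smoothfun := \sum_(j < n.+1) pairing_term j.

Lemma pairing_op (D : {linear smoothfun -> smoothfun}) (u : nat -> C) g :
  u 0%N = u n.+1 -> (forall j, (j <= n)%N -> D (pairing_term j) g = u j.+1 - u j) -> D pairing g = 0.
Proof.
move=> u0 Du; rewrite /pairing linear_sum.
have sE (F : 'I_n.+1 -> smoothfun) : (\sum_(i < n.+1) F i) g = \sum_(i < n.+1) F i g.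
  by elim/big_rec2: _ => // i v w _ <-.
rewrite sE (eq_bigr (fun j : 'I_n.+1 => u j.+1 - u j)) => [|j _]; last by rewrite Du // -ltnS.
by rewrite -(big_mkord predT (fun j => u j.+1 - u j)) telescope_sumr // u0 subrr.
Qed.

Lemma derivation_term (D : {linear smoothfun -> smoothfun}) j g : derivation D ->
  D (pairing_term j) g = ka j * (D (Ej j) g * (y g ^+ j * z g ^+ (n - j)) +
    Ej j g * (j%:R * y g ^+ j.-1 * D y g * z g ^+ (n - j) +
      y g ^+ j * ((n - j)%:R * z g ^+ (n - j).-1 * D z g))).
Proof.
move=> dD; rewrite /pairing_term (opZ1 D) sfunZE dD dD smulE !(derivation_pow _ _ _ dD) !spowE.
by [].
Qed.

Lemma opE_pairing g : opE pairing g = 0.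
Proof.
have [_ dE _] := derivation_op; have [[_ _ Ey Ez] _] := op_row_fun al ga g.
apply: (@pairing_op (@opE R) (fun j => 2 * j%:R * ka j * Ej j g * y g ^+ j.-1 * z g ^+ (n.+1 - j))).
  by rewrite op_lower_top sfun0E !(mulr0, mul0r).
move=> j jn; rewrite derivation_term // Ey Ez pairing_coefS subSS.
rewrite (subSn jn) exprS /=; ring.
Qed.

Lemma opF_pairing g : opF pairing g = 0.
Proof.
have [_ _ dF] := derivation_op; have [_ [Fy Fz]] := op_row_fun al ga g.
apply: (@pairing_op (@opF R) (fun j => - (4 * j%:R * (n.+1 - j)%:R * ka j * Ej j.-1 g * y g ^+ j * z g ^+ (n.+1 - j).-1))).
  by rewrite subnn !(mulr0, mul0r).
move=> j jn; have Fyg : opF y g = 0 by rewrite Fy.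
rewrite derivation_term // Fyg Fz -pairing_coefS !subSS [j.+1.-1]/=.
have nj : (n.+1 - j)%:R = n%:R - j%:R + 1 :> C by rewrite subSn // -natr1 natrB.
have nj' : (n - j)%:R = n%:R - j%:R :> C by rewrite natrB.
have nj'' : (n.+1 - j).-1 = (n - j)%N by rewrite subSn.
rewrite nj'' nj nj'.
case: j jn {nj nj' nj''} => [|j] jn.
  have F0 : opF (Ej 0%N) g = 0 by change (opF f g = 0); rewrite Ff.
  by rewrite F0 /=; ring.
have FS : opF (Ej j.+1) g = 4 * j.+1%:R * (n%:R - j%:R) * Ej j g by rewrite (op_lower j).2.
rewrite FS [j.+1.-1]/= !exprS -!natr1.
move: (Ej j g) (Ej j.+1 g) => u v; ring.
Qed.

Lemma opA_pairing g : opA pairing g = 0.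
Proof.
have [dA _ _] := derivation_op; have [[Ay Az _ _] _] := op_row_fun al ga g.
apply: (@pairing_op (@opA R) (fun=> 0)) => // j jn.
have Ayg : opA y g = y g by rewrite Ay.
have Azg : opA z g = - z g by rewrite Az.
have Afg : opA (Ej j) g = (n%:R - j.*2%:R) * Ej j g by rewrite (op_lower j).1.
rewrite derivation_term // Ayg Azg Afg subrr.
have py (u : C) k : k%:R * u ^+ k.-1 * u = k%:R * u ^+ k by case: k => [|k]; rewrite ?mul0r // exprSr mulrA.
rewrite py mulrN py natrB // -addnn natrD; ring.
Qed.

Lemma pairing_constant g : pairing g = pairing 1%g.
Proof.
have i2 := i2 R.
apply: sfun_constant => a h.
have eA := opA_pairing h; have eE := opE_pairing h; have eF := opF_pairing h.
move: eA eE eF; rewrite /opA /opE /opF !sfunE.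
case: a; move: (sd axI _ h) (sd axJ _ h) (sd axK _ h) => u v w eA eE eF.
- by transitivity (ii * (- ii * u)); [ring: i2|rewrite eA mulr0].
- by transitivity (2^-1 * ((v + ii * w) - (- v + ii * w))); [field|rewrite eE eF subrr mulr0].
- by transitivity (- ii * 2^-1 * ((v + ii * w) + (- v + ii * w))); [field: i2|rewrite eE eF addr0 mulr0].
Qed.
End Spanning.

Lemma sum_sfunE d (F : 'I_d -> smoothfun) g : (\sum_(i < d) F i) g = \sum_(i < d) F i g.
Proof. by elim/big_rec2: _ => // i v w _ <-. Qed.

Definition highest n (f : smoothfun) := opA f = n%:R *: f /\ opF f = 0.

(** The coefficients al and ga may depend on the point g: for (-c, a) one has y(g) = 0 and z(g) =
    det g = 1, so at g only the term f(g) survives, while y(1) = -c and z(1) = a. Constancy of the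
    pairing equates the two values. *)
Lemma highest_expand n f g : highest n f ->
  f g = \sum_(j < n.+1) (pairing_coef j * iter j (@opE R) f 1%g) *
    ((- su2_mx g 1 0) ^+ j * su2_mx g 0 0 ^+ (n - j)).
Proof.
move=> [Af Ff]; set a := su2_mx g 0 0; set c := su2_mx g 1 0.
have yg : row_fun (- c) a 0 g = 0 by rewrite row_funE -/a -/c; ring.
have zg : row_fun (- c) a 1 g = 1.
  rewrite row_funE; have /andP[_ /eqP <-] := valP g.
  by rewrite det2 -/a -/c; ring.
have y1 : row_fun (- c) a 0 1%g = - c by rewrite row_funE !mxE /=; ring.
have z1 : row_fun (- c) a 1 1%g = a by rewrite row_funE !mxE /=; ring.
have := pairing_constant Af Ff (- c) a g; rewrite /pairing !sum_sfunE.
rewrite big_ord_recl big1 => [|j _]; last first.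
  by rewrite sfunZE !smulE !spowE yg expr0n /= !(mul0r, mulr0).
rewrite sfunZE !smulE !spowE yg zg addr0 expr0 expr1n !mulr1 /pairing_coef mul1n invr1 mul1r => ->.
by apply: eq_bigr => j _; rewrite sfunZE !smulE !spowE y1 z1 mulrA.
Qed.

Definition monomial n j : smoothfun :=
  smul (spow (row_fun 1 0 0) (n - j)) (spow (row_fun 0 1 0) j).

Lemma monomialE n j g : monomial n j g = su2_mx g 0 0 ^+ (n - j) * su2_mx g 1 0 ^+ j.
Proof. by rewrite smulE !spowE !row_funE !mul1r !mul0r addr0 add0r. Qed.

Lemma highest_monomial n j : (j <= n)%N -> highest n (monomial n j).
Proof.
move=> jn; have [dA _ dF] := derivation_op.
have py (u : C) k : k%:R * u ^+ k.-1 * u = k%:R * u ^+ k.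
  by case: k => [|k]; rewrite ?mul0r // exprSr mulrA.
split; apply: sfun_ext => g.
  have Ay al ga : opA (row_fun al ga 0) g = row_fun al ga 0 g.
    by have [[-> _ _ _] _] := op_row_fun al ga g.
  rewrite /monomial dA [RHS]sfunZE smulE !(derivation_pow _ _ _ dA) !Ay !py !spowE natrB //; ring.
have Fy al ga : opF (row_fun al ga 0) g = 0.
  by have [_ [-> _]] := op_row_fun al ga g.
by rewrite /monomial dF !(derivation_pow _ _ _ dF) !Fy !(mulr0, mul0r) addr0.
Qed.

(** On real matrices with first column proportional to (1, k) the relation says that k is a root of
    the polynomial with coefficients c; n + 1 natural numbers are too many roots. *)
Lemma monomials_free n (c : 'rV[C]_n.+1) : \sum_(j < n.+1) c 0 j *: monomial n j = 0 -> c = 0.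
Proof.
move=> c0; pose p := \poly_(j < n.+1) c 0 (inord j).
have root_p (k : nat) : root p k%:R.
  pose w : R := (Num.sqrt (1 + k%:R ^+ 2))^-1.
  have k0 : 0 < 1 + k%:R ^+ 2 :> R by rewrite ltr_pwDl // sqr_ge0.
  have w2 : w ^+ 2 * (1 + k%:R ^+ 2) = 1.
    by rewrite exprVn sqr_sqrtr ?(ltW k0) // mulVf // gt_eqF.
  have w0 : w%:C != 0 :> C by rewrite fmorph_eq0 invr_eq0 sqrtr_eq0 -ltNge.
  pose g := quat w 0 (- (w * k%:R)) 0.
  have gE : su2_mx g = quat_mx w 0 (- (w * k%:R)) 0 by apply: quatK; rewrite -[RHS]w2; ring.
  have g00 : su2_mx g 0 0 = w%:C by rewrite gE !mx2E.
  have g10 : su2_mx g 1 0 = w%:C * k%:R by rewrite gE !mx2E opprK -[LHS]/((w * k%:R)%:C) rmorphM /= rmorph_nat.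
  have := congr1 (fun f : smoothfun => f g) c0; rewrite sum_sfunE sfun0E.
  under eq_bigr => j _.
    rewrite sfunZE monomialE g00 g10 exprMn (mulrA (_ ^+ _)) -exprD subnK -1?ltnS //.
    rewrite mulrCA; over.
  rewrite -mulr_sumr => /eqP; rewrite mulf_eq0 expf_eq0 (negbTE w0) andbF /= => /eqP e.
  rewrite rootE horner_poly -[X in _ == X]e; apply/eqP/eq_bigr => j _.
  by rewrite inord_val.
have p0 : p = 0.
  apply/eqP/negP => /negP p0.
  have := max_poly_roots p0 (rs := [seq k%:R | k <- iota 0 n.+1]).
  rewrite size_map size_iota; have -> : all (root p) [seq k%:R | k <- iota 0 n.+1].
    by apply/allP => x /mapP[k _ ->].
  rewrite map_inj_uniq ?iota_uniq => [/(_ isT isT)|x y /eqP]; last by rewrite eqr_nat => /eqP.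
  by rewrite ltnNge size_poly.
apply/rowP => j; have := congr1 (fun q : {poly C} => q`_j) p0.
by rewrite coef_poly ltn_ord inord_val coef0 mxE.
Qed.

Lemma dim_highest n : dim_is (highest n) n.+1.
Proof.
exists (fun j : 'I_n.+1 => monomial n j); split=> [j|f Hf].
  by apply: highest_monomial; rewrite -ltnS.
pose c' : 'rV[C]_n.+1 := \row_j ((-1) ^+ j * (pairing_coef j * iter j (@opE R) f 1%g)).
have fE : f = \sum_(j < n.+1) c' 0 j *: monomial n j.
  apply: sfun_ext => g; rewrite (highest_expand g Hf) sum_sfunE; apply: eq_bigr => j _.
  by rewrite sfunZE monomialE mxE [(- su2_mx g 1 0) ^+ j]exprNn; ring.
exists c'; split=> // c; rewrite fE => cE.
apply/eqP; rewrite -subr_eq0; apply/eqP/(@monomials_free n).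
have E j : (c' - c) 0 j *: monomial n j = c' 0 j *: monomial n j - c 0 j *: monomial n j.
  by rewrite [(c' - c) 0 j]mxE [(- c) 0 j]mxE scalerBl.
by rewrite (eq_bigr _ (fun j _ => E j)) sumrB -cE subrr.
Qed.
End HighestWeight.

(** * Spinors on the lens space *)

Section SpinorCalculus.
Variable R : realType.
Local Notation C := R[i].
Local Notation ii := ('i%C : R[i]).
Implicit Types (psi : spinor R) (a : axis) (g : su2 R).

Definition component psi (i : 'I_2) : su2 R -> C := fun g => psi g i 0.

Lemma is_derive0P (f : R -> R) (d : R) :
  is_derive (0 : R) 1 f d <-> (fun t => t^-1 * (f t - f 0)) @ (0 : R)^' --> d.
Proof.
have e : (fun h : R => h^-1 *: ((f \o shift 0) (h *: (1 : R)) - f 0)) = fun t => t^-1 * (f t - f 0).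
  by apply/funext => t; rewrite /= addr0 [t *: 1]mulr1.
split=> [[df <-]|H]; first by rewrite /derive -e; exact: df.
split; first by rewrite /derivable e; apply/cvg_ex; exists d.
by rewrite /derive e; exact: cvg_lim H.
Qed.

Lemma cder0P (f : R -> C) (d : C) :
  cder f 0 d <-> (fun t => (t^-1)%:C * (f t - f 0)) @ (0 : R)^' --> d.
Proof.
have re (r : R) (z w : C) : complex.Re (r%:C * (z - w)) = r * (complex.Re z - complex.Re w).
  by rewrite cReM cReD cReN /= mul0r subr0.
have im (r : R) (z w : C) : complex.Im (r%:C * (z - w)) = r * (complex.Im z - complex.Im w).
  by rewrite cImM cImD cImN /= mul0r addr0.
rewrite cvg_complexP; under eq_fun do rewrite re.
under [X in _ /\ (X @ _ --> _)]eq_fun do rewrite im.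
by rewrite -!is_derive0P.
Qed.

Lemma diff_quotP a (s : R) psi g (l : 'cV[C]_2) :
  diff_quot (s%:C *: axis_mx R a) psi g t @[t --> (0 : R)^'] --> l <->
  forall i, cder (fun t => component psi i (g * ex a (t * s))%g) 0 (l i 0).
Proof.
rewrite cvg_mxP.
have e i j t : diff_quot (s%:C *: axis_mx R a) psi g t i j =
    (t^-1)%:C * (component psi i (g * ex a (t * s))%g - component psi i (g * ex a (0 * s))%g).
  by rewrite /diff_quot one_paramE mul0r ex0 mulg1 !mxE ord1.
split=> H i.
  by apply/cder0P; have := H i 0; under eq_fun do rewrite e.
by move=> j; rewrite ord1; under eq_fun do rewrite e; apply/cder0P; exact: H.
Qed.

Lemma derive_alongP a s psi (f : 'I_2 -> su2 R -> C) : (forall i, hasdd a (component psi i) (f i)) ->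
  derivable_along (s%:C *: axis_mx R a) psi /\
  forall g i, derive_along (s%:C *: axis_mx R a) psi g i 0 = s%:C * f i g.
Proof.
move=> H; pose l g : 'cV[C]_2 := \col_i (s%:C * f i g).
have cl g i : cder (fun t => component psi i (g * ex a (t * s))%g) 0 (l g i 0).
  rewrite mxE; have := @cder_affine R (fun t => component psi i (g * ex a t)%g) s 0 0 (f i g).
  rewrite mulr0 addr0 => /(_ (H i g)).
  by under eq_fun do rewrite addr0 mulrC.
have D g : diff_quot (s%:C *: axis_mx R a) psi g t @[t --> (0 : R)^'] --> l g.
  by apply/diff_quotP.
have der : derivable_along (s%:C *: axis_mx R a) psi by move=> g; apply/cvg_ex; exists (l g).
split=> // g i.
have /diff_quotP D' : diff_quot (s%:C *: axis_mx R a) psi g t @[t --> (0 : R)^'] -->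
  derive_along (s%:C *: axis_mx R a) psi g by exact: der.
by rewrite (cder_uniq (D' i) (cl g i)) mxE.
Qed.

Lemma derivable_along_hasdd a psi : derivable_along (axis_mx R a) psi ->
  forall i, hasdd a (component psi i) (component (derive_along (axis_mx R a) psi) i).
Proof.
move=> der i g; have := der g; rewrite -[axis_mx R a]scale1r => D.
have /(diff_quotP a 1) D' : diff_quot (1 *: axis_mx R a) psi g t @[t --> (0 : R)^'] -->
  derive_along (1 *: axis_mx R a) psi g by exact: D.
by have := D' i; under eq_fun do rewrite mulr1.
Qed.

Lemma continuous_comp psi : continuous psi <-> forall i, continuous (component psi i).
Proof.
split=> [c i g|c g].
  by have /(cvg_mxP (nbhs_filter g)) H := c g; exact: H.
by apply/(cvg_mxP (nbhs_filter g)) => i j; rewrite ord1; exact: c.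
Qed.

Lemma class_C_comp k psi : class_C k psi <-> forall i, CC k (component psi i).
Proof.
elim: k psi => [|k IH] psi; first exact: continuous_comp.
have ax a : axis_mx R a \in [:: su2_I R; su2_J R; su2_K R].
  by case: a; rewrite !inE eqxx ?orbT.
have axP X : X \in [:: su2_I R; su2_J R; su2_K R] -> exists a, X = axis_mx R a.
  by rewrite !inE => /or3P[] /eqP ->; [exists axI|exists axJ|exists axK].
split=> [[c H] i|H].
  split; first exact: (continuous_comp _).1.
  move=> a; have [der cl] := H _ (ax a); have h := derivable_along_hasdd der i.
  by rewrite (hasdd_eq h); split=> //; exact: (IH _).1.
split=> [|X /axP[a ->]]; first by apply/continuous_comp => i; case: (H i).
have [] := @derive_alongP a 1 psi (fun i => dd a (component psi i)).
  by move=> i; have [_ /(_ a)[]] := H i.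
rewrite scale1r => der E; split=> //; apply/IH => i.
have -> : component (derive_along (axis_mx R a) psi) i = dd a (component psi i).
  by apply/funext => g; rewrite /component E mul1r.
by have [_ /(_ a)[]] := H i.
Qed.

Lemma smooth_comp psi : smooth psi <-> forall i, csmooth (component psi i).
Proof.
by split=> [H i k|H k]; [exact: (class_C_comp k psi).1|apply/class_C_comp => i; exact: H].
Qed.
End SpinorCalculus.

(** * Equivariance under the cyclic group *)

Section Equivariance.
Variables (R : realType) (N : nat).
Hypothesis N0 : (0 < N)%N.
Local Notation C := R[i].
Local Notation ii := ('i%C : R[i]).
Local Notation smoothfun := (smoothfun R).

Implicit Types (f h : smoothfun) (z : C).

Definition theta : R := 2 * pi / N%:R.

Lemma exI_mx (s : R) : su2_mx (ex axI s) = mx2 (expi s) 0 0 (expi (- s)).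
Proof.
rewrite quat_mx_rot; apply: eq_mx2; rewrite !mx2E !mxE /= -?complexiE ?mulr0 ?addr0 //.
all: by apply/eqP; rewrite eq_complex /= ?cosN ?sinN; apply/andP; split; apply/eqP; ring.
Qed.

Lemma zgenE : zgen R N = ex axI theta.
Proof. by apply: val_inj; rewrite /= exI_mx. Qed.

Definition equivariant (z : C) (f : smoothfun) := forall g, f (g * ex axI theta)%g = z * f g.

Lemma subsp_equivariant z : subsp (equivariant z).
Proof.
split=> [g|a f h Hf Hh g]; first by rewrite !sfun0E mulr0.
by rewrite !sfunE Hf Hh; ring.
Qed.

Lemma equivariant_opA z f : equivariant z f -> equivariant z (opA f).
Proof.
move=> H g; suff e : sd axI f (g * ex axI theta)%g = z * sd axI f g by rewrite !sfunE e mulrCA.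
have h := csmooth_hasdd axI (sfunP f).
apply: (cder_uniq (h (g * ex axI theta)%g)).
have -> : (fun t => f (g * ex axI theta * ex axI t)%g) = fun t => z * f (g * ex axI t)%g.
  by apply/funext => t; rewrite -mulgA -exD addrC exD mulgA H.
by have := hasddZ z h g.
Qed.

(** The function exp(-ipt) f(g exp(tI)) has derivative 0. *)
Lemma weight_torus (p : int) f : opA f = p%:~R *: f ->
  forall g t, f (g * ex axI t)%g = expi (p%:~R * t) * f g.
Proof.
move=> Af g t; pose u s := expi (- p%:~R * s) * f (g * ex axI s)%g.
have du s : cder u s 0.
  have h := cderM (cder_expi (- p%:~R) s) (hasdd_cder (csmooth_hasdd axI (sfunP f)) g s).
  have e : dd axI f (g * ex axI s)%g = ii * (p%:~R * f (g * ex axI s)%g).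
    by rewrite -[LHS]/(sd axI f (g * ex axI s)%g) opA_sd Af.
  suff E : ii * (- p%:~R : R)%:C * expi (- p%:~R * s) * f (g * ex axI s)%g +
      expi (- p%:~R * s) * dd axI f (g * ex axI s)%g = 0 by rewrite E in h.
  by rewrite e rmorphN /= rmorph_int; move: (expi _) (f _) => v w; ring.
have := @cder_lipschitz R u (fun=> 0) 0 0 t du.
rewrite ComplexField.Normc.normc0 mul0r mulr0 => /(_ (fun=> lexx _))/nc_eq0/eqP.
rewrite subr_eq0 /u mulr0 expi0 ex0 mulg1 mul1r => /eqP <-.
by rewrite mulrA mulNr expiN mul1r.
Qed.

Lemma expi_2piz (q : int) : expi (q%:~R * (2 * pi)) = 1 :> C.
Proof.
case: q => n; first exact: expi_2pi.
have := expiN (n.+1%:R * (2 * pi) : R); rewrite expi_2pi mul1r => <-.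
by rewrite NegzE intrN mulNr.
Qed.

Lemma expi_dvd (k : int) : expi (k%:~R * theta) = 1 :> C <-> (N%:Z %| k)%Z.
Proof.
have N0' : N%:R != 0 :> R by rewrite pnatr_eq0 -lt0n.
have -> : expi (k%:~R * theta) = expi ((k %% N%:Z)%Z%:~R * theta) :> C.
  rewrite {1}(divz_eq k N%:Z) intrD mulrDl expiD intrM -mulrA.
  by rewrite (_ : N%:Z%:~R * theta = 2 * pi) ?expi_2piz ?mul1r // /theta mulrC divfK.
have r0 : (0 <= k %% N%:Z)%Z by rewrite modz_ge0 // eqz_nat -lt0n.
have rN : ((k %% N%:Z)%Z < N%:Z)%R by rewrite ltz_pmod.
have -> : (N%:Z %| k)%Z = ((k %% N%:Z)%Z == 0) by apply/dvdz_mod0P/eqP.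
move: (k %% N%:Z)%Z r0 rN => r r0 rN.
split=> [|/eqP ->]; last by rewrite mul0r expi0.
move=> e; apply: contraT => rn0.
have : expi (r%:~R * theta) != 1 :> C.
  have r1 : 0 < r%:~R :> R by rewrite ltr0z lt_def rn0.
  apply: expi_neq1; rewrite /theta mulrA mulr_gt0 ?mulr_gt0 ?pi_gt0 ?invr_gt0 ?ltr0n //=.
  rewrite ltr_pdivrMr ?ltr0n // mulrC ltr_pM2l ?mulr_gt0 ?pi_gt0 //.
  by rewrite -[N%:R]/(N%:Z%:~R) ltr_int.
by rewrite e eqxx.
Qed.

Lemma equivariant_weight (p : int) z f : f != 0 -> opA f = p%:~R *: f ->
  equivariant z f <-> expi (p%:~R * theta) = z.
Proof.
move=> /sfun_neq0[g0 f0] Af; split=> [H|<- g]; last exact: weight_torus.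
by apply: (mulIf f0); rewrite -(weight_torus Af) H.
Qed.

(** Weight k - 1 and the prescribed character both carry the factor exp(-i theta); cancelling it
    leaves exp(i k theta) = 1. *)
Lemma equivariant1_weight (k : int) f : f != 0 -> opA f = (k - 1)%:~R *: f ->
  equivariant (expi (- theta)) f <-> (N%:Z %| k)%Z.
Proof.
move=> f0 Af; rewrite (equivariant_weight _ f0 Af) -expi_dvd intrB mulrBl mul1r expiD.
have e0 : expi (- theta) != 0 :> C.
  by apply: contra_eq_neq (expiN theta) => ->; rewrite mulr0 eq_sym oner_eq0.
by split=> [/eqP|->]; [rewrite -{2}[expi (- theta)]mul1r => /eqP/(mulIf e0)|rewrite mul1r].
Qed.

Lemma equivariant2_weight (k : int) f : f != 0 -> opA f = (k + 1)%:~R *: f ->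
  equivariant (expi theta) f <-> (N%:Z %| k)%Z.
Proof.
move=> f0 Af; rewrite (equivariant_weight _ f0 Af) -expi_dvd intrD mulrDl mul1r expiD.
have e0 : expi theta != 0 :> C.
  by apply: contra_eq_neq (expiN theta) => ->; rewrite mul0r eq_sym oner_eq0.
by split=> [/eqP|->]; [rewrite -{2}[expi theta]mul1r => /eqP/(mulIf e0)|rewrite mul1r].
Qed.
End Equivariance.

(** * The eigenvalue equation of the lens space in components *)

Section LensSpinors.
Variables (R : realType) (N : nat) (T : R).
Hypotheses (N0 : (0 < N)%N) (T0 : 0 < T).
Local Notation C := R[i].
Local Notation ii := ('i%C : R[i]).
Local Notation smoothfun := (smoothfun R).
Implicit Types (w : smoothfun * smoothfun) (psi : spinor R) (lambda : C).

Definition spin w : spinor R := fun g => \col_i (if i == 0 then w.1 g else w.2 g).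

Lemma ord2P (P : 'I_2 -> Prop) : P 0 -> P 1 -> forall i, P i.
Proof.
move=> P0 P1 i; have [->//|->//] : i = 0 \/ i = 1.
by case: i => [[|[|i]] //= ?]; [left|right]; apply: val_inj.
Qed.

Lemma comp_spin w : (component (spin w) 0 = w.1) * (component (spin w) 1 = w.2).
Proof. by split; apply/funext => g; rewrite /component mxE. Qed.

Lemma smooth_spin w : smooth (spin w).
Proof. by apply/smooth_comp; apply: ord2P; rewrite comp_spin; exact: sfunP. Qed.

Lemma smoothP psi : smooth psi -> exists w, psi = spin w.
Proof.
move=> /smooth_comp H; exists (mk_sfun (H 0), mk_sfun (H 1)).
apply/funext => g; apply/colP; by apply: ord2P; rewrite mxE.
Qed.

Lemma mulmx_col2 (A : 'M[C]_2) (v : 'cV[C]_2) i : (A *m v) i 0 = A i 0 * v 0 0 + A i 1 * v 1 0.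
Proof.
have l0 : lift ord0 ord0 = 1 :> 'I_2 by apply: val_inj.
by rewrite mxE !big_ord_recl big_ord0 addr0 l0.
Qed.

Lemma lens_spinP w : lens_spinor N (spin w) <->
  equivariant N (expi (- theta R N)) w.1 /\ equivariant N (expi (theta R N)) w.2.
Proof.
have act g k : su2_mx ((zgen R N ^+ k)^-1)%g *m spin w g =
    \col_i (if i == 0 then expi (- theta R N) ^+ k * w.1 g else expi (theta R N) ^+ k * w.2 g).
  have zE : ((zgen R N ^+ k)^-1)%g = ex axI (- (k%:R * theta R N)).
    rewrite zgenE; apply: (@mulIg _ (ex axI (theta R N) ^+ k)%g); rewrite mulVg.
    elim: k => [|k IH]; first by rewrite mul0r oppr0 ex0 expg0 mulg1.
    rewrite expgS mulgA -exD IH; congr (_ * _)%g; congr ex; rewrite -natr1; ring.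
  rewrite zE exI_mx opprK !expiX mulrN; apply/colP; apply: ord2P;
    by rewrite mulmx_col2 !mx2E !mxE /= mul0r ?addr0 ?add0r.
split=> [[_ H]|[e1 e2]].
  have Z1 : ZN N (zgen R N) by exists 1%N; rewrite expg1.
  have H' g : spin w (g * ex axI (theta R N))%g = \col_i (if i == 0 then expi (- theta R N) * w.1 g else expi (theta R N) * w.2 g).
    by rewrite -zgenE (H _ _ Z1) -{1}(expg1 (zgen R N)) act !expr1.
  split=> g; have /colP := H' g; [move/(_ 0)|move/(_ 1)]; by rewrite !mxE.
split; first exact: smooth_spin.
move=> g gamma [k ->]; rewrite act.
elim: k g => [|k IH] g.
  by rewrite expg0 mulg1; apply/colP; apply: ord2P; rewrite !mxE /= expr0 mul1r.
rewrite expgS mulgA IH; apply/colP; apply: ord2P; rewrite !mxE /= zgenE ?e1 ?e2 exprSr mulrA //.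
Qed.

(** The two rows solved for E f2 and F f1. The constant T/2 + 1/T is divided between the shift x =
    lambda + T/2 and the summand t = 1/T. *)
Lemma dirac_spinP w lambda : (forall g, Defs.dirac T (spin w) g = lambda *: spin w g) <->
  opE w.2 = affine (@opA R) (lambda + (T / 2)%:C + (T^-1)%:C) (T^-1)%:C w.1 /\
  opF w.1 = affine (@opA R) (lambda + (T / 2)%:C + (T^-1)%:C) (- (T^-1)%:C) w.2.
Proof.
have der a s : forall g i, derive_along (s%:C *: axis_mx R a) (spin w) g i 0 =
    s%:C * (if i == 0 then sd a w.1 g else sd a w.2 g).
  have h i : hasdd a (component (spin w) i) (if i == 0 then dd a w.1 else dd a w.2).
    by move: i; apply: ord2P; rewrite comp_spin; exact: csmooth_hasdd (sfunP _).
  move=> g i; have [_ ->] := derive_alongP s h.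
  by case: eqP.
have der1 a g i : derive_along (axis_mx R a) (spin w) g i 0 =
    (if i == 0 then sd a w.1 g else sd a w.2 g).
  by have := der a 1 g i; rewrite scale1r mul1r.
have D g : Defs.dirac T (spin w) g = \col_i (if i == 0 then
    - (T^-1)%:C * opA w.1 g + opE w.2 g - (T / 2 + 1 / T)%:C * w.1 g
  else (T^-1)%:C * opA w.2 g + opF w.1 g - (T / 2 + 1 / T)%:C * w.2 g).
  have i2 := i2 R.
  have dI : forall i, derive_along (X1 T) (spin w) g i 0 =
      (T^-1)%:C * (if i == 0 then sd axI w.1 g else sd axI w.2 g) by exact: der axI T^-1 g.
  have dJ : forall i, derive_along (X2 R) (spin w) g i 0 =
      (if i == 0 then sd axJ w.1 g else sd axJ w.2 g) by exact: der1 axJ g.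
  have dK : forall i, derive_along (X3 R) (spin w) g i 0 =
      (if i == 0 then sd axK w.1 g else sd axK w.2 g) by exact: der1 axK g.
  rewrite /Defs.dirac.
  move: (derive_along _ _ g) (derive_along _ _ g) (derive_along _ _ g) dI dJ dK => u v y dI dJ dK.
  have e u' v' y' z' i : (u' + v' + y' - z' : 'cV[C]_2) i 0 = u' i 0 + v' i 0 + y' i 0 - z' i 0 by rewrite !mxE.
  have eZ c (v' : 'cV[C]_2) i : (c *: v') i 0 = c * v' i 0 by rewrite mxE.
  have sE i : spin w g i 0 = if i == 0 then w.1 g else w.2 g by rewrite mxE.
  apply/colP => i; rewrite [RHS]mxE e eZ !mulmx_col2 !dI !dJ !dK sE.
  have Aw (f : smoothfun) : opA f g = - ii * sd axI f g by [].
  have Ew (f : smoothfun) : opE f g = sd axJ f g + ii * sd axK f g by [].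
  have Fw (f : smoothfun) : opF f g = - sd axJ f g + ii * sd axK f g by [].
  rewrite !Aw Ew Fw.
  move: (w.1 g) (w.2 g) (sd axI w.1 g) (sd axI w.2 g) (sd axJ w.1 g) (sd axJ w.2 g)
    (sd axK w.1 g) (sd axK w.2 g) (T / 2 + 1 / T)%:C (T^-1)%:C => *.
  by move: i; apply: ord2P; rewrite !mx2E /= -?complexiE; ring: i2.
have c x f h g : affine (@opA R) x h f g = x * f g + h * opA f g by [].
have cE : (T / 2 + 1 / T)%:C = (T / 2)%:C + (T^-1)%:C :> C by rewrite div1r rmorphD.
split=> [H|[e1 e2] g].
  split; apply: sfun_ext => g; have /colP := H g; rewrite D cE c; [move/(_ 0)|move/(_ 1)];
    rewrite !mxE => e.
    have {}e : - (T^-1)%:C * opA w.1 g + opE w.2 g - ((T / 2)%:C + (T^-1)%:C) * w.1 g = lambda * w.1 g by exact: e.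
    move: (opE _ g) (opA _ g) (w.1 g) (T / 2)%:C (T^-1)%:C e => u v y p q e.
    have -> : u = (- q * v + u - (p + q) * y) + q * v + (p + q) * y by ring.
    by rewrite e; ring.
  have {}e : (T^-1)%:C * opA w.2 g + opF w.1 g - ((T / 2)%:C + (T^-1)%:C) * w.2 g = lambda * w.2 g by exact: e.
  move: (opF _ g) (opA _ g) (w.2 g) (T / 2)%:C (T^-1)%:C e => u v y p q e.
  have -> : u = (q * v + u - (p + q) * y) - q * v + (p + q) * y by ring.
  by rewrite e; ring.
rewrite D cE e1 e2 !c.
move: (opA _ g) (opA _ g) (T / 2)%:C (T^-1)%:C => u v p q.
by apply/colP; apply: ord2P; rewrite !mxE /=; ring.
Qed.
End LensSpinors.

Section Assembly.
Variables (R : realType) (N : nat) (T : R).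
Hypotheses (N0 : (0 < N)%N) (T0 : 0 < T).
Local Notation C := R[i].
Local Notation smoothfun := (smoothfun R).
Implicit Types (w : smoothfun * smoothfun) (psi : spinor R) (lambda : C).

Definition lens_eq lambda := dirac_eq (@opA R) (@opE R) (@opF R)
  (equivariant N (expi (- theta R N))) (equivariant N (expi (theta R N))) (lambda + (T / 2)%:C) T^-1.

Lemma eigenspace_spin lambda w : dirac_eigenspace N T lambda (spin w) <-> lens_eq lambda w.
Proof.
split=> [[/lens_spinP[q1 q2] /dirac_spinP[e1 e2]]|[e1 e2 q1 q2]]; first by split.
by split; [apply/lens_spinP|apply/dirac_spinP].
Qed.

Lemma has_dim_spin lambda d : dim_is (lens_eq lambda) d -> has_dim (dirac_eigenspace N T lambda) d.
Proof.
move=> [b [Pb Hb]]; exists (fun i => spin (b i)); split=> [i|psi Hpsi].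
  exact/eigenspace_spin.
have [w psiE] := smoothP Hpsi.1.1; rewrite psiE in Hpsi *.
have [c [cE cU]] := Hb _ ((eigenspace_spin _ _).1 Hpsi).
have spinE (c' : 'rV[C]_d) : w = \sum_(i < d) c' 0 i *: b i <->
    forall g, spin w g = \sum_(i < d) c' 0 i *: spin (b i) g.
  have S g (j : 'I_2) : (\sum_(i < d) c' 0 i *: spin (b i) g) j 0 =
      if j == 0 then (\sum_(i < d) c' 0 i *: b i).1 g else (\sum_(i < d) c' 0 i *: b i).2 g.
    rewrite summxE; elim/big_rec2: _ => [|i y1 y2 _ ->]; first by case: ifP.
    by rewrite !mxE; case: ifP.
  split=> [-> g|H].
    by apply/colP => j; rewrite S mxE.
  rewrite [LHS]surjective_pairing [RHS]surjective_pairing; congr pair; apply: sfun_ext => g.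
    by have /colP/(_ 0) := H g; rewrite S mxE.
  by have /colP/(_ 1) := H g; rewrite S mxE.
exists c; split; first exact/spinE.
by move=> c' /spinE; exact: cU.
Qed.

Lemma lens_eq_weight lambda w : lens_eq lambda w -> w != 0 -> exists (k : int) w',
  [/\ dirac_wt (@opA R) (@opE R) (@opF R) (lambda + (T / 2)%:C) (T^-1)%:C k w', w' != 0 & (N%:Z %| k)%Z].
Proof.
move=> H; apply: (dirac_eq_weight (@op_AE R) (@op_AF R) (@op_EF R) (@op_band R)) H.
- exact: subsp_equivariant.
- exact: subsp_equivariant.
- by move=> v; exact: equivariant_opA.
- by move=> v; exact: equivariant_opA.
- by move=> v k; exact: equivariant1_weight.
- by move=> v k; exact: equivariant2_weight.
- by rewrite invr_gt0.
Qed.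

Lemma dim_lens_eq lambda (d : int -> nat) :
  (forall k, (N%:Z %| k)%Z -> dim_is (dirac_wt (@opA R) (@opE R) (@opF R) (lambda + (T / 2)%:C) (T^-1)%:C k) (d k)) ->
  (forall k, ~~ (N%:Z %| k)%Z -> d k = 0%N) ->
  exists s : seq int, [/\ uniq s, dim_is (lens_eq lambda) (\sum_(k <- s) d k)%N &
    forall k, d k != 0%N -> k \in s].
Proof.
apply: (dim_dirac_eq (@op_AE R) (@op_AF R) (@op_EF R) (@op_band R)).
- exact: subsp_equivariant.
- exact: subsp_equivariant.
- by move=> v; exact: equivariant_opA.
- by move=> v; exact: equivariant_opA.
- by move=> v k; exact: equivariant1_weight.
- by move=> v k; exact: equivariant2_weight.
- by rewrite invr_gt0.
Qed.

(** A nonzero part of weight k gives x = -|k| / T, or x^2 = (n + 1)^2 - k^2 + (k / T)^2, which is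
    nonnegative because |k| <= n. *)
Lemma real_spectrum lambda psi : dirac_eigenspace N T lambda psi -> (exists g, psi g != 0) ->
  exists r : R, lambda = r%:C.
Proof.
move=> H [g g0]; have [w psiE] := smoothP H.1.1.
move: H; rewrite psiE => /eigenspace_spin Hw.
have w0 : w != 0.
  apply: contra_neq g0 => w0; rewrite psiE w0; apply/colP => i; rewrite !mxE.
  by case: ifP.
have [k [w' [sw w'0 _]]] := lens_eq_weight Hw w0.
have t0 : (T^-1)%:C != 0 :> C by rewrite fmorph_eq0 invr_eq0 gt_eqF.
suff [r xE] : exists r : R, lambda + (T / 2)%:C = r%:C.
  by exists (r - T / 2); rewrite rmorphB /= -xE addrK.
have [[n [j [nj nk xE]]]|[_ xE]] := dirac_wt_cases (@op_AF R) (@op_EF R) (@op_weight_ineq R) t0 sw w'0.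
  pose r : R := ((n%:Z + 1) ^+ 2 - k ^+ 2)%:~R + (k%:~R * T^-1) ^+ 2.
  have r0 : 0 <= r by rewrite addr_ge0 ?sqr_ge0 // ler0z; nia.
  have : (lambda + (T / 2)%:C) ^+ 2 = (Num.sqrt r)%:C ^+ 2.
    move/eqP: xE; rewrite subr_eq => /eqP ->.
    have -> : (Num.sqrt r)%:C ^+ 2 = r%:C :> C by rewrite -rmorphXn /= sqr_sqrtr.
    have rE (a b : R) : (a + b ^+ 2)%:C = a%:C + b%:C ^+ 2 :> C by rewrite rmorphD rmorphXn.
    by rewrite /r rE rmorphM /= !rmorph_int.
  move/eqP; rewrite eqf_sqr => /orP[] /eqP ->; first by exists (Num.sqrt r).
  by exists (- Num.sqrt r); rewrite rmorphN.
by exists (- (`|k|%:~R * T^-1)); rewrite xE rmorphN rmorphM /= rmorph_int.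
Qed.
End Assembly.

(** * Dimension of each weight part of an eigenspace *)

Section Multiplicities.
Variables (R : realType) (N : nat) (T lambda : R).
Hypotheses (N0 : (0 < N)%N) (Neven : ~~ odd N) (T0 : 0 < T).
Local Notation C := R[i].
Let x := lambda + T / 2.

Lemma intr_casimir (n : nat) (k : int) :
  ((n%:Z + 1) ^+ 2 - k ^+ 2)%:~R = (1 + n%:R) ^+ 2 - k%:~R ^+ 2 :> R.
Proof. by rewrite intrB !expr2 !intrM intrD [_ + 1%:~R]addrC. Qed.

(* For k = m * N: the parameters n and m give lambda in the first family. *)
Definition level (k : int) (n : nat) : bool :=
  [&& odd n, - n%:Z <= k - 1, k - 1 < n%:Z &
    x ^+ 2 == (1 + n%:R) ^+ 2 + k%:~R ^+ 2 * (1 / T ^+ 2 - 1)].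

Lemma level_unique k n m : level k n -> level k m -> n = m.
Proof.
move=> /and4P[_ _ _ /eqP e1] /and4P[_ _ _ /eqP e2].
have /addIr/eqP := etrans (esym e1) e2.
by rewrite !nat1r -!natrX eqr_nat eqn_exp2r // eqSS => /eqP.
Qed.

(** Given lambda, a weight k admits at most one n, so the first family contributes a single n + 1 or
    nothing. *)
Definition dim1 (k : int) : nat :=
  if ~~ (N%:Z %| k)%Z then 0%N else
  if pselect (exists n, level k n) is left h then (xchoose h).+1 else 0%N.

Definition dim2 (k : int) : nat :=
  if [&& (N%:Z %| k)%Z, k != 0 & x == - (`|k|%:~R / T)] then `|k|%N else 0%N.

Lemma dim1E k n : (N%:Z %| k)%Z -> level k n -> dim1 k = n.+1.
Proof.
move=> Nk kn; rewrite /dim1 Nk; case: pselect => [h|[]]; last by exists n.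
by congr (_.+1); apply: level_unique (xchooseP h) kn.
Qed.

Lemma dim1P k : dim1 k != 0%N -> (N%:Z %| k)%Z /\ exists2 n, level k n & dim1 k = n.+1.
Proof.
rewrite /dim1; case Nk : (N%:Z %| k)%Z => //=; case: pselect => // h _.
by split=> //; exists (xchoose h) => //; exact: xchooseP.
Qed.

(** Both conditions together would force (n + 1)^2 = k^2, although |k| <= n. Hence no weight
    contributes to both families. *)
Lemma level_exclusive k n : level k n -> x ^+ 2 = (k%:~R / T) ^+ 2 -> False.
Proof.
move=> /and4P[_ h1 h2 /eqP xE]; rewrite xE => e.
have : (((n%:Z + 1) ^+ 2 - k ^+ 2)%:~R : R) = 0.
  rewrite intr_casimir; move: e; rewrite expr_div_n => e.
  transitivity (((1 + n%:R) ^+ 2 + k%:~R ^+ 2 * (1 / T ^+ 2 - 1)) - k%:~R ^+ 2 / T ^+ 2 : R).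
    by ring.
  by rewrite e subrr.
by move/eqP; rewrite intr_eq0; nia.
Qed.

Lemma dim_weight k : (N%:Z %| k)%Z ->
  dim_is (dirac_wt (@opA R) (@opE R) (@opF R) (lambda%:C + (T / 2)%:C) (T^-1)%:C k) (dim1 k + dim2 k).
Proof.
move=> Nk; have t0 : (T^-1)%:C != 0 :> C by rewrite fmorph_eq0 invr_eq0 gt_eqF.
have xC : lambda%:C + (T / 2)%:C = x%:C :> C by rewrite -rmorphD.
(* The parity of N enters here: k is even, so n = k - 1 + 2j is odd as in [level], and conversely an
   odd n admits such a j. *)
have keven : ~~ odd `|k|%N.
  have Nk' : (N %| `|k|)%N by exact: Nk.
  by rewrite -dvdn2; apply: dvdn_trans Nk'; rewrite dvdn2.
have C2 (z : int) : x ^+ 2 - (k%:~R * T^-1) ^+ 2 = z%:~R <->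
    (lambda%:C + (T / 2)%:C) ^+ 2 - (k%:~R * (T^-1)%:C) ^+ 2 = z%:~R :> C.
  have sqrBC (a b : R) : (a ^+ 2 - b ^+ 2)%:C = a%:C ^+ 2 - b%:C ^+ 2 :> C.
    by rewrite rmorphB !rmorphXn.
  have -> : k%:~R * (T^-1)%:C = (k%:~R * T^-1)%:C :> C by rewrite rmorphM /= rmorph_int.
  rewrite xC -sqrBC -(rmorph_int (real_complex R)) /=.
  by split=> [->|/complexI].
have levelP n : (exists2 j : nat, n%:Z = k - 1 + 2 * j%:Z & - n%:Z <= k - 1 < n%:Z) ->
    x ^+ 2 - (k%:~R * T^-1) ^+ 2 = ((n%:Z + 1) ^+ 2 - k ^+ 2)%:~R -> level k n.
  move=> [j nj /andP[h1 h2]] e; apply/and4P; split=> //; first by lia.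
  apply/eqP; rewrite -[LHS](subrK ((k%:~R * T^-1) ^+ 2)) e intr_casimir.
  by field; rewrite gt_eqF.
have [[n kn]|nolevel] := pselect (exists n, level k n).
  have -> : dim2 k = 0%N.
    rewrite /dim2; case: ifP => // /and3P[_ _ /eqP xE]; case: (level_exclusive kn).
    rewrite xE sqrrN !exprMn; congr (_ * _).
    by have [k'|k'] := leP 0 k; [rewrite ger0_norm|rewrite ltr0_norm // intrN sqrrN].
  rewrite (dim1E Nk kn) addn0; have /and4P[on h1 h2 /eqP xE] := kn.
  have [j nj] : exists j : nat, n%:Z = k - 1 + 2 * j%:Z.
    by exists (`|(n%:Z - k + 1)%R| %/ 2)%N; lia.
  apply: (dim_dirac_wt1 (@op_AE R) (@op_AF R) (@op_EF R) (@op_weight_ineq R) (@dim_highest R) t0 nj).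
    by rewrite h1 h2.
  apply/C2; rewrite xE intr_casimir.
  by field; rewrite gt_eqF.
have -> : dim1 k = 0%N by rewrite /dim1 Nk; case: pselect.
rewrite add0n /dim2 Nk /=; case: ifP => [/andP[k0 /eqP xE]|H].
  apply: (dim_dirac_wt2 (@op_AE R) (@op_AF R) (@op_EF R) (@op_weight_ineq R) (@dim_highest R) t0) => //.
  by rewrite xC xE rmorphN rmorphM /= rmorph_int.
apply: dim0 => w sw; apply/eqP; apply: contraT => w0.
have [[n [j [nj nk xE]]]|[k0 xE]] := dirac_wt_cases (@op_AF R) (@op_EF R) (@op_weight_ineq R) t0 sw w0.
  by case: nolevel; exists n; apply: levelP; [exists j|apply/C2].
move: H; rewrite k0 /=; case/eqP; apply: (@complexI R).
by rewrite -xC xE rmorphN rmorphM /= rmorph_int.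
Qed.
End Multiplicities.

(** * Multiplicities *)

Section Counting.
Variables (R : realType) (N : nat) (T lambda : R).
Hypotheses (N0 : (0 < N)%N) (T0 : 0 < T).
Let x := lambda + T / 2.

Lemma big_support (I : eqType) (s s' : seq I) (F : I -> nat) : uniq s -> uniq s' ->
  (forall i, F i != 0%N -> i \in s) -> (forall i, F i != 0%N -> i \in s') ->
  (\sum_(i <- s) F i = \sum_(i <- s') F i)%N.
Proof.
move=> us us' Hs Hs'.
have nz (r : seq I) : (\sum_(i <- r) F i = \sum_(i <- [seq i <- r | F i != 0%N]) F i)%N.
  by rewrite big_filter [LHS](bigID (fun i => F i != 0%N)) /= [X in (_ + X)%N]big1 ?addn0 // => i /negPn/eqP.
rewrite nz [RHS]nz; apply: perm_big; apply: uniq_perm; rewrite ?filter_uniq // => i.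
by rewrite !mem_filter; case: eqP => //= /eqP i0; rewrite Hs ?Hs'.
Qed.

(** The radicand D is positive, so x is nonzero and its sign determines s. *)
Lemma eigenvalue1E n m (s : bool) : odd n -> - n%:Z <= m * N%:Z - 1 -> m * N%:Z - 1 < n%:Z ->
  eigenvalue1 N T n m s = lambda <-> s = (x < 0) /\ level T lambda (m * N%:Z) n.
Proof.
move=> on h1 h2; set D := (1 + n%:R) ^+ 2 + (m * N%:Z)%:~R ^+ 2 * (1 / T ^+ 2 - 1).
have D0 : 0 < D.
  have -> : D = ((n%:Z + 1) ^+ 2 - (m * N%:Z) ^+ 2)%:~R + ((m * N%:Z)%:~R / T) ^+ 2.
    by rewrite intr_casimir /D; field; rewrite gt_eqF.
  by rewrite ltr_pwDl ?sqr_ge0 // ltr0z; nia.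
have -> : eigenvalue1 N T n m s = - (T / 2) + (-1) ^+ s * Num.sqrt D.
  by rewrite /eigenvalue1 /D intrM exprMn.
have lE : level T lambda (m * N%:Z) n = (x ^+ 2 == D) by rewrite /level on h1 h2.
have -> : (- (T / 2) + (-1) ^+ s * Num.sqrt D = lambda) <-> x = (-1) ^+ s * Num.sqrt D.
  by split=> E; [rewrite /x -E|rewrite -[RHS](addrK (T / 2)) -/x E]; ring.
have s0 : 0 < Num.sqrt D by rewrite sqrtr_gt0.
rewrite lE; split=> [->|[-> /eqP xD]].
  rewrite exprMn sqr_sqrtr ?(ltW D0) // sqrr_sign mul1r eqxx; split=> //.
  by case: (s); rewrite ?expr1 ?expr0 ?mulN1r ?mul1r ?oppr_lt0 ?s0 // ltNge (ltW s0).
by rewrite -xD sqrtr_sqr; case: ltP => [x0|x0]; [rewrite ltr0_norm // expr1 mulN1r opprK|rewrite ger0_norm // mul1r].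
Qed.

(** For fixed lambda, m determines n and the sign of x determines s, so the triples are in bijection
    with the weights k = mN that have a level; f below is this bijection. *)
Lemma esum_first_family (s : seq int) : uniq s ->
  (forall k, dim1 N T lambda k != 0%N -> k \in s) ->
  \esum_(p in index1 N `&` [set p | let: (n, m, b) := p in eigenvalue1 N T n m b = lambda])
    (p.1.1.+1)%:R%:E = (\sum_(k <- s) dim1 N T lambda k)%:R%:E :> \bar R.
Proof.
move=> us Hs; set A := _ `&` _.
pose f k := ((dim1 N T lambda k).-1, (k %/ N%:Z)%Z, x < 0).
pose s1 := [seq f k | k <- s & dim1 N T lambda k != 0%N].
have NZ : N%:Z != 0 by lia.
have AE : A = [set` s1].
  apply/seteqP; split=> [[[n m] b]|p].
    move=> [[on /andP[h1 h2]] /= /(eigenvalue1E _ on h1 h2)[-> kn]].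
    have Nk : (N%:Z %| m * N%:Z)%Z by rewrite dvdz_mull.
    have dE := dim1E Nk kn.
    have -> : (n, m, x < 0) = f (m * N%:Z) by rewrite /f dE mulzK.
    by apply: map_f; rewrite mem_filter dE /=; apply: Hs; rewrite dE.
  move=> /mapP[k]; rewrite mem_filter => /andP[/dim1P[Nk [n kn dE]] _] ->.
  have kE : (k %/ N%:Z)%Z * N%:Z = k by rewrite divzK.
  have /and4P[on h1 h2 _] := kn.
  rewrite /f dE; split=> /=; first by rewrite kE h1 h2.
  by apply/(eigenvalue1E _ on); rewrite kE.
have us1 : uniq s1.
  rewrite map_inj_in_uniq ?filter_uniq // => k l; rewrite !mem_filter.
  move=> /andP[/dim1P[Nk _] _] /andP[/dim1P[Nl _] _] [_ e].
  by rewrite -(divzK Nk) e divzK.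
rewrite AE esum_fset; [|exact: finite_seq|by move=> i _; rewrite lee_fin].
rewrite -fsbig_seq // sumEFin; congr EFin.
rewrite big_map big_filter /= natr_sum [RHS](bigID (fun k => dim1 N T lambda k != 0%N)) /=.
rewrite [X in _ = _ + X]big1 ?addr0 => [|k /negPn/eqP -> //].
by apply: eq_bigr => k; case: (dim1 N T lambda k).
Qed.

(** At most one m gives lambda, and it stands for the two weights mN and -mN of dimension mN each.
    For m = 0 both sides vanish, since weight 0 is excluded from [dim2]. *)
Lemma esum_second_family (s : seq int) : uniq s ->
  (forall k, dim2 N T lambda k != 0%N -> k \in s) ->
  \esum_(m in [set m : nat | eigenvalue2 N T m = lambda]) (2 * m * N)%:R%:E =
    (\sum_(k <- s) dim2 N T lambda k)%:R%:E :> \bar R.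
Proof.
move=> us Hs.
have N0' : N%:R != 0 :> R by rewrite pnatr_eq0 -lt0n.
have T0' : T != 0 by rewrite gt_eqF.
have evE m : eigenvalue2 N T m = lambda <-> x = - (m%:R * N%:R / T).
  by rewrite /eigenvalue2; split=> E; [rewrite /x -E|rewrite -[RHS](addrK (T / 2)) -/x E]; ring.
have d2P k : dim2 N T lambda k != 0%N -> exists m : nat,
    [/\ `|k|%N = (m * N)%N, m != 0%N & x = - (m%:R * N%:R / T)].
  rewrite /dim2; case: ifP => // /and3P[Nk k0 /eqP xE] _.
  have /dvdnP[m mE] : (N %| `|k|)%N by exact: Nk.
  exists m; split=> //; first by apply: contra_neq k0 => m0; move: mE; rewrite m0; lia.
  by rewrite -natrM -mE /x xE -abszE.
have [[m mE]|none] := pselect (exists m, eigenvalue2 N T m = lambda); last first.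
  have -> : [set m | eigenvalue2 N T m = lambda] = set0.
    by apply/seteqP; split=> // m mE; case: none; exists m.
  rewrite esum_set0 big1_seq // => k _; apply/eqP; apply: contraT => /d2P[m [_ _ xE]].
  by case: none; exists m; apply/evE.
have xE := (evE m).1 mE.
have uniqm l : x = - (l%:R * N%:R / T) -> l = m.
  rewrite xE => /oppr_inj/(mulIf (invr_neq0 T0'))/(mulIf N0')/eqP.
  by rewrite eqr_nat => /eqP.
have -> : [set m | eigenvalue2 N T m = lambda] = [set m].
  by apply/seteqP; split=> [l /evE/uniqm //|l ->].
rewrite esum_set1 ?lee_fin //; congr (_%:R%:E).
have [m0|m0] := eqVneq m 0%N.
  rewrite m0 big1_seq ?mul0n ?muln0 // => k _; apply/eqP; apply: contraT.
  by move=> /d2P[l [_ l0 /uniqm lm]]; rewrite lm m0 in l0.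
have d2E k : `|k|%N = (m * N)%N -> dim2 N T lambda k = (m * N)%N.
  move=> kE; rewrite /dim2 -/x ifT // -abszE kE.
  by apply/and3P; split; [rewrite /dvdz unfold_in /= kE dvdn_mull|lia|rewrite xE -pmulrn natrM].
rewrite (@big_support _ s [:: (m * N)%:Z; - (m * N)%:Z]) //.
- by rewrite big_cons big_seq1 !d2E; lia.
- by rewrite /= inE andbT; lia.
- by move=> k /d2P[l [kE _ /uniqm lm]]; rewrite lm in kE; rewrite !inE; lia.
Qed.
End Counting.

Theorem theorem4p1 (R : realType) (N : nat) (T : R)
    (hN : (2 <= N)%N) (hNeven : ~~ odd N) (hT : 0 < T) :
  (forall (lambda : R[i]) (psi : spinor R),
      dirac_eigenspace N T lambda psi -> (exists g, psi g != 0) ->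
      exists r : R, lambda = r%:C) /\
  (forall lambda : R, exists d : nat,
      has_dim (dirac_eigenspace N T lambda%:C) d /\
      d%:R%:E = listed_multiplicity N T lambda).
Proof.
have N0 : (0 < N)%N by exact: ltnW.
split=> [lambda psi|lambda]; first exact: real_spectrum.
have [|k Nk|s [us ds Hs]] := @dim_lens_eq R N T N0 hT lambda%:C
  (fun k => dim1 N T lambda k + dim2 N T lambda k)%N.
- by move=> k; exact: dim_weight.
- by rewrite /dim1 /dim2 (negbTE Nk).
(* The finite list s contains the support of the sum of [dim1] and [dim2], hence that of each, and
   serves for both families. *)
exists (\sum_(k <- s) (dim1 N T lambda k + dim2 N T lambda k))%N.
split; first exact: has_dim_spin.
rewrite big_split natrD EFinD /listed_multiplicity.
rewrite (@esum_first_family R N T lambda N0 hT s) // => [|k dk]; last first.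
  by apply: Hs; rewrite addn_eq0 negb_and dk.
by rewrite (@esum_second_family R N T lambda N0 hT s) // => k dk; apply: Hs; rewrite addn_eq0 negb_and dk orbT.
Qed.
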